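(* The problem $\mathrm{SBD\text{-}EXT}(\mathrm{CNF}\to\mathrm{Horn})$ is in $\mathrm{para}\text{-}\mathrm{NP}$: given a CNF default theory $\langle W,D\rangle$ (without tautological clauses) and a strong Horn-backdoor $B\subseteq\mathrm{Vars}(W)\cup\mathrm{Vars}(D)$, parameterised by $|B|$, deciding whether $\langle W,D\rangle$ has a consistent stable extension is in $\mathrm{para}\text{-}\mathrm{NP}$.
   Context: Default theories, consistent stable extensions, extended literals, $\mathcal{A}_3(B)$ and the reduct default theory $\langle W,D\rangle[Y]$ are as follows. A default rule is $\frac{\alpha:\beta}{\gamma}$ with CNF formulas; $\langle W,D\rangle$ has a set $W$ of CNF formulas and set $D$ of default rules; $E$ is a stable extension if $E=\Gamma(E)$ where $\Gamma(E)$ is the smallest deductively closed set containing $W$ and containing $\gamma$ whenever $\frac{\alpha:\beta}{\gamma}\in D$, $\alpha\in\Gamma(E)$, $\neg\beta\notin E$; consistent means $\bot\notin E$. $\mathcal{A}_3(B)$ is the set of all $\{a_x:x\in B\}$ with $a_x\in\{x,\neg x,x_\varepsilon\}$; for a literal $\ell$, $\phi[\ell]$ deletes clauses containing $\ell$ and deletes $\sim\!\ell$ elsewhere, $\phi[x_\varepsilon]$ deletes all occurrences of $x,\neg x$. With $D=\{\delta_i=\frac{\alpha_i:\beta_i}{\gamma_i}\}$ and fresh variables $y_i$, $\langle W,D\rangle[Y]=(\{\omega[Y]:\omega\in W\},\{\frac{\alpha_i[Y]:\beta_i[Y]}{\gamma_i[Y]\land y_i}\})$. A clause is Horn if it has at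 most one positive literal. For a class $\mathcal{C}$ of CNF formulas, $B$ is a strong $\mathcal{C}$-backdoor of $\langle W,D\rangle$ if for every $Y\in\mathcal{A}_3(B)$ all formulas of $\langle W,D\rangle[Y]$ (in the knowledge base and in all default rules) belong to $\mathcal{C}$. A parameterised problem $L\subseteq\Sigma^*\times\mathbb{N}$ is in $\mathrm{para}\text{-}\mathcal{K}$ for a classical class $\mathcal{K}$ if there are a computable $f:\mathbb{N}\to\Sigma'^*$ and a classical problem $L'\in\mathcal{K}$ with $(x,k)\in L\iff(x,f(k))\in L'$. *)

(* Defs.v *)
From Stdlib Require Import BinNums BinNat.
From mathcomp Require Import all_boot.
Set Implicit Arguments. Unset Strict Implicit. Unset Printing Implicit Defensive.

(* A literal (v, true) is the variable v, (v, false) is its negation. *)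
Definition lit := (nat * bool)%type.
Definition clause := seq lit.
Definition cnf := seq clause.
Definition rule := (cnf * cnf * cnf)%type.
Definition rpre (r : rule) : cnf := r.1.1.
Definition rjust (r : rule) : cnf := r.1.2.
Definition rconcl (r : rule) : cnf := r.2.
Definition theory := (seq cnf * seq rule)%type.

Definition vars_cnf (f : cnf) : seq nat := flatten (map (map fst) f).
Definition vars_theory (T : theory) : seq nat :=
  flatten (map vars_cnf T.1) ++
  flatten (map (fun r => vars_cnf (rpre r) ++ vars_cnf (rjust r) ++ vars_cnf (rconcl r)) T.2).

Definition taut_clause (c : clause) : bool := has (fun l => (l.1, ~~ l.2) \in c) c.
Definition no_taut_cnf (f : cnf) : bool := all (fun c => ~~ taut_clause c) f.
Definition no_taut (T : theory) : bool :=
  all no_taut_cnf T.1 &&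
  all (fun r => [&& no_taut_cnf (rpre r), no_taut_cnf (rjust r) & no_taut_cnf (rconcl r)]) T.2.

Definition horn_clause (c : clause) : bool := count (fun l => l.2) c <= 1.
Definition horn_cnf (f : cnf) : bool := all horn_clause f.

(* Reducts by Y in A_3(B).  Y : nat -> option bool gives, for x in B,  *)
(* a_x = x (Some true), ~x (Some false) or x_eps (None); values of Y   *)
(* outside B are ignored, so quantifying over all Y ranges over A_3(B).*)

Definition red_clause (B : seq nat) (Y : nat -> option bool) (c : clause) : option clause :=
  if has (fun l => (l.1 \in B) && (Y l.1 == Some l.2)) c then None
  else Some (filter (fun l => l.1 \notin B) c).
Definition red_cnf (B : seq nat) (Y : nat -> option bool) (f : cnf) : cnf :=
  pmap (red_clause B Y) f.

Definition fresh_var (T : theory) (i : nat) : nat := (foldr maxn 0 (vars_theory T)).+1 + i.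

Definition red_theory (B : seq nat) (Y : nat -> option bool) (T : theory) : theory :=
  (map (red_cnf B Y) T.1,
   map (fun ir : nat * rule =>
          (red_cnf B Y (rpre ir.2), red_cnf B Y (rjust ir.2),
           red_cnf B Y (rconcl ir.2) ++ [:: [:: (fresh_var T ir.1, true)]]))
       (zip (iota 0 (size T.2)) T.2)).

Definition all_horn (T : theory) : bool :=
  all horn_cnf T.1 &&
  all (fun r => [&& horn_cnf (rpre r), horn_cnf (rjust r) & horn_cnf (rconcl r)]) T.2.

Definition strong_horn_backdoor (B : seq nat) (T : theory) : Prop :=
  forall Y : nat -> option bool, all_horn (red_theory B Y T).

Inductive form :=
| FBot | FVar of nat | FNeg of form | FAnd of form & form | FOr of form & form.

Fixpoint eval (v : nat -> bool) (f : form) : bool :=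
  match f with
  | FBot => false
  | FVar x => v x
  | FNeg g => ~~ eval v g
  | FAnd g h => eval v g && eval v h
  | FOr g h => eval v g || eval v h
  end.

Definition lit_form (l : lit) : form := if l.2 then FVar l.1 else FNeg (FVar l.1).
Definition clause_form (c : clause) : form := foldr (fun l acc => FOr (lit_form l) acc) FBot c.
Definition cnf_form (f : cnf) : form := foldr (fun c acc => FAnd (clause_form c) acc) (FNeg FBot) f.

Definition entails (S : form -> Prop) (phi : form) : Prop :=
  forall v : nat -> bool, (forall psi, S psi -> eval v psi) -> eval v phi.
Definition ded_closed (S : form -> Prop) : Prop := forall phi, entails S phi -> S phi.

Definition Gamma (T : theory) (E : form -> Prop) (phi : form) : Prop :=
  forall S : form -> Prop,
    (forall w, w \in T.1 -> S (cnf_form w)) ->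
    ded_closed S ->
    (forall r, r \in T.2 -> S (cnf_form (rpre r)) -> ~ E (FNeg (cnf_form (rjust r))) ->
       S (cnf_form (rconcl r))) ->
    S phi.

Definition stable_extension (T : theory) (E : form -> Prop) : Prop :=
  forall phi, E phi <-> Gamma T E phi.

Definition has_consistent_stable_extension (T : theory) : Prop :=
  exists E, stable_extension T E /\ ~ E FBot.

Fixpoint pos_bits (p : positive) : seq bool :=
  match p with
  | xH => [:: true]
  | xO q => rcons (pos_bits q) false
  | xI q => rcons (pos_bits q) true
  end.

(* self-delimiting binary encoding of a natural number *)
Definition enc_nat (n : nat) : seq bool :=
  let bits := match N.of_nat n with N0 => [::] | Npos p => pos_bits p end in
  flatten (map (fun b => [:: true; b]) bits) ++ [:: false; false].

Definition enc_seq (A : Type) (e : A -> seq bool) (s : seq A) : seq bool :=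
  flatten (map (fun a => true :: e a) s) ++ [:: false].

Definition enc_lit (l : lit) : seq bool := enc_nat l.1 ++ [:: l.2].
Definition enc_clause : clause -> seq bool := enc_seq enc_lit.
Definition enc_cnf : cnf -> seq bool := enc_seq enc_clause.
Definition enc_rule (r : rule) : seq bool :=
  enc_cnf (rpre r) ++ enc_cnf (rjust r) ++ enc_cnf (rconcl r).
Definition enc_instance (T : theory) (B : seq nat) : seq bool :=
  enc_seq enc_cnf T.1 ++ enc_seq enc_rule T.2 ++ enc_seq enc_nat B.

Definition pair_enc (x y : seq bool) : seq bool :=
  flatten (map (fun b => [:: true; b]) x) ++ [:: false; false] ++ y.

(* Deterministic single-tape Turing machines over {0,1,blank}          *)

Inductive dir := DL | DR | DS.

Record TM := MkTM {
  tm_Q : finType;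
  q_start : tm_Q;
  q_acc : tm_Q;
  q_rej : tm_Q;
  delta : tm_Q -> option bool -> tm_Q * option bool * dir
}.
Arguments q_start : clear implicits.
Arguments q_acc : clear implicits.
Arguments q_rej : clear implicits.
Arguments delta : clear implicits.

(* configuration: state, left tape (reversed), scanned symbol, right tape *)
Definition config (M : TM) := (tm_Q M * seq (option bool) * option bool * seq (option bool))%type.

Definition step (M : TM) (c : config M) : config M :=
  let: (q, l, a, r) := c in
  if (q == q_acc M) || (q == q_rej M) then c else
  let: (q', b, d) := delta M q a in
  match d with
  | DS => (q', l, b, r)
  | DL => match l with [::] => (q', [::], None, b :: r) | x :: l' => (q', l', x, b :: r) end
  | DR => match r with [::] => (q', b :: l, None, [::]) | x :: r' => (q', b :: l, x, r') end
  end.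

Arguments step : clear implicits.

Definition init (M : TM) (w : seq bool) : config M :=
  (q_start M, [::], head None (map Some w), behead (map Some w)).

Arguments init : clear implicits.

Definition run (M : TM) (t : nat) (w : seq bool) : config M := iter t (step M) (init M w).
Arguments run : clear implicits.

Definition state_of {M : TM} (c : config M) : tm_Q M := c.1.1.1.

Definition accepts_within (M : TM) (t : nat) (w : seq bool) : bool :=
  state_of (run M t w) == q_acc M.

Fixpoint somes (s : seq (option bool)) : seq bool :=
  match s with Some b :: s' => b :: somes s' | _ => [::] end.

Definition output {M : TM} (c : config M) : seq bool := somes (c.1.2 :: c.2).

Definition computable (f : nat -> seq bool) : Prop :=
  exists M : TM, forall k, exists t,
    state_of (run M t (nseq k true)) = q_acc M /\ output (run M t (nseq k true)) = f k.

Definition poly_bound (c d n : nat) : nat := c * n ^ d + c.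

Definition inNP (L : seq bool -> Prop) : Prop :=
  exists (M : TM) (c d : nat), forall x,
    L x <-> exists y, size y <= poly_bound c d (size x) /\
                      accepts_within M (poly_bound c d (size x)) (pair_enc x y).

Definition paraNP (L : seq bool -> nat -> Prop) : Prop :=
  exists f : nat -> seq bool, computable f /\
  exists L' : seq bool -> Prop, inNP L' /\
    forall x k, L x k <-> L' (pair_enc x (f k)).

Definition SBD_EXT_Horn (x : seq bool) (k : nat) : Prop :=
  exists (T : theory) (B : seq nat),
    x = enc_instance T B /\ k = size B /\ uniq B /\ no_taut T /\
    all (fun v => v \in vars_theory T) B /\ strong_horn_backdoor B T /\
    has_consistent_stable_extension T.

(* Main.v *)
From Stdlib Require Import BinNums BinNat FunctionalExtensionality.
Require Import Defs.
From mathcomp Require Import all_boot zify.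
From mathcomp Require Import boolp.
Set Implicit Arguments. Unset Strict Implicit. Unset Printing Implicit Defensive.

(* Membership of an instance is expressed by an existential second-order        *)
(* sentence over the positions of the string, and every such sentence defines   *)
(* an NP language: the certificate tabulates the relations, and the verifier    *)
(* evaluates the first-order part by nested loops over pointers.                *)
(*   The backdoor condition amounts to its instance in which every backdoor     *)
(* variable is deleted: each clause has at most one positive literal outside B. *)
(* Hence, once B is assigned, entailment is decided by unit propagation, whose  *)
(* successive stages are a certificate.  The parameter contributes the string   *)
(* 1 .. 1 of length 2^|B|; its positions serve as names of the assignments of   *)
(* B, and a valuation closed under single flips and separating all positions    *)
(* certifies that this length is right.  A stable extension is given by its     *)
(* generating defaults with a derivation order, refutations for the entailments *)
(* (one run of unit propagation per assignment of B), and models for the        *)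
(* consistency conditions.                                                      *)

(** * Programs and Turing machines *)

(** The advice computed from the parameter [k] is a string of [2 ^ k] ones ([pow2_computable]), so a
    classical NP problem may spend polynomial work on each assignment of the backdoor. That problem
    consists of the nonempty strings satisfying the existential second-order sentence [sbd_formula];
    [fagin_inNP] places it in NP.

    A consistent stable extension is determined by its generating defaults. [stable_sound] and
    [stable_complete] replace the fixed point by finitely many conditions: the fired conclusions are
    consistent with the knowledge base, each fired prerequisite follows from conclusions of smaller
    height, each fired justification is consistent, and every other default either lacks its
    prerequisite or has a refuted justification. Consistency and non-entailment are witnessed by
    single valuations. Entailment is coNP-hard in general, and here the backdoor helps: once its
    variables are assigned, each clause has at most one positive literal left ([backdoorE]), and
    unit propagation is sound and complete ([refute_sound], [refute_complete]), with fewer stages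
    than input positions. One short refutation per assignment therefore certifies an entailment.

    All certificates are relations on positions of the input string. [scan_axiomsE] recovers the
    parse of the string from guessed automaton states, [decode] recovers the theory from the emitted
    tokens, and [flip_closed_all] with [flip_closed_size] lets the ones of the advice name all
    assignments. [core_sound] and [core_complete] combine these facts. *)

Notation sym := (option bool).
(** [RT] and [RF] are answers for [If] to branch on; [RC] asks the enclosing [Loop] for another
    round. *)
Inductive res := RT | RF | RC.

Inductive prog :=
| Op of (sym -> sym * dir * res)
| If of prog & prog & prog
| Loop of prog.

Definition tape := nat -> sym.
Definition upd (F : tape) (e : nat) (b : sym) : tape :=
  fun i => if i == e then b else F i.
Definition mv (e : nat) (d : dir) : nat :=
  match d with DL => e.-1 | DR => e.+1 | DS => e end.

(** The number [t] only bounds the running time from above, whence the inequalities [t1 + t2 <= t].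
    The premise [d = DL -> 0 < e] keeps the head on nonnegative cells, the only ones that [tape] can
    describe. *)
Inductive exec : prog -> nat -> tape -> nat -> res -> tape -> nat -> Prop :=
| exOp g t F e b d x :
    g (F e) = (b, d, x) -> (d = DL -> 0 < e) -> 0 < t ->
    exec (Op g) t F e x (upd F e b) (mv e d)
| exIfT p p1 p2 t1 t2 t F e F1 e1 x F2 e2 :
    exec p t1 F e RT F1 e1 -> exec p1 t2 F1 e1 x F2 e2 -> t1 + t2 <= t ->
    exec (If p p1 p2) t F e x F2 e2
| exIfF p p1 p2 t1 t2 t F e F1 e1 x F2 e2 :
    exec p t1 F e RF F1 e1 -> exec p2 t2 F1 e1 x F2 e2 -> t1 + t2 <= t ->
    exec (If p p1 p2) t F e x F2 e2
| exLoopC p t1 t2 t F e F1 e1 x F2 e2 :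
    exec p t1 F e RC F1 e1 -> exec (Loop p) t2 F1 e1 x F2 e2 -> t1 + t2 <= t ->
    exec (Loop p) t F e x F2 e2
| exLoopE p t F e x F1 e1 :
    exec p t F e x F1 e1 -> x <> RC -> exec (Loop p) t F e x F1 e1.

Lemma exec_weaken p t t' F e x F' e' :
  exec p t F e x F' e' -> t <= t' -> exec p t' F e x F' e'.
Proof.
move=> H; elim: H t' => {p t F e x F' e'}.
- by move=> g t F e b d x Hg Hd Ht t' Htt'; apply: exOp => //; lia.
- move=> p p1 p2 t1 t2 t F e F1 e1 x F2 e2 H1 _ H2 _ Ht t' Htt'.
  by apply: (exIfT _ H1 H2); lia.
- move=> p p1 p2 t1 t2 t F e F1 e1 x F2 e2 H1 _ H2 _ Ht t' Htt'.
  by apply: (exIfF _ H1 H2); lia.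
- move=> p t1 t2 t F e F1 e1 x F2 e2 H1 _ H2 _ Ht t' Htt'.
  by apply: (exLoopC H1 H2); lia.
- by move=> p t F e x F1 e1 H IH Hx t' Htt'; apply: exLoopE => //; apply: IH.
Qed.

Definition row := sym -> nat * sym * dir.
Definition row0 : row := fun a => (0, a, DS).

Fixpoint psize (p : prog) : nat :=
  match p with
  | Op _ => 1
  | If p p1 p2 => psize p + psize p1 + psize p2
  | Loop p => psize p
  end.

(** Continuation passing: [base] is the address of the first row and [ex] sends each result to a
    target address. Control structure turns into jump targets, so it costs no machine steps. *)
Fixpoint compile (p : prog) (base : nat) (ex : res -> nat) : seq row :=
  match p with
  | Op g => [:: fun a => let: (b, d, x) := g a in (ex x, b, d)]
  | If p p1 p2 =>
      let b1 := base + psize p in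
      let b2 := b1 + psize p1 in
      compile p base (fun x => if x is RT then b1 else b2)
      ++ compile p1 b1 ex ++ compile p2 b2 ex
  | Loop p => compile p base (fun x => if x is RC then base else ex x)
  end.

Lemma size_compile p base ex : size (compile p base ex) = psize p.
Proof.
elim: p base ex => //= p IH p1 IH1 p2 IH2 base ex.
by rewrite !size_cat IH IH1 IH2 addnA.
Qed.

Definition machine (P : seq row) : TM :=
  @MkTM 'I_(size P).+2 ord0 (inord (size P)) (inord (size P).+1)
    (fun q a => let: (j, b, d) := nth row0 P q a in (inord j, b, d)).

Definition code_at (P : seq row) (base : nat) (c : seq row) : Prop :=
  exists P1 P2, P = P1 ++ c ++ P2 /\ size P1 = base.

(* Only the cells reachable without crossing position 0 are constrained, so   *)
(* that trailing blanks of the two half-tapes do not matter.                  *)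
Definition rep (l : seq sym) (a : sym) (r : seq sym) (F : tape) (e : nat) : Prop :=
  [/\ a = F e, forall i, nth None r i = F (e + i.+1)
    & forall i, i < e -> nth None l i = F (e - i.+1)].

Section Simulation.
Variable P : seq row.
Let M := machine P.

Lemma step_machine base c l a r F e j b d :
  code_at P base c -> 0 < size c -> rep l a r F e ->
  nth row0 c 0 (F e) = (j, b, d) -> (d = DL -> 0 < e) ->
  exists l' a' r', step M (inord base, l, a, r) = (inord j, l', a', r') /\
     rep l' a' r' (upd F e b) (mv e d).
Proof.
move=> [P1 [P2 [EP sP]]] sc [Ea Hr Hl] Hc Hd.
have lb : base < size P by rewrite EP !size_cat; lia.
have Erow : nth row0 P base = nth row0 c 0.
  by rewrite EP nth_cat sP ltnn subnn nth_cat sc.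
rewrite /step /=.
have -> : ((inord base : 'I_(size P).+2) == inord (size P)) = false.
  by apply/negbTE/eqP => /(congr1 val) /=; rewrite !inordK; lia.
have -> : ((inord base : 'I_(size P).+2) == inord (size P).+1) = false.
  by apply/negbTE/eqP => /(congr1 val) /=; rewrite !inordK; lia.
rewrite /= inordK; last by lia.
rewrite Erow Ea Hc.
case: d Hd Hc => Hd Hc.
- have e0 : 0 < e by apply: Hd.
  case: l Hl => [|x l] Hl.
  + exists [::], None, (b :: r); split => //; split.
    * by have := Hl 0 e0; rewrite /= /upd /mv; case: eqP => [|_] //; [lia|rewrite -subn1].
    * case=> [|i] /=; first by rewrite /upd; case: eqP => //; lia.
      rewrite Hr /upd; case: eqP; first by lia.
      by move=> _; congr F; lia.
    * move=> i Hi; rewrite /= in Hi; have := Hl i.+1; rewrite !nth_nil => ->; last by lia.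
      by rewrite /upd /mv; case: eqP; [lia|]; move=> _; congr F; lia.
  + exists l, x, (b :: r); split => //; split.
    * have := Hl 0 e0; rewrite /= /upd /mv; case: eqP => [|_]; first by lia.
      by rewrite -subn1.
    * case=> [|i] /=; first by rewrite /upd; case: eqP => //; lia.
      rewrite Hr /upd; case: eqP; first by lia.
      by move=> _; congr F; lia.
    * move=> i Hi; rewrite /= in Hi; have := Hl i.+1; rewrite /= => ->; last by lia.
      by rewrite /upd /mv; case: eqP; [lia|]; move=> _; congr F; lia.
- case: r Hr => [|x r] Hr.
  + exists (b :: l), None, [::]; split => //; split.
    * have := Hr 0; rewrite /= /upd /mv; case: eqP => [|_]; first by lia.
      by rewrite addn1.
    * move=> i; have := Hr i.+1; rewrite !nth_nil => ->.
      by rewrite /upd /mv; case: eqP; [lia|]; move=> _; congr F; lia.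
    * case=> [|i] Hi /=; first by rewrite /upd; case: eqP => //; lia.
      rewrite /= in Hi; rewrite Hl; last by lia.
      by rewrite /upd; case: eqP; [lia|]; move=> _; congr F; lia.
  + exists (b :: l), x, r; split => //; split.
    * have := Hr 0; rewrite /= /upd /mv; case: eqP => [|_]; first by lia.
      by rewrite addn1.
    * move=> i; have := Hr i.+1; rewrite /= => ->.
      by rewrite /upd /mv; case: eqP; [lia|]; move=> _; congr F; lia.
    * case=> [|i] Hi /=; first by rewrite /upd; case: eqP => //; lia.
      rewrite /= in Hi; rewrite Hl; last by lia.
      by rewrite /upd; case: eqP; [lia|]; move=> _; congr F; lia.
- exists l, b, r; split => //; split.
  + by rewrite /upd /= eqxx.
  + by move=> i; rewrite Hr /upd /=; case: eqP => //; lia.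
  + by move=> i /= Hi; rewrite Hl // /upd; case: eqP => //; lia.
Qed.

(** Induction on the execution. The fragment may sit anywhere in a larger program and have arbitrary
    exits, because the parts of [If] and the body of [Loop] are compiled with other addresses and
    exits. *)
Lemma simulation p t F e x F' e' : exec p t F e x F' e' ->
  forall base ex l a r, code_at P base (compile p base ex) -> rep l a r F e ->
  exists s l' a' r', s <= t /\
    iter s (step M) (inord base, l, a, r) = (inord (ex x), l', a', r') /\
    rep l' a' r' F' e'.
Proof.
elim=> {p t F e x F' e'}.
- move=> g t F e b d x Hg Hd Ht base ex l a r Hc Hrep.
  have Hc0 : nth row0 (compile (Op g) base ex) 0 (F e) = (ex x, b, d) by rewrite /nth /= Hg.
  have [l' [a' [r' [Es Hrep']]]] := step_machine Hc isT Hrep Hc0 Hd.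
  by exists 1, l', a', r'; split.
- move=> p p1 p2 t1 t2 t F e F1 e1 x F2 e2 _ IH1 _ IH2 Ht base ex l a r.
  move=> [P1 [P2 [EP sP]]] Hrep.
  case: (IH1 base (fun x => if x is RT then base + psize p else base + psize p + psize p1) l a r) => //.
    by exists P1, (compile p1 (base + psize p) ex ++ compile p2 (base + psize p + psize p1) ex ++ P2); split; rewrite // EP /= -!catA.
  move=> s1 [l1 [a1 [r1 [Hs1 [E1 Hrep1]]]]].
  case: (IH2 (base + psize p) ex l1 a1 r1) => //.
    exists (P1 ++ compile p base (fun x => if x is RT then base + psize p else base + psize p + psize p1)),
      (compile p2 (base + psize p + psize p1) ex ++ P2); split.
      by rewrite EP /= -!catA.
    by rewrite size_cat size_compile sP.
  move=> s2 [l2 [a2 [r2 [Hs2 [E2 Hrep2]]]]].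
  exists (s2 + s1), l2, a2, r2; split; first by lia.
  by rewrite iterD E1.
- move=> p p1 p2 t1 t2 t F e F1 e1 x F2 e2 _ IH1 _ IH2 Ht base ex l a r.
  move=> [P1 [P2 [EP sP]]] Hrep.
  case: (IH1 base (fun x => if x is RT then base + psize p else base + psize p + psize p1) l a r) => //.
    by exists P1, (compile p1 (base + psize p) ex ++ compile p2 (base + psize p + psize p1) ex ++ P2); split; rewrite // EP /= -!catA.
  move=> s1 [l1 [a1 [r1 [Hs1 [E1 Hrep1]]]]].
  case: (IH2 (base + psize p + psize p1) ex l1 a1 r1) => //.
    exists (P1 ++ compile p base (fun x => if x is RT then base + psize p else base + psize p + psize p1) ++ compile p1 (base + psize p) ex), P2; split.
      by rewrite EP /= -!catA.
    by rewrite !size_cat !size_compile sP addnA.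
  move=> s2 [l2 [a2 [r2 [Hs2 [E2 Hrep2]]]]].
  exists (s2 + s1), l2, a2, r2; split; first by lia.
  by rewrite iterD E1.
- move=> p t1 t2 t F e F1 e1 x F2 e2 _ IH1 _ IH2 Ht base ex l a r Hc Hrep.
  have [s1 [l1 [a1 [r1 [Hs1 [E1 Hrep1]]]]]] := IH1 _ _ _ _ _ Hc Hrep.
  have [s2 [l2 [a2 [r2 [Hs2 [E2 Hrep2]]]]]] := IH2 _ _ _ _ _ Hc Hrep1.
  exists (s2 + s1), l2, a2, r2; split; first by lia.
  by rewrite iterD E1.
- move=> p t F e x F1 e1 _ IH Hx base ex l a r Hc Hrep.
  have [s1 [l1 [a1 [r1 [Hs1 [E1 Hrep1]]]]]] := IH _ _ _ _ _ Hc Hrep.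
  exists s1, l1, a1, r1; split => //; split => //.
  by rewrite E1; case: x Hx {E1 IH}.
Qed.
End Simulation.

Definition prog_machine (p : prog) : TM :=
  machine (compile p 0 (fun x => if x is RT then psize p else (psize p).+1)).

(** The machine tape is infinite on both sides; [e] chooses how many blank cells to the left of the
    input receive nonnegative coordinates. *)
Definition input_tape (e : nat) (w : seq bool) : tape :=
  fun i => if i < e then None else nth None (map Some w) (i - e).

Lemma rep_init e w :
  rep [::] (head None (map Some w)) (behead (map Some w)) (input_tape e w) e.
Proof.
split.
- by rewrite /input_tape ltnn subnn; case: w.
- move=> i; rewrite /input_tape ifF; last by lia.
  by rewrite nth_behead; congr nth; lia.
- by move=> i Hi; rewrite nth_nil /input_tape ifT //; lia.
Qed.

Lemma prog_machine_run p t e w x F' e' :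
  exec p t (input_tape e w) e x F' e' ->
  exists s l a r, s <= t /\
    run (prog_machine p) s w =
      ((if x is RT then q_acc (prog_machine p) else q_rej (prog_machine p)), l, a, r) /\
    rep l a r F' e'.
Proof.
move=> /(simulation (P := compile p 0 (fun x => if x is RT then psize p else (psize p).+1))) H.
have [||s [l [a [r [Hs [E R]]]]]] := H 0 (fun x => if x is RT then psize p else (psize p).+1) [::]
  (head None (map Some w)) (behead (map Some w)).
- by exists [::], [::]; rewrite cats0.
- exact: rep_init.
exists s, l, a, r; split => //; split => //.
rewrite /run /init /=.
have <- : (inord 0 : 'I_(size (compile p 0 (fun x => if x is RT then psize p else (psize p).+1))).+2) = ord0.
  by apply/val_inj; rewrite /= inordK.
rewrite E; congr (_, _, _, _).
by case: (x); apply/val_inj; rewrite /= !inordK ?size_compile //.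
Qed.

Lemma halted_run (M : TM) s s' w : s <= s' ->
  let q := state_of (run M s w) in
  (q == q_acc M) || (q == q_rej M) -> run M s' w = run M s w.
Proof.
move=> Hs q Hq; rewrite -(subnK Hs) /run iterD -/(run M s w).
elim: (s' - s) => //= k ->.
by move: Hq; rewrite /q; case: (run M s w) => [[[q1 l] a] r] /= ->.
Qed.

Lemma acc_neq_rej p : q_acc (prog_machine p) != q_rej (prog_machine p).
Proof. by apply/eqP => /(congr1 val) /=; rewrite !inordK; lia. Qed.

Lemma prog_machine_accepts p t e w F' e' T :
  exec p t (input_tape e w) e RT F' e' -> t <= T ->
  accepts_within (prog_machine p) T w.
Proof.
move=> /prog_machine_run [s [l [a [r [Hs [E _]]]]]] HT.
rewrite /accepts_within (@halted_run _ s T); last by rewrite E eqxx.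
  by rewrite E /=.
by lia.
Qed.

(** Halting configurations persist and the two halting states differ, so once some run rejects, no
    time bound [T], shorter or longer, can show acceptance. *)
Lemma prog_machine_rejects p t e w F' e' T :
  exec p t (input_tape e w) e RF F' e' ->
  ~~ accepts_within (prog_machine p) T w.
Proof.
move=> /prog_machine_run [s [l [a [r [Hs [E _]]]]]].
apply/negP => Ha.
have HT : state_of (run (prog_machine p) (maxn s T) w) = q_acc (prog_machine p).
  rewrite (@halted_run _ T) ?leq_maxr //; first exact/eqP.
  by move: Ha; rewrite /accepts_within => ->.
move: HT; rewrite (@halted_run _ s) ?leq_maxl //; last by rewrite E eqxx orbT.
by rewrite E /state_of /= => /esym/eqP; apply/negP; exact: (acc_neq_rej p).
Qed.

(** * The function 2^k *)

Definition Seq (p q : prog) : prog := If p q q.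
Definition Ret (x : res) : prog := Op (fun a => (a, DS, x)).
Definition Write (b : sym) : prog := Op (fun _ => (b, DS, RT)).
Definition Is (s : sym) : prog := Op (fun a => (a, DS, if a == s then RT else RF)).
Definition Move (d : dir) : prog := Op (fun a => (a, d, RT)).
Definition Moves (d : dir) (k : nat) : prog := iter k (Seq (Move d)) (Ret RT).
Definition Skip (d : dir) (x : res) : prog :=
  Loop (Op (fun a => if a is Some _ then (a, d, RC) else (a, DS, x))).

Definition rb (b : bool) : res := if b then RT else RF.

Lemma upd_id F e : upd F e (F e) = F.
Proof. by apply: functional_extensionality => i; rewrite /upd; case: eqP => [->|]. Qed.

Lemma exec_Ret x F e : exec (Ret x) 1 F e x F e.
Proof.
rewrite -{2}[F](upd_id F e); apply: (@exOp _ 1 F e (F e) DS x) => //.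
Qed.

Lemma exec_Write b F e : exec (Write b) 1 F e RT (upd F e b) e.
Proof. exact: (@exOp _ 1 F e b DS RT). Qed.

Lemma exec_Is s F e : exec (Is s) 1 F e (rb (F e == s)) F e.
Proof. by rewrite -{3}[F](upd_id F e); apply: (@exOp _ 1 F e (F e) DS). Qed.

Lemma exec_MoveR F e : exec (Move DR) 1 F e RT F e.+1.
Proof. by rewrite -{2}[F](upd_id F e); apply: (@exOp _ 1 F e (F e) DR). Qed.

Lemma exec_MoveL F e : exec (Move DL) 1 F e.+1 RT F e.
Proof. by rewrite -{2}[F](upd_id F e.+1); apply: (@exOp _ 1 F e.+1 (F e.+1) DL). Qed.

Lemma exec_Seq p q t1 t2 F e b F1 e1 x F2 e2 :
  exec p t1 F e (rb b) F1 e1 -> exec q t2 F1 e1 x F2 e2 ->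
  exec (Seq p q) (t1 + t2) F e x F2 e2.
Proof. by case: b => H1 H2; [apply: (exIfT _ H1 H2)|apply: (exIfF _ H1 H2)]. Qed.

Lemma exec_If p q r t1 t2 F e b F1 e1 x F2 e2 :
  exec p t1 F e (rb b) F1 e1 -> exec (if b then q else r) t2 F1 e1 x F2 e2 ->
  exec (If p q r) (t1 + t2) F e x F2 e2.
Proof. by case: b => H1 H2; [apply: (exIfT _ H1 H2)|apply: (exIfF _ H1 H2)]. Qed.

Lemma exec_MovesR k F e : exec (Moves DR k) k.+1 F e RT F (e + k).
Proof.
elim: k e => [|k IH] e; first by rewrite addn0; apply: exec_Ret.
by rewrite addnS -addSn -[k.+2]add1n; apply: (exec_Seq (b := true) (exec_MoveR F e)); apply: IH.
Qed.

Lemma exec_MovesL k F e : exec (Moves DL k) k.+1 F (e + k) RT F e.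
Proof.
elim: k e => [|k IH] e; first by rewrite addn0; apply: exec_Ret.
by rewrite addnS -[k.+2]add1n; apply: (exec_Seq (b := true) (exec_MoveL F _)); apply: IH.
Qed.

Lemma exec_SkipR x k F e : x <> RC ->
  (forall i, i < k -> F (e + i) <> None) -> F (e + k) = None ->
  exec (Skip DR x) k.+1 F e x F (e + k).
Proof.
move=> Hx; elim: k e => [|k IH] e Hs Hn.
  rewrite addn0; apply: exLoopE => //.
  rewrite -{2}[F](upd_id F e); apply: (@exOp _ 1 F e (F e) DS x) => //.
  by rewrite -(addn0 e) Hn.
have := Hs 0 isT; rewrite addn0; case E: (F e) => [b|] // _.
rewrite addnS -addSn; apply: (@exLoopC _ 1 k.+1 _ _ _ F e.+1) => //.
  rewrite -{2}[F](upd_id F e); apply: (@exOp _ 1 F e (F e) DR RC) => //.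
  by rewrite E.
apply: IH; last by rewrite -Hn; congr F; lia.
by move=> i Hi; have := Hs i.+1; rewrite addSnnS; apply.
Qed.

Lemma exec_SkipL x k F e : x <> RC ->
  (forall i, i < k -> F (e + i.+1) <> None) -> F e = None ->
  exec (Skip DL x) k.+1 F (e + k) x F e.
Proof.
move=> Hx; elim: k => [|k IH] Hs Hn.
  rewrite addn0; apply: exLoopE => //.
  rewrite -{2}[F](upd_id F e); apply: (@exOp _ 1 F e (F e) DS x) => //.
  by rewrite Hn.
have := Hs k (leqnn _); case E: (F _) => [b|] // _.
apply: (@exLoopC _ 1 k.+1 _ _ _ F (e + k)) => //.
  rewrite -{2}[F](upd_id F (e + k.+1)).
  have -> : e + k = mv (e + k.+1) DL by rewrite /=; lia.
  by apply: (@exOp _ 1 F (e + k.+1) (F (e + k.+1)) DL RC) => //; rewrite ?E //; lia.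
by apply: IH => // i Hi; apply: Hs; lia.
Qed.

(* The unary input is read as the binary counter 2^k - 1; every decrement       *)
(* appends a mark behind the separator, and the final underflow stops on the    *)
(* separator, which becomes the last mark.                                      *)
Definition decr_body : prog :=
  If (Loop (Op (fun a => match a with
                 | None => (Some true, DS, RF)
                 | Some false => (Some true, DR, RC)
                 | Some true => (Some false, DS, RT) end)))
     (Seq (Skip DR RT) (Seq (Move DR) (Seq (Skip DR RT) (Seq (Write (Some true))
       (Seq (Skip DL RT) (Seq (Move DL) (Seq (Skip DL RT) (Seq (Move DR) (Ret RC)))))))))
     (Ret RT).

Definition pow2_prog : prog := Loop decr_body.

Fixpoint binval (s : seq bool) : nat :=
  if s is b :: s' then b + (binval s').*2 else 0.

(* blank cell 0, then the counter s, the separator, and j marks *)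
Definition counter_tape (s : seq bool) (j : nat) : tape :=
  fun i => if i is i'.+1 then
    if i' < size s then Some (nth false s i') else
    if size s < i' <= size s + j then Some true else None
  else None.

(** The least significant bit comes first, so a decrement changes an initial block [0 .. 0 1] into
    [1 .. 1 0] and touches nothing else. *)
Lemma exec_borrow s j : 0 < binval s ->
  exists a s', [/\ s = nseq a false ++ true :: s',
    exec (Loop (Op (fun a => match a with
                 | None => (Some true, DS, RF)
                 | Some false => (Some true, DR, RC)
                 | Some true => (Some false, DS, RT) end)))
     a.+1 (counter_tape s j) 1 RT (counter_tape (nseq a true ++ false :: s') j) a.+1
    & binval s = (binval (nseq a true ++ false :: s')).+1].
Proof.
move=> Hs.
have [a [s' Es]] : exists a s', s = nseq a false ++ true :: s'.
  elim: s Hs => // -[] s IH /=; first by exists 0, s.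
  rewrite add0n double_gt0 => /IH [a [s' ->]]; by exists a.+1, s'.
exists a, s'; split => //; last first.
  by rewrite {}Es {Hs}; elim: a => //= a ->; rewrite doubleS; lia.
rewrite {}Es {Hs}.
(* Here [b] counts the zeros already turned into ones, which opens the way to induction on the
   remaining [a]. *)
suff H b : exec (Loop (Op (fun a => match a with
                 | None => (Some true, DS, RF)
                 | Some false => (Some true, DR, RC)
                 | Some true => (Some false, DS, RT) end)))
     a.+1 (counter_tape (nseq b true ++ nseq a false ++ true :: s') j) b.+1
     RT (counter_tape (nseq (b + a) true ++ false :: s') j) (b + a).+1 by exact: (H 0).
elim: a b => [|a IH] b.
  rewrite addn0; apply: exLoopE => //.
  have -> : counter_tape (nseq b true ++ false :: s') j
      = upd (counter_tape (nseq b true ++ nseq 0 false ++ true :: s') j) b.+1 (Some false).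
    apply: functional_extensionality => -[|i] //=; rewrite /upd eqSS.
    rewrite !size_cat !size_nseq /= ?size_cat ?size_nseq /=; case: eqP => [->|Hi].
      by rewrite ifT ?nth_cat ?size_nseq ?ltnn ?subnn //; lia.
    rewrite !nth_cat !size_nseq ?subn0; congr (if _ then Some _ else _).
    by case: ltnP => // H; case E: (i - b) => [|k] //; lia.
  apply: (@exOp _ 1 _ _ (Some false) DS RT) => //=.
  by rewrite !size_cat !size_nseq /= ifT ?nth_cat ?size_nseq ?ltnn ?subnn //; lia.
have -> : b + a.+1 = b.+1 + a by lia.
apply: (@exLoopC _ 1 a.+1); [|exact: IH|by lia].
have -> : counter_tape (nseq b.+1 true ++ nseq a false ++ true :: s') j
      = upd (counter_tape (nseq b true ++ nseq a.+1 false ++ true :: s') j) b.+1 (Some true).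
  apply: functional_extensionality => -[|i] //; rewrite /upd eqSS /counter_tape.
  rewrite !size_cat !size_nseq /=; case: eqP => [->|Hi].
    rewrite ifT; last by lia.
    by rewrite -cat_cons -[true :: nseq b true]/(nseq b.+1 true) nth_cat size_nseq leqnn nth_nseq leqnn.
  have -> : b.+1 + (a + (size s').+1) = b + (a.+1 + (size s').+1) by lia.
  congr (if _ then Some _ else _).
  rewrite -[true :: _]/(nseq b.+1 true ++ nseq a false ++ true :: s').
  rewrite -[false :: _]/(nseq a.+1 false ++ true :: s').
  rewrite !nth_cat !size_nseq !nth_nseq.
  case: (ltnP i b.+1) => H1; case: (ltnP i b) => H2; try lia; try by [].
  case: (ltnP (i - b.+1) a) => H3; case: (ltnP (i - b) a.+1) => H4; try lia; try by [].
  by congr (nth _ _ _); lia.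
apply: (@exOp _ 1 _ _ (Some true) DR RC) => //=.
by rewrite !size_cat !size_nseq /= ifT ?nth_cat ?size_nseq ?ltnn ?subnn //; lia.
Qed.

Lemma counter_some s j i : 0 < i -> i <= size s -> counter_tape s j i <> None.
Proof. by case: i => // i _ Hi; rewrite /counter_tape Hi. Qed.

Lemma counter_marks s j i : size s < i -> i <= size s + j -> counter_tape s j i.+1 <> None.
Proof. by move=> H1 H2; rewrite /counter_tape ifF ?H1 ?H2 //; lia. Qed.

Lemma counter_none s j i : i = (size s).+1 \/ size s + j + 1 < i -> counter_tape s j i = None.
Proof. by case: i => // i H; rewrite /counter_tape !ifF //; lia. Qed.

Lemma counter_append s j :
  upd (counter_tape s j) (size s + j).+2 (Some true) = counter_tape s j.+1.
Proof.
apply: functional_extensionality => -[|i] //; rewrite /upd /counter_tape eqSS.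
case: eqP => [->|Hi]; first by rewrite ifF ?ifT //; lia.
by case: ifP => // Hs; congr (if _ then _ else _); lia.
Qed.

Lemma exec_decr s j : 0 < binval s ->
  exists s' t, [/\ size s' = size s, binval s = (binval s').+1 &
    exec decr_body t (counter_tape s j) 1 RC (counter_tape s' j.+1) 1].
Proof.
move=> /(exec_borrow j) [a [s1 [Es Hex Hv]]].
set s' := nseq a true ++ false :: s1 in Hex Hv.
have ss' : size s' = size s by rewrite Es /s' !size_cat !size_nseq.
have la : a < size s' by rewrite /s' size_cat size_nseq /=; lia.
set n := size s'.
have Hr1 := @exec_SkipR RT (n - a) (counter_tape s' j) a.+1 _ _ _.
have Hr2 := @exec_SkipR RT j (counter_tape s' j) n.+2 _ _ _.
have Hl1 := @exec_SkipL RT j.+1 (counter_tape s' j.+1) n.+1 _ _ _.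
have Hl2 := @exec_SkipL RT n (counter_tape s' j.+1) 0 _ _ _.
exists s'; eexists; split=> //.
apply: (exec_If (b := true) Hex).
apply: (exec_Seq (b := true)).
  apply: Hr1 => //; last by apply: counter_none; rewrite /n; lia.
  by move=> i Hi; apply: counter_some; rewrite /n in Hi; lia.
have -> : a.+1 + (n - a) = n.+1 by rewrite /n; lia.
apply: (exec_Seq (b := true) (exec_MoveR _ _)).
apply: (exec_Seq (b := true)).
  apply: Hr2 => //; last by apply: counter_none; rewrite /n; lia.
  by move=> i Hi; rewrite addSn; apply: counter_marks; rewrite /n; lia.
apply: (exec_Seq (b := true) (exec_Write _ _ _)).
have -> : n.+2 + j = (size s' + j).+2 by rewrite /n; lia.
rewrite counter_append.
apply: (exec_Seq (b := true)).
  have -> : (size s' + j).+2 = n.+1 + j.+1 by rewrite /n; lia.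
  apply: Hl1 => //; last by apply: counter_none; rewrite /n; lia.
  by move=> i Hi; rewrite addSn; apply: counter_marks; rewrite /n; lia.
apply: (exec_Seq (b := true) (exec_MoveL _ _)).
apply: (exec_Seq (b := true)).
  rewrite -[n]add0n; apply: Hl2 => //.
  by move=> i Hi; apply: counter_some; rewrite /n in Hi; lia.
apply: (exec_Seq (b := true) (exec_MoveR _ _)).
exact: exec_Ret.
Qed.

(** On the zero counter the borrow runs through to the blank separator and fills it. With the [j]
    marks behind it this makes [j + 1] consecutive ones, and the head stands on the first of
    them. *)
Lemma exec_underflow s j : binval s = 0 ->
  exists t F', exec decr_body t (counter_tape s j) 1 RT F' (size s).+1 /\
    forall i, F' ((size s).+1 + i) = if i <= j then Some true else None.
Proof.
move=> Hs.
have Es : s = nseq (size s) false.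
  by elim: s Hs => // -[] s IH //= /eqP; rewrite add0n double_eq0 => /eqP/IH <-.
set n := size s in Es *.
exists (n.+1 + 1), (upd (counter_tape (nseq n true) j) n.+1 (Some true)); split; last first.
  move=> i; rewrite /upd; case: eqP => [Hi|Hi]; first by rewrite ifT //; lia.
  rewrite addSn /counter_tape size_nseq ifF; last by lia.
  by case: i Hi => [|i] Hi; [lia|]; congr (if _ then _ else _); lia.
apply: (exec_If (b := false)); last exact: exec_Ret.
rewrite {1}Es {Es Hs}.
suff H a b : a + b = n -> exec (Loop (Op (fun a => match a with
                 | None => (Some true, DS, RF)
                 | Some false => (Some true, DR, RC)
                 | Some true => (Some false, DS, RT) end)))
     a.+1 (counter_tape (nseq b true ++ nseq a false) j) b.+1
     RF (upd (counter_tape (nseq n true) j) n.+1 (Some true)) n.+1 by apply: (H n 0); rewrite addn0.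
elim: a b => [|a IH] b Hab.
  rewrite cats0 -Hab add0n; apply: exLoopE => //.
  apply: (@exOp _ 1 _ _ (Some true) DS RF) => //.
  by rewrite counter_none // size_nseq; left.
apply: (@exLoopC _ 1 a.+1); [|apply: (IH b.+1); lia|by lia].
have -> : counter_tape (nseq b.+1 true ++ nseq a false) j
      = upd (counter_tape (nseq b true ++ nseq a.+1 false) j) b.+1 (Some true).
  apply: functional_extensionality => -[|i] //; rewrite /upd eqSS /counter_tape.
  rewrite !size_cat !size_nseq; case: eqP => [->|Hi].
    rewrite ifT; last by lia.
    by rewrite nth_cat size_nseq leqnn nth_nseq leqnn.
  have -> : b.+1 + a = b + a.+1 by lia.
  congr (if _ then Some _ else _).
  rewrite !nth_cat !size_nseq !nth_nseq.
  by case: (ltnP i b.+1) => H1; case: (ltnP i b) => H2; try lia; rewrite ?if_same.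
apply: (@exOp _ 1 _ _ (Some true) DR RC) => //=.
by rewrite !size_cat !size_nseq /= ifT ?nth_cat ?size_nseq ?ltnn ?subnn //; lia.
Qed.

Lemma binval_ones k : (binval (nseq k true)).+1 = 2 ^ k.
Proof. by elim: k => //= k IH; rewrite expnS -IH; lia. Qed.

(** Each round lowers [binval] by one and adds a mark, so the counter value is the induction
    measure. From [2 ^ k - 1] without marks, the filled separator supplies the last missing one. *)
Lemma exec_pow2 s j : exists t F', exec pow2_prog t (counter_tape s j) 1 RT F' (size s).+1 /\
    forall i, F' ((size s).+1 + i) = if i <= j + binval s then Some true else None.
Proof.
move E: (binval s) => v; elim: v s j E => [|v IH] s j E.
  have [t [F' [H1 H2]]] := exec_underflow j E.
  by exists t, F'; split; [apply: exLoopE|rewrite addn0].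
have [|s' [t1 [ss Ev H1]]] := @exec_decr s j; first by rewrite E.
have [|t2 [F' [H2 H3]]] := IH s' j.+1; first by lia.
exists (t1 + t2), F'; rewrite -ss; split; first exact: (exLoopC H1 H2).
by move=> i; rewrite H3 addSnnS.
Qed.

Lemma somes_nseq (n : nat) (s : seq sym) :
  (forall i, nth None s i = if i < n then Some true else None) -> somes s = nseq n true.
Proof.
elim: n s => [|n IH] s H; first by have := H 0; case: s {H} => // -[].
case: s H => [|a s] H; first by have := H 0.
have := H 0; rewrite /= => ->; congr (_ :: _).
by apply: IH => i; have := H i.+1.
Qed.

Theorem pow2_computable : computable (fun k => nseq (2 ^ k) true).
Proof.
exists (prog_machine pow2_prog) => k.
have [t [F' [H1 H2]]] := exec_pow2 (nseq k true) 0.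
have E : counter_tape (nseq k true) 0 = input_tape 1 (nseq k true).
  apply: functional_extensionality => -[|i] //.
  rewrite /counter_tape /input_tape /= subn1 /= size_nseq map_nseq nth_nseq.
  case: ltnP => [Hi|Hi]; first by rewrite nth_nseq Hi.
  by rewrite ifF ?nth_nseq ?ifF //; lia.
rewrite E in H1.
have [s [l [a [r [Hs [Er [Ha Hr _]]]]]]] := prog_machine_run H1.
exists s; rewrite Er; split => //.
rewrite /output /=; change (somes (a :: r) = nseq (2 ^ k) true).
apply: somes_nseq => i; rewrite -binval_ones ltnS -(add0n (binval _)) -H2.
by case: i => [|i] /=; rewrite ?addn0 // Ha.
Qed.

(** * Pointers into the input *)

Section Programs.
Variable m : nat.

(** The tape is a row of blocks of [m + 2] cells, one block per position; cell [i + 2] of a block is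
    set iff pointer [i] stands there. The search strides through the cells [i + 2] of successive
    blocks. *)
Definition Find (i : nat) : prog :=
  Seq (Move DR) (Loop
    (Seq (Moves DR i.+2) (If (Is (Some true)) (Ret RT)
       (Seq (Moves DR (m - i)) (Ret RC))))).

Definition Answer (p : prog) : prog := If p (Skip DL RT) (Skip DL RF).

Definition PBit (i : nat) : prog :=
  Seq (Find i) (Seq (Moves DL i.+2) (Answer (Is (Some true)))).

Definition PTag (i : nat) : prog :=
  Seq (Find i) (Seq (Moves DL i.+1) (Answer (Is (Some true)))).

(** Both pointers are looked for in one scan from the left. Pointer [j] is tested first, so
    coinciding pointers yield [RF]. *)
Definition PLt (i j : nat) : prog :=
  Seq (Move DR) (Loop
    (Seq (Moves DR j.+2) (If (Is (Some true)) (Skip DL RF)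
      (Seq (Moves DL j.+2) (Seq (Moves DR i.+2)
        (If (Is (Some true)) (Skip DL RT)
          (Seq (Moves DR (m - i)) (Ret RC)))))))).

(* Cyclic successor; the answer RF signals a wrap-around. *)
Definition PNext (i : nat) : prog :=
  Seq (Find i) (Seq (Write (Some false)) (Seq (Moves DR (m - i))
    (If (Is None)
      (Seq (Moves DL 1) (Seq (Skip DL RT) (Seq (Moves DR i.+3)
         (Seq (Write (Some true)) (Skip DL RF)))))
      (Seq (Moves DR i.+2) (Seq (Write (Some true)) (Skip DL RT)))))).

End Programs.

Section Layout.
Variables (z y : seq bool) (m h : nat).
Let n := size z + size y.
Let K := m.+2.
Hypothesis n_gt0 : 0 < n.

(** Cell [h] is a blank home cell and the blocks to its right contain no blank, so a skip to the
    left from any block ends at [h]. *)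
Definition lay (c : nat -> nat -> bool) : tape := fun i =>
  if h < i then
    let j := i - h.+1 in
    if j < n * K then Some (c (j %/ K) (j %% K)) else None
  else None.

(** The first two cells of a block store the bit and a tag telling the certificate [y] from the
    input [z]; the others are pointer marks. *)
Definition cell (s : nat -> nat) (p k : nat) : bool :=
  match k with
  | 0 => nth false (z ++ y) p
  | 1 => size z <= p
  | k'.+2 => s k' == p
  end.

Definition pos (p k : nat) : nat := h.+1 + p * K + k.

Lemma lay_pos c p k : p < n -> k < K -> lay c (pos p k) = Some (c p k).
Proof.
move=> Hp Hk; rewrite /lay /pos ifT; last by lia.
have -> : h.+1 + p * K + k - h.+1 = p * K + k by lia.
rewrite ifT; last by nia.
by rewrite divnMDl // divn_small // addn0 modnMDl modn_small.
Qed.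

Lemma lay_home c : lay c h = None.
Proof. by rewrite /lay ltnn. Qed.

Lemma lay_end c : lay c (pos n 0) = None.
Proof. by rewrite /lay /pos ifT ?ifF //; lia. Qed.

Lemma lay_some c i : i < n * K -> lay c (h + i.+1) <> None.
Proof. by move=> Hi; rewrite /lay ifT ?ifT //; lia. Qed.

Definition cupd (c : nat -> nat -> bool) p k b : nat -> nat -> bool :=
  fun p' k' => if (p' == p) && (k' == k) then b else c p' k'.

Lemma upd_lay c p k b : p < n -> k < K ->
  upd (lay c) (pos p k) (Some b) = lay (cupd c p k b).
Proof.
move=> Hp Hk; apply: functional_extensionality => i; rewrite /upd.
case: eqP => [->|Hi]; first by rewrite lay_pos // /cupd !eqxx.
rewrite /lay; case: ltnP => // Hhi; case: ltnP => // Hj.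
rewrite /cupd; case: eqP => //= Hd; case: eqP => // Hm; case: Hi.
by rewrite /pos -Hd -Hm; have := divn_eq (i - h.+1) K; lia.
Qed.

Lemma exec_home x c p k : x <> RC -> p < n -> k < K ->
  exec (Skip DL x) (n * K).+1 (lay c) (pos p k) x (lay c) h.
Proof.
move=> Hx Hp Hk.
have -> : pos p k = h + (p * K + k).+1 by rewrite /pos; lia.
apply: (@exec_weaken _ (p * K + k).+2); last by nia.
apply: exec_SkipL => //; last exact: lay_home.
by move=> i Hi; apply: lay_some; nia.
Qed.

Lemma exec_Find i s : i < m -> s i < n ->
  exec (Find m i) ((s i).+1 * (m + m + 20)) (lay (cell s)) h RT (lay (cell s)) (pos (s i) i.+2).
Proof.
move=> Hi Hs.
have Hloop a p : p + a = s i -> exec (Loop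
    (Seq (Moves DR i.+2) (If (Is (Some true)) (Ret RT)
       (Seq (Moves DR (m - i)) (Ret RC))))) (a.+1 * (m + m + 19)) (lay (cell s)) (pos p 0)
       RT (lay (cell s)) (pos (s i) i.+2).
  elim: a p => [|a IH] p Hp.
    apply: exLoopE => //; rewrite -Hp addn0.
    apply: (@exec_weaken _ (i.+3 + (1 + 1))); last by nia.
    apply: (exec_Seq (b := true) (exec_MovesR _ _ _)).
    have -> : pos p 0 + i.+2 = pos p i.+2 by rewrite /pos; lia.
    apply: (exec_If (exec_Is _ _ _)).
    rewrite lay_pos; [|by lia|by rewrite /K; lia].
    rewrite /cell -Hp addn0 eqxx /=; exact: exec_Ret.
  apply: (@exLoopC _ (i.+3 + (1 + ((m - i).+1 + 1))) (a.+1 * (m + m + 19))); last by nia.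
    apply: (exec_Seq (b := true) (exec_MovesR _ _ _)).
    have -> : pos p 0 + i.+2 = pos p i.+2 by rewrite /pos; lia.
    apply: (exec_If (exec_Is _ _ _)).
    rewrite lay_pos; [|by lia|by rewrite /K; lia].
    have -> : (Some (cell s p i.+2) == Some true) = false.
      by rewrite /cell; have -> : (s i == p) = false by lia.
    apply: (exec_Seq (b := true) (exec_MovesR _ _ _)).
    exact: exec_Ret.
  have -> : pos p i.+2 + (m - i) = pos p.+1 0 by rewrite /pos /K; nia.
  by apply: IH; lia.
apply: (@exec_weaken _ (1 + (s i).+1 * (m + m + 19))); last by nia.
apply: (exec_Seq (b := true) (exec_MoveR _ _)).
have -> : h.+1 = pos 0 0 by rewrite /pos; lia.
exact: Hloop.
Qed.

Definition opt : nat := (n.+1 * (m + m + 60)) * 3.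

Lemma exec_Answer c p k : p < n -> k < K ->
  exec (Answer (Is (Some true))) (1 + (n * K).+1) (lay c) (pos p k) (rb (c p k)) (lay c) h.
Proof.
move=> Hp Hk; apply: (exec_If (exec_Is _ _ _)).
by rewrite lay_pos //; case: (c p k); apply: exec_home.
Qed.

Lemma exec_Bit i s : i < m -> s i < n ->
  exec (PBit m i) opt (lay (cell s)) h (rb (nth false (z ++ y) (s i))) (lay (cell s)) h.
Proof.
move=> Hi Hs.
apply: (@exec_weaken _ ((s i).+1 * (m + m + 20) + (i.+3 + (1 + (n * K).+1)))); last by rewrite /opt /K; nia.
apply: (exec_Seq (b := true) (exec_Find Hi Hs)).
have -> : pos (s i) i.+2 = pos (s i) 0 + i.+2 by rewrite /pos; lia.
apply: (exec_Seq (b := true) (exec_MovesL _ _ _)).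
exact: (@exec_Answer (cell s)).
Qed.

Lemma exec_Tag i s : i < m -> s i < n ->
  exec (PTag m i) opt (lay (cell s)) h (rb (size z <= s i)) (lay (cell s)) h.
Proof.
move=> Hi Hs.
apply: (@exec_weaken _ ((s i).+1 * (m + m + 20) + (i.+2 + (1 + (n * K).+1)))); last by rewrite /opt /K; nia.
apply: (exec_Seq (b := true) (exec_Find Hi Hs)).
have -> : pos (s i) i.+2 = pos (s i) 1 + i.+1 by rewrite /pos; lia.
apply: (exec_Seq (b := true) (exec_MovesL _ _ _)).
exact: (@exec_Answer (cell s)).
Qed.

Lemma exec_Lt i j s : i < m -> j < m -> s i < n -> s j < n ->
  exec (PLt m i j) opt (lay (cell s)) h (rb (s i < s j)) (lay (cell s)) h.
Proof.
move=> Hi Hj Hsi Hsj.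
(* The scan ends at the leftmost of the two pointers; [a] blocks remain until then. *)
have Hloop a p : p + a = minn (s i) (s j) -> exec (Loop
    (Seq (Moves DR j.+2) (If (Is (Some true)) (Skip DL RF)
      (Seq (Moves DL j.+2) (Seq (Moves DR i.+2)
        (If (Is (Some true)) (Skip DL RT)
          (Seq (Moves DR (m - i)) (Ret RC)))))))) (a.+1 * (3 * m + 20) + n * K) (lay (cell s)) (pos p 0)
       (rb (s i < s j)) (lay (cell s)) h.
  elim: a p => [|a IH] p Hp.
    have Hpn : p < n by lia.
    case E: (s j == p).
      have -> : (s i < s j) = false by lia.
      apply: exLoopE => //.
      apply: (@exec_weaken _ (j.+3 + (1 + (n * K).+1))); last by nia.
      apply: (exec_Seq (b := true) (exec_MovesR _ _ _)).
      have -> : pos p 0 + j.+2 = pos p j.+2 by rewrite /pos; lia.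
      apply: (exec_If (exec_Is _ _ _)).
      rewrite lay_pos; [|by lia|by rewrite /K; lia].
      by rewrite /cell E; apply: exec_home => //; rewrite /K; lia.
    have Ei : s i == p by lia.
    have -> : (s i < s j) = true by lia.
    apply: exLoopE => //.
    apply: (@exec_weaken _ (j.+3 + (1 + (j.+3 + (i.+3 + (1 + (n * K).+1)))))); last by nia.
    apply: (exec_Seq (b := true) (exec_MovesR _ _ _)).
    have Ej0 : pos p 0 + j.+2 = pos p j.+2 by rewrite /pos; lia.
    rewrite Ej0; apply: (exec_If (exec_Is _ _ _)).
    rewrite lay_pos; [|by lia|by rewrite /K; lia].
    have -> : cell s p j.+2 = false by [].
    rewrite -Ej0.
    apply: (exec_Seq (b := true) (exec_MovesL _ _ _)).
    apply: (exec_Seq (b := true) (exec_MovesR _ _ _)).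
    have -> : pos p 0 + i.+2 = pos p i.+2 by rewrite /pos; lia.
    apply: (exec_If (exec_Is _ _ _)).
    rewrite lay_pos; [|by lia|by rewrite /K; lia].
    by rewrite /cell Ei; apply: exec_home => //; rewrite /K; lia.
  apply: (@exLoopC _ (j.+3 + (1 + (j.+3 + (i.+3 + (1 + ((m - i).+1 + 1)))))) (a.+1 * (3 * m + 20) + n * K)); last by nia.
    apply: (exec_Seq (b := true) (exec_MovesR _ _ _)).
    have Ej0 : pos p 0 + j.+2 = pos p j.+2 by rewrite /pos; lia.
    rewrite Ej0; apply: (exec_If (exec_Is _ _ _)).
    rewrite lay_pos; [|by lia|by rewrite /K; lia].
    have E : (s j == p) = false by lia.
    have -> : cell s p j.+2 = false by [].
    rewrite -Ej0.
    apply: (exec_Seq (b := true) (exec_MovesL _ _ _)).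
    apply: (exec_Seq (b := true) (exec_MovesR _ _ _)).
    have -> : pos p 0 + i.+2 = pos p i.+2 by rewrite /pos; lia.
    apply: (exec_If (exec_Is _ _ _)).
    rewrite lay_pos; [|by lia|by rewrite /K; lia].
    have Ei : (s i == p) = false by lia.
    have -> : cell s p i.+2 = false by [].
    apply: (exec_Seq (b := true) (exec_MovesR _ _ _)).
    exact: exec_Ret.
  have -> : pos p i.+2 + (m - i) = pos p.+1 0 by rewrite /pos /K; nia.
  by apply: IH; lia.
apply: (@exec_weaken _ (1 + ((minn (s i) (s j)).+1 * (3 * m + 20) + n * K))); last first.
  have : minn (s i) (s j) <= n by lia.
  by rewrite /opt /K; nia.
apply: (exec_Seq (b := true) (exec_MoveR _ _)).
have -> : h.+1 = pos 0 0 by rewrite /pos; lia.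
exact: Hloop.
Qed.

Definition supd (s : nat -> nat) (i v : nat) : nat -> nat :=
  fun j => if j == i then v else s j.

Lemma cell_supd s i v :
  cupd (cupd (cell s) (s i) i.+2 false) v i.+2 true = cell (supd s i v).
Proof.
apply: functional_extensionality => p; apply: functional_extensionality => k.
rewrite /cupd /cell /supd; case: k => [|[|k]] /=; rewrite ?andbF // !eqSS.
case: (k =P i) => [->|] ; rewrite ?andbT ?andbF //.
by rewrite [v == p]eq_sym; case: (p == v) => //; case: (p =P s i) => // Hp; apply/eqP; exact: nesym.
Qed.

Lemma exec_Next i s : i < m -> s i < n ->
  exec (PNext m i) opt (lay (cell s)) h (rb ((s i).+1 < n))
    (lay (cell (supd s i ((s i).+1 %% n)))) h.
Proof.
move=> Hi Hs.
apply: (@exec_weaken _ ((s i).+1 * (m + m + 20) + (1 + ((m - i).+1 + (1 + (2 + ((n * K).+1 + ((i.+4) + (1 + (n * K).+1)))))))));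
  last by rewrite /opt /K; nia.
apply: (exec_Seq (b := true) (exec_Find Hi Hs)).
apply: (exec_Seq (b := true) (exec_Write _ _ _)).
rewrite upd_lay //.
apply: (exec_Seq (b := true) (exec_MovesR _ _ _)).
have -> : pos (s i) i.+2 + (m - i) = pos (s i).+1 0 by rewrite /pos /K; nia.
apply: (exec_If (exec_Is _ _ _)).
case: (ltnP (s i).+1 n) => Hn.
  rewrite lay_pos // modn_small // -cell_supd.
  rewrite [Some _ == None](_ : _ = false) //.
  apply: (@exec_weaken _ (i.+3 + (1 + (n * K).+1))); last by lia.
  apply: (exec_Seq (b := true) (exec_MovesR _ _ _)).
  have -> : pos (s i).+1 0 + i.+2 = pos (s i).+1 i.+2 by rewrite /pos; lia.
  apply: (exec_Seq (b := true) (exec_Write _ _ _)).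
  by rewrite upd_lay //; apply: exec_home.
have En : (s i).+1 = n by lia.
rewrite En lay_end eqxx modnn -cell_supd.
apply: (exec_Seq (b := true)).
  have -> : pos n 0 = pos (s i) m.+1 + 1 by rewrite /pos -En /K; lia.
  exact: exec_MovesL.
apply: (exec_Seq (b := true)).
  by apply: exec_home => //; rewrite /K.
apply: (exec_Seq (b := true) (exec_MovesR _ _ _)).
have -> : h + i.+3 = pos 0 i.+2 by rewrite /pos; lia.
apply: (exec_Seq (b := true) (exec_Write _ _ _)).
by rewrite upd_lay //; apply: exec_home.
Qed.

End Layout.

(** * Rewriting the input into blocks with pointer cells *)

Definition Put (vs : seq bool) : prog :=
  foldr (fun v => Seq (Op (fun _ => (Some v, DR, RT)))) (Ret RT) vs.

(** Every pointer starts at position 0, so the block written while the block area is still empty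
    carries all pointer marks and the later blocks carry none. The way back crosses the home cell
    and stops at the blank left by the consumed input cell. *)
Definition Emit (m : nat) (b tg : bool) : prog :=
  Seq (Moves DR 1) (Seq (Skip DR RT) (Seq (Moves DR 1)
    (Seq (If (Is None) (Put [:: b, tg & nseq m true])
             (Seq (Skip DR RT) (Put [:: b, tg & nseq m false])))
      (Seq (Moves DL 1) (Seq (Skip DL RT) (Seq (Moves DL 1) (Seq (Skip DL RT)
        (Moves DR 1)))))))).

(** In [pair_enc] each bit of [z] follows a [true], and a [false] in that place announces the second
    component, so the marker decides between another round and leaving the loop. *)
Definition EatZ (m : nat) : prog :=
  Loop (If (Op (fun a => (None, DR, if a == Some true then RT else RF)))
    (If (Op (fun a => (None, DS, if a == Some true then RT else RF)))
       (Seq (Emit m true false) (Ret RC)) (Seq (Emit m false false) (Ret RC)))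
    (Op (fun _ => (None, DR, RT)))).

Definition EatY (m : nat) : prog :=
  Loop (If (Is None) (Ret RT)
    (If (Op (fun a => (None, DS, if a == Some true then RT else RF)))
       (Seq (Emit m true true) (Ret RC)) (Seq (Emit m false true) (Ret RC)))).

Definition Relayout (m : nat) : prog := Seq (EatZ m) (EatY m).

Lemma size_pair_enc x y : size (pair_enc x y) = (size x).*2 + 2 + size y.
Proof.
rewrite /pair_enc !size_cat /= addnA; congr (_ + _ + _).
by elim: x => //= b x ->.
Qed.

Lemma nth_pair_enc d x y i : nth d (pair_enc x y) i =
  if i < (size x).*2 then (if odd i then nth d x i./2 else true)
  else nth d [:: false, false & y] (i - (size x).*2).
Proof.
rewrite /pair_enc; elim: x i => [|b x IH] i; first by rewrite /= subn0.
by case: i => [|[|i]] //=; rewrite IH doubleS !ltnS negbK subSS.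
Qed.

Lemma exec_Put vs F e : exec (Put vs) (size vs).+1 F e RT
  (fun i => if e <= i < e + size vs then Some (nth false vs (i - e)) else F i) (e + size vs).
Proof.
elim: vs F e => [|v vs IH] F e /=.
  rewrite addn0; set F' := (fun i => _).
  have -> : F' = F by apply: functional_extensionality => i; rewrite /F' ifF //; lia.
  exact: exec_Ret.
rewrite -[(size vs).+2]add1n; apply: (exec_Seq (b := true)).
  exact: (@exOp _ 1 F e (Some v) DR RT).
set F' := (fun i => _).
have -> : F' = (fun i => if e.+1 <= i < e.+1 + size vs then Some (nth false vs (i - e.+1))
                  else upd F e (Some v) i).
  apply: functional_extensionality => i; rewrite /F' /upd.
  case: (i =P e) => [->|Hi]; first by rewrite subnn ifT ?ifF //; lia.
  have -> : (e <= i < e + (size vs).+1) = (e < i < e.+1 + size vs) by lia.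
  by case: ifP => // H; have -> : i - e = (i - e.+1).+1 by lia.
by rewrite addnS -addSn; apply: IH.
Qed.

Section Relayout.
Variables (z y : seq bool) (m : nat).
Let n := size z + size y.
Let K := m.+2.
Let w := pair_enc z y.
Let h := size w.

(** Invariant of the copying loops: the first [u] input cells are erased and [j] blocks have been
    written. *)
Definition partial (u j : nat) : tape := fun i =>
  if i <= h then (if u <= i then nth None (map Some w) i else None) else
  let k := i - h.+1 in
  if k < j * K then Some (cell z y (fun=> 0) (k %/ K) (k %% K)) else None.

Lemma input_partial : input_tape 0 w = partial 0 0.
Proof.
apply: functional_extensionality => i; rewrite /input_tape /partial /= subn0.
case: leqP => // Hi.
by rewrite nth_default // size_map -/h; lia.
Qed.

Lemma partial_lay : partial h n = lay z y m h (cell z y (fun=> 0)).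
Proof.
apply: functional_extensionality => i; rewrite /lay /partial leqNgt.
case: ltnP => //= Hi; case: leqP => // Hhi.
by rewrite nth_default // size_map -/h; lia.
Qed.

Lemma partial_eat u j : u <= h -> upd (partial u j) u None = partial u.+1 j.
Proof.
move=> Hu; apply: functional_extensionality => i; rewrite /upd /partial.
case: eqP => [->|Hi]; first by rewrite Hu ltnn.
by case: ifP => // Hh; congr (if _ then _ else _); lia.
Qed.

Lemma partial_area u j k : k < j * K -> partial u j (h.+1 + k) <> None.
Proof.
move=> Hk; rewrite /partial ifF; last by lia.
by rewrite (_ : h.+1 + k - h.+1 = k) ?Hk //; lia.
Qed.

Lemma partial_after u j : partial u j (h.+1 + j * K) = None.
Proof. by rewrite /partial !ifF //; lia. Qed.

Lemma partial_w u j i : u <= i -> i < h -> partial u j i = Some (nth false w i).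
Proof. by move=> Hu Hi; rewrite /partial ltnW // Hu (nth_map false). Qed.

Lemma partial_h u j : partial u j h = None.
Proof. by rewrite /partial leqnn nth_default ?size_map // if_same. Qed.

Lemma partial_eaten u j i : i < u -> i <= h -> partial u j i = None.
Proof. by move=> Hi Hh; rewrite /partial Hh ifF //; lia. Qed.

Definition emt : nat := 4 * (h + n * K + m + 20).

Lemma exec_Emit u j b tg : u < h -> j < n ->
  b = nth false (z ++ y) j -> tg = (size z <= j) ->
  exec (Emit m b tg) emt (partial u.+1 j) u RT (partial u.+1 j.+1) u.+1.
Proof.
move=> Hu Hj Eb Etg.
have Eput : (fun i => if h.+1 + j * K <= i < h.+1 + j * K + size [:: b, tg & nseq m (j == 0)]
    then Some (nth false [:: b, tg & nseq m (j == 0)] (i - (h.+1 + j * K))) else partial u.+1 j i)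
    = partial u.+1 j.+1.
  apply: functional_extensionality => i /=; rewrite size_nseq.
  case: ifP => Hi.
    rewrite /partial ifF; last by lia.
    set k := i - (h.+1 + j * K).
    have Hk : k < K by rewrite /k /K; lia.
    have -> : i - h.+1 = j * K + k by rewrite /k; lia.
    rewrite ifT; last by rewrite mulSn; lia.
    rewrite divnMDl // modnMDl divn_small // modn_small // addn0.
    congr Some; rewrite /cell.
    case: (k) Hk => [|[|k']] //= Hk'.
    by rewrite nth_nseq ifT ?[0 == _]eq_sym.
  rewrite /partial; case: (leqP i h) => // Hhi.
  congr (if _ then _ else _).
  move: Hi; rewrite mulSn -/K; lia.
apply: (@exec_weaken _ (2 + ((h - u.+1).+1 + (2 + ((1 + ((j * K).+1 + (size [:: b, tg & nseq m (j == 0)]).+1)) +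
   (2 + ((j.+1 * K).+1 + (2 + ((h - u.+1).+1 + 2)))))))));
   last by rewrite /= size_nseq /emt mulSn; rewrite /K; nia.
apply: (exec_Seq (b := true) (exec_MovesR _ _ _)).
rewrite addn1; apply: (exec_Seq (b := true)).
  apply: exec_SkipR => //.
    by move=> i Hi; rewrite partial_w //; lia.
  by rewrite subnKC // partial_h.
rewrite subnKC //; apply: (exec_Seq (b := true) (exec_MovesR _ _ _)).
apply: (@exec_Seq _ _ _ _ _ _ true (partial u.+1 j.+1) (h.+1 + j * K + K)).
  rewrite -Eput; apply: (exec_If (exec_Is _ _ _)).
  case: (posnP j) => Hj0.
    rewrite Hj0 mul0n addn0 addn1.
    have -> : partial u.+1 0 h.+1 = None by have := partial_after u.+1 0; rewrite mul0n addn0.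
    rewrite eqxx.
    have := exec_Put [:: b, tg & nseq m true] (partial u.+1 0) h.+1.
    by rewrite /= size_nseq => H; apply: exec_weaken H _.
  rewrite addn1; case E: (partial _ _ _) => [c|]; last first.
    by move: (@partial_area u.+1 j 0); rewrite addn0 E; case=> //; rewrite /K; nia.
  rewrite [Some _ == None](_ : _ = false) //.
  apply: (exec_Seq (b := true)).
    by apply: exec_SkipR => //; [move=> i Hi; apply: partial_area|apply: partial_after].
  have := exec_Put [:: b, tg & nseq m false] (partial u.+1 j) (h.+1 + j * K).
  by rewrite /= size_nseq.
apply: (exec_Seq (b := true)).
  have -> : h.+1 + j * K + K = (h + j.+1 * K) + 1 by rewrite mulSn; lia.
  exact: exec_MovesL.
apply: (exec_Seq (b := true)).
  apply: exec_SkipL => //; last exact: partial_h.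
  by move=> i Hi; rewrite addnS -addSn; apply: partial_area.
apply: (exec_Seq (b := true)).
  have -> : h = (h.-1) + 1 by lia.
  exact: exec_MovesL.
apply: (exec_Seq (b := true)).
  have -> : h.-1 = u + (h - u.+1) by lia.
  apply: exec_SkipL => //; last by rewrite partial_eaten //; lia.
  by move=> i Hi; rewrite partial_w //; lia.
rewrite -[u.+1 in X in exec _ _ _ _ _ _ X]addn1; exact: exec_MovesR.
Qed.

Let hE : h = (size z).*2 + 2 + size y.
Proof. exact: size_pair_enc. Qed.

Lemma exec_EatZ i : i <= size z ->
  exec (EatZ m) ((size z - i).+1 * (emt + 10)) (partial i.*2 i) i.*2 RT
    (partial ((size z).*2 + 2) (size z)) ((size z).*2 + 2).
Proof.
move=> Hi; move E: (size z - i) => a; elim: a i Hi E => [|a IH] i Hi E.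
  have -> : i = size z by lia.
  apply: exLoopE => //; apply: (@exec_weaken _ (1 + 1)); last by lia.
  apply: (@exec_If _ _ _ _ _ _ _ false (partial ((size z).*2.+1) (size z)) (size z).*2.+1).
    rewrite -partial_eat; last by lia.
    apply: (@exOp _ 1 _ _ None DR) => //.
    by rewrite partial_w //; [|lia]; rewrite /w nth_pair_enc ltnn subnn.
  have -> : (size z).*2 + 2 = (size z).*2.+2 by lia.
  rewrite -(@partial_eat (size z).*2.+1); last by lia.
  exact: (@exOp _ 1 _ _ None DR).
have Hiz : i < size z by lia.
apply: (@exLoopC _ (1 + (1 + (emt + 1))) (a.+1 * (emt + 10))); last by nia.
  apply: (@exec_If _ _ _ _ _ _ _ true (partial i.*2.+1 i) i.*2.+1).
    rewrite -partial_eat; last by lia.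
    apply: (@exOp _ 1 _ _ None DR) => //.
    rewrite partial_w //; [|lia]; rewrite /w nth_pair_enc.
    have -> : i.*2 < (size z).*2 by lia.
    by rewrite odd_double.
  apply: (@exec_If _ _ _ _ _ _ _ (nth false z i) (partial i.*2.+2 i) i.*2.+1).
    rewrite -(@partial_eat i.*2.+1); last by lia.
    apply: (@exOp _ 1 _ _ None DS) => //.
    rewrite partial_w //; [|lia]; rewrite /w nth_pair_enc.
    have -> : i.*2.+1 < (size z).*2 by lia.
    rewrite /= odd_double /= uphalf_double.
    by case: (nth _ _ _).
  have HE := @exec_Emit i.*2.+1 i (nth false z i) false.
  have Ez : nth false z i = nth false (z ++ y) i by rewrite nth_cat Hiz.
  case: (nth false z i) HE Ez => HE Ez.
    apply: (exec_Seq (b := true)); last exact: exec_Ret.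
    by apply: HE => //; rewrite /n; lia.
  apply: (exec_Seq (b := true)); last exact: exec_Ret.
  by apply: HE => //; rewrite /n; lia.
by rewrite -doubleS; apply: IH; lia.
Qed.

Lemma exec_EatY i : i <= size y ->
  exec (EatY m) ((size y - i).+1 * (emt + 10)) (partial ((size z).*2 + 2 + i) (size z + i))
    ((size z).*2 + 2 + i) RT (partial h n) h.
Proof.
move=> Hi; move E: (size y - i) => a; elim: a i Hi E => [|a IH] i Hi E.
  have -> : i = size y by lia.
  apply: exLoopE => //; apply: (@exec_weaken _ (1 + 1)); last by lia.
  apply: (exec_If (exec_Is _ _ _)).
  rewrite -hE partial_h; exact: exec_Ret.
have Hiy : i < size y by lia.
have Ew : nth false w ((size z).*2 + 2 + i) = nth false y i.
  rewrite /w nth_pair_enc ifF; last by lia.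
  by have -> : (size z).*2 + 2 + i - (size z).*2 = i.+2 by lia.
apply: (@exLoopC _ (1 + (1 + (emt + 1))) (a.+1 * (emt + 10))); last by nia.
  apply: (exec_If (exec_Is _ _ _)).
  rewrite {1}partial_w //; last by lia.
  rewrite [Some _ == None](_ : _ = false) //.
  apply: (@exec_If _ _ _ _ _ _ _ (nth false y i) (partial ((size z).*2 + 2 + i).+1 (size z + i)) ((size z).*2 + 2 + i)).
    rewrite -partial_eat; last by lia.
    apply: (@exOp _ 1 _ _ None DS) => //.
    by rewrite partial_w //; [|lia]; rewrite Ew; case: (nth _ _ _).
  have HE := @exec_Emit ((size z).*2 + 2 + i) (size z + i) (nth false y i) true.
  have Ez : nth false y i = nth false (z ++ y) (size z + i).
    by rewrite nth_cat ifF ?addKn //; lia.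
  case: (nth false y i) HE Ez => HE Ez.
    apply: (exec_Seq (b := true)); last exact: exec_Ret.
    by apply: HE => //; rewrite /n; lia.
  apply: (exec_Seq (b := true)); last exact: exec_Ret.
  by apply: HE => //; rewrite /n; lia.
by rewrite -!addnS; apply: IH; lia.
Qed.

Lemma exec_Relayout :
  exec (Relayout m) ((n + 2) * (emt + 10)) (input_tape 0 w) 0 RT
    (lay z y m h (cell z y (fun=> 0))) h.
Proof.
rewrite input_partial -partial_lay.
apply: (@exec_weaken _ ((size z).+1 * (emt + 10) + (size y).+1 * (emt + 10)));
  last by rewrite -mulnDl leq_mul2r /n; lia.
apply: (exec_Seq (b := true)).
  have := @exec_EatZ 0 (leq0n _); rewrite subn0; exact.
have := @exec_EatY 0 (leq0n _); rewrite subn0 !addn0; exact.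
Qed.

End Relayout.

(** * First-order formulas with certificate relations *)

Definition is_poly (f : nat -> nat) : Prop :=
  exists c d, forall n, f n <= poly_bound c d n.

Lemma poly_const a : is_poly (fun=> a).
Proof. by exists a, 0 => n; rewrite /poly_bound; lia. Qed.

Lemma poly_id : is_poly id.
Proof. by exists 1, 1 => n; rewrite /poly_bound expn1; lia. Qed.

Lemma poly_le f g : (forall n, f n <= g n) -> is_poly g -> is_poly f.
Proof. by move=> H [c [d Hg]]; exists c, d => n; apply: leq_trans (Hg n). Qed.

(** The [+ 1] covers [n = 0], where [n ^ 0 = 1] may exceed [n ^ (0 + d') = 0]. *)
Lemma leq_expn_add n d d' : n ^ d <= n ^ (d + d') + 1.
Proof.
case: n => [|n].
  by case: d => [|d]; [rewrite expn0 addn1|rewrite exp0n].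
by apply: leq_trans (leq_addr _ _); rewrite expnD leq_pmulr // expn_gt0.
Qed.

Lemma poly_add f g : is_poly f -> is_poly g -> is_poly (fun n => f n + g n).
Proof.
move=> [c [d Hf]] [c' [d' Hg]]; exists (2 * (c + c')), (d + d') => n.
have := Hf n; have := Hg n; rewrite /poly_bound.
have := leq_expn_add n d d'; have := leq_expn_add n d' d.
rewrite (addnC d' d); move: (n ^ d) (n ^ d') (n ^ (d + d')) => a b e; nia.
Qed.

Lemma poly_mul f g : is_poly f -> is_poly g -> is_poly (fun n => f n * g n).
Proof.
move=> [c [d Hf]] [c' [d' Hg]]; exists (4 * (c * c')), (d + d') => n.
apply: leq_trans (leq_mul (Hf n) (Hg n)) _; rewrite /poly_bound.
have := leq_expn_add n d d'; have := leq_expn_add n d' d.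
rewrite (addnC d' d) expnD; move: (n ^ d) (n ^ d') => a b H1 H2.
have -> : (c * a + c) * (c' * b + c') = (c * c') * ((a + 1) * (b + 1)) by nia.
have -> : 4 * (c * c') * (a * b) + 4 * (c * c') = (c * c') * (4 * (a * b) + 4) by nia.
by rewrite leq_mul2l; apply/orP; right; nia.
Qed.

Lemma poly_exp f d : is_poly f -> is_poly (fun n => f n ^ d).
Proof.
move=> Hf; elim: d => [|d IH]; first exact: (poly_const 1).
by apply: poly_le (poly_mul Hf IH) => n; rewrite expnS.
Qed.

Lemma poly_comp f g : is_poly f -> is_poly g -> is_poly (fun n => f (g n)).
Proof.
move=> [c [d Hf]] Hg; apply: poly_le (fun n => Hf (g n)) _.
apply: poly_add (poly_const c); apply: poly_mul (poly_const c) _.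
exact: poly_exp.
Qed.

Lemma poly_S f : is_poly f -> is_poly (fun n => (f n).+1).
Proof. by move=> Hf; apply: poly_le (poly_add (poly_const 1) Hf) => n; rewrite add1n. Qed.

(** Parametric higher-order syntax: with [V := nat] the same formula is read over positions by [sat]
    and over pointer indices by [fprog], and [eqv] relates the two readings. *)
Inductive fo (V : Type) : Type :=
| QBit of V
| QLt of V & V
| QRel of nat & V & V & V & V
| QNot of fo V
| QAnd of fo V & fo V
| QOr of fo V & fo V
| QImp of fo V & fo V
| QAll of (V -> fo V)
| QEx of (V -> fo V).

(** A family indexed by the first argument. All relations have four places; smaller arities repeat
    an argument. *)
Definition rels := nat -> nat -> nat -> nat -> nat -> bool.

Fixpoint sat (z : seq bool) (R : rels) (f : fo nat) : Prop :=
  match f with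
  | QBit p => nth false z p
  | QLt p q => p < q
  | QRel i p q r s => R i p q r s
  | QNot g => ~ sat z R g
  | QAnd g g' => sat z R g /\ sat z R g'
  | QOr g g' => sat z R g \/ sat z R g'
  | QImp g g' => sat z R g -> sat z R g'
  | QAll g => forall p, p < size z -> sat z R (g p)
  | QEx g => exists2 p, p < size z & sat z R (g p)
  end.

(* [eqv r k G f g]: f and g are instances of one parametric formula with at     *)
(* most k nested quantifiers and relation symbols below r, at variables paired   *)
(* by G.                                                                         *)
Inductive eqv (r : nat) : nat -> seq (nat * nat) -> fo nat -> fo nat -> Prop :=
| eqBit k G x y : (x, y) \in G -> eqv r k G (QBit x) (QBit y)
| eqLt k G x y x' y' : (x, y) \in G -> (x', y') \in G -> eqv r k G (QLt x x') (QLt y y')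
| eqRel k G i x1 y1 x2 y2 x3 y3 x4 y4 : i < r ->
    (x1, y1) \in G -> (x2, y2) \in G -> (x3, y3) \in G -> (x4, y4) \in G ->
    eqv r k G (QRel i x1 x2 x3 x4) (QRel i y1 y2 y3 y4)
| eqNot k G f g : eqv r k G f g -> eqv r k G (QNot f) (QNot g)
| eqAnd k G f g f' g' : eqv r k G f g -> eqv r k G f' g' -> eqv r k G (QAnd f f') (QAnd g g')
| eqOr k G f g f' g' : eqv r k G f g -> eqv r k G f' g' -> eqv r k G (QOr f f') (QOr g g')
| eqImp k G f g f' g' : eqv r k G f g -> eqv r k G f' g' -> eqv r k G (QImp f f') (QImp g g')
| eqAll k G f g : (forall x y, eqv r k ((x, y) :: G) (f x) (g y)) -> eqv r k.+1 G (QAll f) (QAll g)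
| eqEx k G f g : (forall x y, eqv r k ((x, y) :: G) (f x) (g y)) -> eqv r k.+1 G (QEx f) (QEx g).

(** * Evaluating formulas with pointer programs *)

Section Programs.
(* Pointers below A hold the values of variables; A, .., A + 3 form an odometer *)
(* over the positions of z, and A + 4 points into the table of the relations.   *)
Variables A r : nat.
Let m := A + 5.

Definition PWrap (i : nat) : prog := Loop (If (PNext m i) (Ret RC) (Ret RT)).
Definition PNextZ (i : nat) : prog :=
  If (PNext m i) (If (PTag m i) (Seq (PWrap i) (Ret RF)) (Ret RT)) (Ret RF).
Definition PEq (i j : nat) : prog :=
  If (PLt m i j) (Ret RF) (If (PLt m j i) (Ret RF) (Ret RT)).
Definition PAdv (k : nat) : prog := iter k (Seq (PNext m (A + 4))) (Ret RT).
Definition PTable : prog :=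
  Loop (If (PTag m (A + 4)) (Ret RT) (If (PNext m (A + 4)) (Ret RC) (Ret RT))).
Definition POdo : prog :=
  If (PNextZ (A + 3)) (Ret RC) (If (PNextZ (A + 2)) (Ret RC)
    (If (PNextZ (A + 1)) (Ret RC) (If (PNextZ A) (Ret RC) (Ret RF)))).
Definition PMatch (x1 x2 x3 x4 : nat) : prog :=
  If (PEq A x1) (If (PEq (A + 1) x2) (If (PEq (A + 2) x3) (PEq (A + 3) x4) (Ret RF)) (Ret RF)) (Ret RF).
(** Enumerating quadruples in lexicographic order replaces the computation of a table address: each
    skipped quadruple moves the table pointer by the [r] entries stored for it, and the match moves
    it by [i] more. *)
Definition PSearch (i x1 x2 x3 x4 : nat) : prog :=
  Loop (If (PMatch x1 x2 x3 x4) (Seq (PAdv i) (PBit m (A + 4)))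
     (Seq (PAdv r) POdo)).
Definition PClean : prog :=
  Seq (PWrap A) (Seq (PWrap (A + 1)) (Seq (PWrap (A + 2)) (Seq (PWrap (A + 3)) (PWrap (A + 4))))).
Definition PRel (i x1 x2 x3 x4 : nat) : prog :=
  Seq PTable (If (PSearch i x1 x2 x3 x4) (Seq PClean (Ret RT)) (Seq PClean (Ret RF))).

(** The variable bound at nesting depth [d] is pointer [d]. Each quantifier loop leaves its pointer
    at 0, ready for reuse. *)
Fixpoint fprog (d : nat) (f : fo nat) : prog :=
  match f with
  | QBit p => PBit m p
  | QLt p q => PLt m p q
  | QRel i p q u v => PRel i p q u v
  | QNot g => If (fprog d g) (Ret RF) (Ret RT)
  | QAnd g g' => If (fprog d g) (fprog d g') (Ret RF)
  | QOr g g' => If (fprog d g) (Ret RT) (fprog d g')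
  | QImp g g' => If (fprog d g) (fprog d g') (Ret RT)
  | QAll g => Loop (If (fprog d.+1 (g d)) (If (PNextZ d) (Ret RC) (Ret RT))
                       (Seq (PWrap d) (Ret RF)))
  | QEx g => Loop (If (fprog d.+1 (g d)) (Seq (PWrap d) (Ret RT))
                       (If (PNextZ d) (Ret RC) (Ret RF)))
  end.

(** Two cells to the right of home lies the tag of the first block. It is [Some false] exactly when
    [z] is nonempty, so the empty input is rejected before any quantifier is evaluated. *)
Definition fagin_prog (f : fo nat) : prog :=
  Seq (Relayout m) (Seq (Moves DR 2) (If (Is (Some false))
    (Seq (Skip DL RT) (fprog 0 f)) (Ret RF))).

Definition t_op (n : nat) : nat := (n.+1 * (m + m + 60)) * 3.
Definition t_wrap (n : nat) : nat := n.+1 * (t_op n + 2).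
Definition t_nextz (n : nat) : nat := t_op n + t_op n + t_wrap n + 3.
Definition t_adv (k n : nat) : nat := k.+1 * (t_op n + 1).
Definition t_iter (n : nat) : nat :=
  20 * (t_op n + 2) + t_adv r n + t_op n + 4 * (t_nextz n + 2).
Definition t_rel (n : nat) : nat :=
  n.+1 * (2 * t_op n + 2) + ((n ^ 4).+1 * t_iter n + t_adv r n) + 5 * t_wrap n + 10.

Fixpoint t_form (d : nat) (f : fo nat) (n : nat) : nat :=
  match f with
  | QBit _ | QLt _ _ => t_op n
  | QRel _ _ _ _ _ => t_rel n
  | QNot g => (t_form d g n).+1
  | QAnd g g' | QOr g g' | QImp g g' => (t_form d g n + t_form d g' n).+1
  | QAll g | QEx g => n.+1 * (t_form d.+1 (g d) n + t_nextz n + t_wrap n + 3)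
  end.
End Programs.

Lemma digits_lt N p1 p2 p3 p4 : p1 < N -> p2 < N -> p3 < N -> p4 < N ->
  ((p1 * N + p2) * N + p3) * N + p4 < N ^ 4.
Proof.
move=> H1 H2 H3 H4; rewrite !expnS expn0 muln1.
have step u v w : u < v -> w < N -> u * N + w < N * v by nia.
have S2 := step _ _ _ (step _ _ _ H1 H2) H3.
exact: (step _ _ _ S2 H4).
Qed.

(** * Correctness of formula evaluation *)

Section Correctness.
Variables (z y : seq bool) (A r h : nat).
Let m := A + 5.
Let N := size z.
Let n := N + size y.
Hypothesis N_gt0 : 0 < N.
Let n_gt0 : 0 < size z + size y. Proof. by rewrite ltn_addr. Qed.

Notation pexec p T s x s' := (exec p T (lay z y m h (cell z y s)) h x (lay z y m h (cell z y s')) h).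

Lemma supd_id s i : supd s i (s i) = s.
Proof. by apply: functional_extensionality => j; rewrite /supd; case: eqP => [->|]. Qed.

Lemma supd_same s i v : s i = v -> supd s i v = s.
Proof. by move=> <-; apply: supd_id. Qed.

Lemma supdK s i v v' : supd (supd s i v) i v' = supd s i v'.
Proof. by apply: functional_extensionality => j; rewrite /supd; case: eqP. Qed.

Lemma supd_eq s i v : supd s i v i = v. Proof. by rewrite /supd eqxx. Qed.

Lemma supd_ne s i j v : j <> i -> supd s i v j = s j.
Proof. by rewrite /supd; case: eqP. Qed.

Lemma pexec_Next i s : i < m -> s i < n ->
  pexec (PNext m i) (t_op A n) s (rb ((s i).+1 < n)) (supd s i ((s i).+1 %% n)).
Proof. exact: exec_Next. Qed.

Lemma pexec_Wrap i s : i < m -> s i < n -> pexec (PWrap A i) (t_wrap A n) s RT (supd s i 0).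
Proof.
move=> Hi Hs; apply: (@exec_weaken _ ((n - s i) * (t_op A n + 2))); last first.
  by rewrite /t_wrap leq_mul2r; apply/orP; right; lia.
move E: (n - (s i).+1) => a; have -> : n - s i = a.+1 by lia.
elim: a s Hs E => [|a IH] s Hs E.
  apply: exLoopE => //; apply: (@exec_weaken _ (t_op A n + 1)); last by lia.
  have := pexec_Next Hi Hs; have -> : (s i).+1 = n by lia.
  by rewrite modnn ltnn => H; apply: (exec_If (b := false) H); apply: exec_Ret.
apply: (@exLoopC _ (t_op A n + 1) (a.+1 * (t_op A n + 2))); last by lia.
  by apply: (exec_If (pexec_Next Hi Hs)); rewrite ifT; [apply: exec_Ret|lia].
rewrite -(supdK s i ((s i).+1 %% n) 0) modn_small; last by lia.
by apply: IH; rewrite supd_eq; lia.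
Qed.

Definition zsucc (p : nat) : nat := if p.+1 < N then p.+1 else 0.

Lemma pexec_NextZ i s : i < m -> s i < N ->
  pexec (PNextZ A i) (t_nextz A n) s (rb ((s i).+1 < N)) (supd s i (zsucc (s i))).
Proof.
move=> Hi Hs; have Hsn : s i < n by rewrite /n; lia.
apply: (@exec_weaken _ (t_op A n + (t_op A n + (t_wrap A n + 1)))); last by rewrite /t_nextz; lia.
apply: (exec_If (pexec_Next Hi Hsn)).
case: (ltnP (s i).+1 n) => Hn; last first.
  rewrite (_ : (s i).+1 = n); last by lia.
  rewrite /zsucc (_ : (s i).+1 < N = false) ?modnn; last by rewrite /n in Hn; lia.
  have -> : (n < N) = false by rewrite /n; lia.
  by apply: exec_weaken; [apply: exec_Ret|lia].
rewrite modn_small // /zsucc.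
have HT := @exec_Tag z y m h n_gt0 i (supd s i (s i).+1) Hi _; rewrite supd_eq in HT.
apply: (exec_If (HT Hn)).
rewrite -/N; case: (leqP N (s i).+1) => HN.
  apply: (exec_Seq (b := true)); last exact: exec_Ret.
  rewrite -(supdK s i (s i).+1 0); apply: pexec_Wrap => //.
  by rewrite supd_eq.
by apply: exec_weaken; [apply: exec_Ret|lia].
Qed.

Lemma pexec_Eq i j s : i < m -> j < m -> s i < n -> s j < n ->
  pexec (PEq A i j) (t_op A n + (t_op A n + 1)) s (rb (s i == s j)) s.
Proof.
move=> Hi Hj Hsi Hsj.
apply: (exec_If (exec_Lt h n_gt0 Hi Hj Hsi Hsj)).
case: ltngtP => H.
- by apply: exec_weaken; [apply: exec_Ret|lia].
- have HL := exec_Lt h n_gt0 Hj Hi Hsj Hsi.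
  by rewrite H in HL; apply: (exec_If HL); apply: exec_Ret.
- have HL := exec_Lt h n_gt0 Hj Hi Hsj Hsi.
  by rewrite H ltnn in HL; apply: (exec_If HL); apply: exec_Ret.
Qed.

Lemma pexec_Adv k s : s (A + 4) < n ->
  pexec (PAdv A k) (t_adv A k n) s RT (supd s (A + 4) ((s (A + 4) + k) %% n)).
Proof.
elim: k s => [|k IH] s Hs.
  rewrite addn0 modn_small // supd_id.
  by apply: exec_weaken; [apply: exec_Ret|rewrite /t_adv; lia].
apply: (@exec_weaken _ (t_op A n + t_adv A k n)); last by rewrite /t_adv; lia.
apply: (exec_Seq (pexec_Next _ Hs)); first by rewrite /m; lia.
have := IH (supd s (A + 4) ((s (A + 4)).+1 %% n)).
by rewrite supdK supd_eq modnDml addSnnS; apply; rewrite ltn_mod.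
Qed.

Lemma pexec_Table s : s (A + 4) = 0 ->
  pexec (PTable A) (n.+1 * (2 * t_op A n + 2)) s RT (supd s (A + 4) (N %% n)).
Proof.
move=> Hs0.
have Hm : A + 4 < m by rewrite /m; lia.
suff H a u : u + a = N -> u < n -> pexec (PTable A) (a.+1 * (2 * t_op A n + 2)) (supd s (A + 4) u) RT (supd s (A + 4) (N %% n)).
  have := H N 0; rewrite (supd_same Hs0) => {}H; apply: (exec_weaken (H _ _)) => //.
  by rewrite leq_mul2r; apply/orP; right; rewrite /n; lia.
elim: a u => [|a IH] u Eu Hu.
  apply: exLoopE => //; apply: (@exec_weaken _ (t_op A n + 1)); last by lia.
  have HT := @exec_Tag z y m h n_gt0 (A + 4) (supd s (A + 4) u) Hm; rewrite supd_eq in HT.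
  apply: (exec_If (HT Hu)).
  rewrite -/N (_ : N <= u); last by lia.
  have -> : N %% n = u by rewrite modn_small //; lia.
  exact: exec_Ret.
have HT := @exec_Tag z y m h n_gt0 (A + 4) (supd s (A + 4) u) Hm; rewrite supd_eq in HT.
have HN := @pexec_Next (A + 4) (supd s (A + 4) u) Hm; rewrite supd_eq supdK in HN.
case: (ltnP u.+1 n) => Hun.
  apply: (@exLoopC _ (t_op A n + (t_op A n + 1)) (a.+1 * (2 * t_op A n + 2))); last by lia.
    apply: (exec_If (HT Hu)); rewrite -/N (_ : (N <= u) = false); last by lia.
    by apply: (exec_If (HN Hu)); rewrite Hun; apply: exec_Ret.
  by rewrite modn_small //; apply: IH; lia.
have En : u.+1 = n by lia.
apply: exLoopE => //; apply: (@exec_weaken _ (t_op A n + (t_op A n + 1))); last by lia.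
apply: (exec_If (HT Hu)); rewrite -/N (_ : (N <= u) = false); last by lia.
apply: (exec_If (HN Hu)); rewrite (_ : (u.+1 < n) = false); last by lia.
have -> : N = n by rewrite /n; rewrite /n in En; lia.
by rewrite En !modnn; apply: exec_Ret.
Qed.

(* The position in z ++ y where PRel looks for the value of a relation. *)
Definition table_pos (i p1 p2 p3 p4 : nat) : nat :=
  (N + ((((p1 * N + p2) * N + p3) * N + p4) * r + i)) %% n.

(** Reduction modulo [n] makes every string [y], whatever its length, a table of some relations, so
    an accepted certificate always yields an interpretation. *)
Definition table_rel : rels := fun i p1 p2 p3 p4 =>
  nth false (z ++ y) (table_pos i p1 p2 p3 p4).

Section Search.
Variable s : nat -> nat.
Definition odo (q1 q2 q3 q4 t : nat) : nat -> nat := fun j =>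
  if j == A then q1 else if j == A + 1 then q2 else if j == A + 2 then q3 else
  if j == A + 3 then q4 else if j == A + 4 then t else s j.

Let odo1 q1 q2 q3 q4 t : odo q1 q2 q3 q4 t A = q1. Proof. by rewrite /odo eqxx. Qed.
Let odo2 q1 q2 q3 q4 t : odo q1 q2 q3 q4 t (A + 1) = q2.
Proof. by rewrite /odo; repeat case: eqP => //; lia. Qed.
Let odo3 q1 q2 q3 q4 t : odo q1 q2 q3 q4 t (A + 2) = q3.
Proof. by rewrite /odo; repeat case: eqP => //; lia. Qed.
Let odo4 q1 q2 q3 q4 t : odo q1 q2 q3 q4 t (A + 3) = q4.
Proof. by rewrite /odo; repeat case: eqP => //; lia. Qed.
Let odo5 q1 q2 q3 q4 t : odo q1 q2 q3 q4 t (A + 4) = t.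
Proof. by rewrite /odo; repeat case: eqP => //; lia. Qed.
Let odo_lt q1 q2 q3 q4 t j : j < A -> odo q1 q2 q3 q4 t j = s j.
Proof. by move=> Hj; rewrite /odo; repeat case: eqP => //; lia. Qed.

Ltac odo_tac := apply: functional_extensionality => j; rewrite /supd /odo;
  repeat case: eqP => //; lia.
Let odou1 q1 q2 q3 q4 t v : supd (odo q1 q2 q3 q4 t) A v = odo v q2 q3 q4 t.
Proof. odo_tac. Qed.
Let odou2 q1 q2 q3 q4 t v : supd (odo q1 q2 q3 q4 t) (A + 1) v = odo q1 v q3 q4 t.
Proof. odo_tac. Qed.
Let odou3 q1 q2 q3 q4 t v : supd (odo q1 q2 q3 q4 t) (A + 2) v = odo q1 q2 v q4 t.
Proof. odo_tac. Qed.
Let odou4 q1 q2 q3 q4 t v : supd (odo q1 q2 q3 q4 t) (A + 3) v = odo q1 q2 q3 v t.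
Proof. odo_tac. Qed.
Let odou5 q1 q2 q3 q4 t v : supd (odo q1 q2 q3 q4 t) (A + 4) v = odo q1 q2 q3 q4 v.
Proof. odo_tac. Qed.

(** Four-digit increment in base [N]. The bound by [N ^ 4] rules out overflow, so some digit can be
    raised and the answer is [RC]. *)
Lemma pexec_Odo q1 q2 q3 q4 t : q1 < N -> q2 < N -> q3 < N -> q4 < N ->
  ((q1 * N + q2) * N + q3) * N + q4 + 1 < N ^ 4 ->
  exists q1' q2' q3' q4', [/\ q1' < N, q2' < N, q3' < N & q4' < N] /\
    ((q1' * N + q2') * N + q3') * N + q4' = ((q1 * N + q2) * N + q3) * N + q4 + 1 /\
    pexec (POdo A) (4 * (t_nextz A n + 2)) (odo q1 q2 q3 q4 t) RC (odo q1' q2' q3' q4' t).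
Proof.
move=> H1 H2 H3 H4 Hlt.
have N4 := @pexec_NextZ (A + 3) (odo q1 q2 q3 q4 t).
rewrite odo4 odou4 in N4.
have {}N4 := N4 _ H4.
have N3 := @pexec_NextZ (A + 2) (odo q1 q2 q3 0 t).
rewrite odo3 odou3 in N3.
have {}N3 := N3 _ H3.
have N2 := @pexec_NextZ (A + 1) (odo q1 q2 0 0 t).
rewrite odo2 odou2 in N2.
have {}N2 := N2 _ H2.
have N1 := @pexec_NextZ A (odo q1 0 0 0 t).
rewrite odo1 odou1 in N1.
have {}N1 := N1 _ H1.
case E4: (q4.+1 < N).
  exists q1, q2, q3, q4.+1; split; first by split.
  split; first by lia.
  apply: (@exec_weaken _ (t_nextz A n + 1)); last by lia.
  rewrite /zsucc E4 in N4; apply: (exec_If (N4 _)); first by rewrite /m; lia.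
  exact: exec_Ret.
case E3: (q3.+1 < N).
  exists q1, q2, q3.+1, 0; split; first by split.
  split; first by have -> : N = q4.+1 by [lia]; lia.
  apply: (@exec_weaken _ (t_nextz A n + (t_nextz A n + 1))); last by lia.
  rewrite /zsucc E4 in N4; apply: (exec_If (N4 _)); first by rewrite /m; lia.
  rewrite /zsucc E3 in N3; apply: (exec_If (N3 _)); first by rewrite /m; lia.
  exact: exec_Ret.
have EN4 : N = q4.+1 by lia.
have EN3 : q3 = q4 by lia.
case E2: (q2.+1 < N).
  exists q1, q2.+1, 0, 0; split; first by split.
  split; first by rewrite EN3 EN4; lia.
  apply: (@exec_weaken _ (t_nextz A n + (t_nextz A n + (t_nextz A n + 1)))); last by lia.
  rewrite /zsucc E4 in N4; apply: (exec_If (N4 _)); first by rewrite /m; lia.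
  rewrite /zsucc E3 in N3; apply: (exec_If (N3 _)); first by rewrite /m; lia.
  rewrite /zsucc E2 in N2; apply: (exec_If (N2 _)); first by rewrite /m; lia.
  exact: exec_Ret.
have EN2 : q2 = q4 by lia.
case E1: (q1.+1 < N).
  exists q1.+1, 0, 0, 0; split; first by split.
  split; first by rewrite EN3 EN2 EN4; lia.
  apply: (@exec_weaken _ (t_nextz A n + (t_nextz A n + (t_nextz A n + (t_nextz A n + 1))))); last by lia.
  rewrite /zsucc E4 in N4; apply: (exec_If (N4 _)); first by rewrite /m; lia.
  rewrite /zsucc E3 in N3; apply: (exec_If (N3 _)); first by rewrite /m; lia.
  rewrite /zsucc E2 in N2; apply: (exec_If (N2 _)); first by rewrite /m; lia.
  rewrite /zsucc E1 in N1; apply: (exec_If (N1 _)); first by rewrite /m; lia.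
  exact: exec_Ret.
have EN1 : q1 = q4 by lia.
move: Hlt; rewrite EN1 EN2 EN3 EN4 !expnS expn0; lia.
Qed.

Lemma digits_inj p1 p2 p3 p4 q1 q2 q3 q4 :
  p2 < N -> p3 < N -> p4 < N -> q2 < N -> q3 < N -> q4 < N ->
  ((p1 * N + p2) * N + p3) * N + p4 = ((q1 * N + q2) * N + q3) * N + q4 ->
  [/\ p1 = q1, p2 = q2, p3 = q3 & p4 = q4].
Proof.
have dec a b a' b' : b < N -> b' < N -> a * N + b = a' * N + b' -> a = a' /\ b = b'.
  move=> Hb Hb' E; have := congr1 (divn^~ N) E; have := congr1 (modn^~ N) E.
  by rewrite !modnMDl !divnMDl // !modn_small // !divn_small // !addn0.
move=> ? ? ? ? ? ? /dec [||/dec [||/dec [||]]] //.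
Qed.

Variables (i x1 x2 x3 x4 : nat).
Hypotheses (X1 : x1 < A) (X2 : x2 < A) (X3 : x3 < A) (X4 : x4 < A).
Hypotheses (S1 : s x1 < N) (S2 : s x2 < N) (S3 : s x3 < N) (S4 : s x4 < N).

Lemma pexec_Match q1 q2 q3 q4 t : q1 < N -> q2 < N -> q3 < N -> q4 < N ->
  pexec (PMatch A x1 x2 x3 x4) (4 * (2 * t_op A n + 2)) (odo q1 q2 q3 q4 t)
    (rb [&& q1 == s x1, q2 == s x2, q3 == s x3 & q4 == s x4]) (odo q1 q2 q3 q4 t).
Proof.
move=> H1 H2 H3 H4.
have HN p : p < N -> p < n by rewrite /n; lia.
have E1 := @pexec_Eq A x1 (odo q1 q2 q3 q4 t); rewrite odo1 odo_lt // in E1.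
have E2 := @pexec_Eq (A + 1) x2 (odo q1 q2 q3 q4 t); rewrite odo2 odo_lt // in E2.
have E3 := @pexec_Eq (A + 2) x3 (odo q1 q2 q3 q4 t); rewrite odo3 odo_lt // in E3.
have E4 := @pexec_Eq (A + 3) x4 (odo q1 q2 q3 q4 t); rewrite odo4 odo_lt // in E4.
apply: (@exec_weaken _ ((t_op A n + (t_op A n + 1)) + ((t_op A n + (t_op A n + 1)) +
  ((t_op A n + (t_op A n + 1)) + (t_op A n + (t_op A n + 1)))))); last by lia.
apply: (exec_If (E1 _ _ _ _)); try (by rewrite /m; lia); try exact: HN.
case: eqP => _; last by apply: exec_weaken; [apply: exec_Ret|lia].
apply: (exec_If (E2 _ _ _ _)); try (by rewrite /m; lia); try exact: HN.
case: eqP => _; last by apply: exec_weaken; [apply: exec_Ret|lia].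
apply: (exec_If (E3 _ _ _ _)); try (by rewrite /m; lia); try exact: HN.
case: eqP => _; last by apply: exec_weaken; [apply: exec_Ret|lia].
apply: E4; try (by rewrite /m; lia); exact: HN.
Qed.

(** Induction on the number [a] of quadruples still to be skipped. The invariant places the table
    pointer at [N] plus [r] times the odometer value, modulo [n]. *)
Lemma pexec_Search a q1 q2 q3 q4 : q1 < N -> q2 < N -> q3 < N -> q4 < N ->
  ((q1 * N + q2) * N + q3) * N + q4 + a = ((s x1 * N + s x2) * N + s x3) * N + s x4 ->
  exists q1' q2' q3' q4' t', [/\ q1' < N, q2' < N, q3' < N, q4' < N & t' < n] /\
  pexec (PSearch A r i x1 x2 x3 x4) (a.+1 * t_iter A r n + t_adv A i n)
    (odo q1 q2 q3 q4 ((N + (((q1 * N + q2) * N + q3) * N + q4) * r) %% n))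
    (rb (table_rel i (s x1) (s x2) (s x3) (s x4)))
    (odo q1' q2' q3' q4' t').
Proof.
elim: a q1 q2 q3 q4 => [|a IH] q1 q2 q3 q4 H1 H2 H3 H4 E.
  rewrite addn0 in E; have [E1 E2 E3 E4] := digits_inj H2 H3 H4 S2 S3 S4 E.
  set t := (N + _) %% n; exists q1, q2, q3, q4, ((t + i) %% n); split.
    by split; rewrite // ltn_mod.
  have -> : table_rel i (s x1) (s x2) (s x3) (s x4) = nth false (z ++ y) ((t + i) %% n).
    by rewrite /table_rel /table_pos /t modnDml -E addnA.
  apply: exLoopE; last by case: (nth _ _ _).
  apply: (@exec_weaken _ (4 * (2 * t_op A n + 2) + (t_adv A i n + t_op A n))); last by rewrite /t_iter; lia.
  apply: (exec_If (pexec_Match _ H1 H2 H3 H4)).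
  rewrite E1 E2 E3 E4 !eqxx -E1 -E2 -E3 -E4 /=.
  have HA := @pexec_Adv i (odo q1 q2 q3 q4 t); rewrite odo5 odou5 in HA.
  apply: (exec_Seq (b := true) (HA _)); first by rewrite ltn_mod.
  have HB := @exec_Bit z y m h n_gt0 (A + 4) (odo q1 q2 q3 q4 ((t + i) %% n)); rewrite odo5 in HB.
  by apply: HB; rewrite ?ltn_mod // /m; lia.
have Hne : [&& q1 == s x1, q2 == s x2, q3 == s x3 & q4 == s x4] = false.
  by apply/negP => /and4P [/eqP E1 /eqP E2 /eqP E3 /eqP E4]; move: E; rewrite E1 E2 E3 E4; lia.
set t := (N + _) %% n.
have Hlt : ((q1 * N + q2) * N + q3) * N + q4 + 1 < N ^ 4.
  apply: (@leq_ltn_trans (((s x1 * N + s x2) * N + s x3) * N + s x4)); first by lia.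
  exact: digits_lt.
have [q1' [q2' [q3' [q4' [[G1 G2 G3 G4] [Eq HO]]]]]] := pexec_Odo ((t + r) %% n) H1 H2 H3 H4 Hlt.
have [|e1 [e2 [e3 [e4 [t' [Ge HS]]]]]] := IH q1' q2' q3' q4' G1 G2 G3 G4; first by lia.
exists e1, e2, e3, e4, t'; split=> //.
apply: (@exLoopC _ (4 * (2 * t_op A n + 2) + (t_adv A r n + (4 * (t_nextz A n + 2))))
   (a.+1 * t_iter A r n + t_adv A i n) _ _ _ (lay z y m h (cell z y (odo q1' q2' q3' q4' ((t + r) %% n)))) h); last by rewrite /t_iter; lia.
  apply: (exec_If (pexec_Match _ H1 H2 H3 H4)); rewrite Hne.
  have HA := @pexec_Adv r (odo q1 q2 q3 q4 t); rewrite odo5 odou5 in HA.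
  by apply: (exec_Seq (b := true) (HA _)); rewrite ?ltn_mod.
have -> : (t + r) %% n = (N + (((q1' * N + q2') * N + q3') * N + q4') * r) %% n.
  by rewrite /t modnDml Eq; congr (_ %% n); lia.
exact: HS.
Qed.

Lemma pexec_Clean q1 q2 q3 q4 t : q1 < N -> q2 < N -> q3 < N -> q4 < N -> t < n ->
  pexec (PClean A) (5 * t_wrap A n) (odo q1 q2 q3 q4 t) RT (odo 0 0 0 0 0).
Proof.
move=> H1 H2 H3 H4 Ht.
have HN p : p < N -> p < n by rewrite /n; lia.
apply: (@exec_weaken _ (t_wrap A n + (t_wrap A n + (t_wrap A n + (t_wrap A n + t_wrap A n))))); last by lia.
have W1 := @pexec_Wrap A (odo q1 q2 q3 q4 t); rewrite odo1 odou1 in W1.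
have W2 := @pexec_Wrap (A + 1) (odo 0 q2 q3 q4 t); rewrite odo2 odou2 in W2.
have W3 := @pexec_Wrap (A + 2) (odo 0 0 q3 q4 t); rewrite odo3 odou3 in W3.
have W4 := @pexec_Wrap (A + 3) (odo 0 0 0 q4 t); rewrite odo4 odou4 in W4.
have W5 := @pexec_Wrap (A + 4) (odo 0 0 0 0 t); rewrite odo5 odou5 in W5.
apply: (exec_Seq (b := true) (W1 _ _)); [by rewrite /m; lia|exact: HN|].
apply: (exec_Seq (b := true) (W2 _ _)); [by rewrite /m; lia|exact: HN|].
apply: (exec_Seq (b := true) (W3 _ _)); [by rewrite /m; lia|exact: HN|].
apply: (exec_Seq (b := true) (W4 _ _)); [by rewrite /m; lia|exact: HN|].
by apply: W5; rewrite // /m; lia.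
Qed.

Lemma pexec_Rel : (forall j, A <= j -> s j = 0) -> i < r ->
  pexec (PRel A r i x1 x2 x3 x4) (t_rel A r n) s
    (rb (table_rel i (s x1) (s x2) (s x3) (s x4))) s.
Proof.
move=> Hs Hi.
have E0 : odo 0 0 0 0 0 = s.
  apply: functional_extensionality => j; rewrite /odo.
  by do 5!(case: eqP => [->|_]; first by rewrite Hs //; lia).
have HT := @pexec_Table (odo 0 0 0 0 0); rewrite odo5 odou5 in HT.
have HJ : ((s x1 * N + s x2) * N + s x3) * N + s x4 <= n ^ 4.
  apply: (@leq_trans (N ^ 4)); last by rewrite leq_exp2r // /n; lia.
  exact/ltnW/digits_lt.
have [q1 [q2 [q3 [q4 [t [[G1 G2 G3 G4 Gt] HS]]]]]] :=
  @pexec_Search (((s x1 * N + s x2) * N + s x3) * N + s x4) 0 0 0 0 N_gt0 N_gt0 N_gt0 N_gt0 (erefl _).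
have HC := pexec_Clean G1 G2 G3 G4 Gt; rewrite E0 in HC HT.
have Et : (N + (((0 * N + 0) * N + 0) * N + 0) * r) %% n = N %% n by congr (_ %% n); lia.
rewrite Et in HS.
apply: (@exec_weaken _ (n.+1 * (2 * t_op A n + 2) +
   (((((s x1 * N + s x2) * N + s x3) * N + s x4).+1 * t_iter A r n + t_adv A i n) + (5 * t_wrap A n + 1)))).
  apply: (exec_Seq (b := true) (HT (erefl _))).
  apply: (exec_If HS).
  case: (table_rel _ _ _ _ _); apply: (exec_Seq (b := true) HC); exact: exec_Ret.
rewrite /t_rel.
have : t_adv A i n <= t_adv A r n by rewrite /t_adv leq_mul2r; apply/orP; right; lia.
have : (((s x1 * N + s x2) * N + s x3) * N + s x4).+1 * t_iter A r n <= (n ^ 4).+1 * t_iter A r n.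
  by rewrite leq_mul2r; apply/orP; right; lia.
lia.
Qed.
End Search.

Variable R : rels.
Hypothesis table_ok : forall i p1 p2 p3 p4, i < r ->
  p1 < N -> p2 < N -> p3 < N -> p4 < N ->
  table_rel i p1 p2 p3 p4 = R i p1 p2 p3 p4.

(** Both quantifiers at once: [good] selects the universal loop, which stops early at a failing
    value, or the existential one, which stops early at a witness. *)
Lemma pexec_loop (p c1 : prog) (good : bool) (d : nat) (T : nat) (s : nat -> nat)
    (P : nat -> Prop) : d < m -> s d = 0 ->
  (forall v, v < N -> exists b : bool, pexec p T (supd s d v) (rb b) (supd s d v) /\ (b <-> P v)) ->
  c1 = (if good then If p (If (PNextZ A d) (Ret RC) (Ret RT)) (Seq (PWrap A d) (Ret RF))
        else If p (Seq (PWrap A d) (Ret RT)) (If (PNextZ A d) (Ret RC) (Ret RF))) ->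
  exists b : bool, pexec (Loop c1) (n.+1 * (T + t_nextz A n + t_wrap A n + 3)) s (rb b) s /\
    (b <-> if good then (forall v, v < N -> P v) else exists2 v, v < N & P v).
Proof.
move=> Hd Hs0 Hp ->.
have HW v : v < N -> pexec (PWrap A d) (t_wrap A n) (supd s d v) RT s.
  move=> Hv; have := @pexec_Wrap d (supd s d v) Hd; rewrite supd_eq supdK (supd_same Hs0).
  by apply; rewrite /n; lia.
have HZ v : v < N -> pexec (PNextZ A d) (t_nextz A n) (supd s d v) (rb (v.+1 < N)) (supd s d (zsucc v)).
  by move=> Hv; have := @pexec_NextZ d (supd s d v) Hd; rewrite supd_eq supdK; apply.
suff H a v : v + a.+1 = N -> exists b : bool, pexec (Loop (if good then If p (If (PNextZ A d) (Ret RC) (Ret RT)) (Seq (PWrap A d) (Ret RF))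
        else If p (Seq (PWrap A d) (Ret RT)) (If (PNextZ A d) (Ret RC) (Ret RF))))
    (a.+1 * (T + t_nextz A n + t_wrap A n + 3)) (supd s d v) (rb b) s /\
    (b <-> if good then (forall u, v <= u -> u < N -> P u) else exists2 u, v <= u < N & P u).
  have [|b [H1 H2]] := H N.-1 0; first by lia.
  exists b; split.
    rewrite (supd_same Hs0) in H1; apply: (exec_weaken H1).
    by rewrite leq_mul2r; apply/orP; right; rewrite /n; lia.
  rewrite H2; case: (good); split.
  - by move=> G v; apply: G.
  - by move=> G v _; apply: G.
  - by move=> [v]; exists v.
  - by move=> [v]; exists v.
elim: a v => [|a IH] v Hv.
  have Hvn : v < N by lia.
  have [b [H1 H2]] := Hp v Hvn; exists b; split.
    have HZ' := HZ v Hvn; have HW' := HW v Hvn.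
    have Ez : (v.+1 < N) = false by lia.
    have EZ := supd_same Hs0.
    rewrite /zsucc Ez EZ in HZ'.
    apply: exLoopE; last by case: (b).
    apply: (@exec_weaken _ (T + (t_nextz A n + t_wrap A n + 1))); last by lia.
    case: (good); apply: (exec_If H1); case: (b).
    - by apply: (@exec_weaken _ (t_nextz A n + 1)); [apply: (exec_If HZ'); apply: exec_Ret|lia].
    - by apply: (@exec_weaken _ (t_wrap A n + 1)); [apply: (exec_Seq (b := true) HW'); apply: exec_Ret|lia].
    - by apply: (@exec_weaken _ (t_wrap A n + 1)); [apply: (exec_Seq (b := true) HW'); apply: exec_Ret|lia].
    - by apply: (@exec_weaken _ (t_nextz A n + 1)); [apply: (exec_If HZ'); apply: exec_Ret|lia].
  rewrite H2; case: (good); split.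
  - by move=> Pv u Hu1 Hu2; have -> : u = v by lia.
  - by apply.
  - by exists v => //; lia.
  - by case=> u Hu; have -> : u = v by lia.
have Hvn : v < N by lia.
have [b [H1 H2]] := Hp v Hvn.
have HZ' := HZ v Hvn; have HW' := HW v Hvn.
have Ez : (v.+1 < N) = true by lia.
rewrite /zsucc Ez in HZ'.
have [|b' [H1' H2']] := IH v.+1; first by lia.
case Eg: good H1' H2' IH; case Eb: b H1 H2 => H1 H2 H1' H2' _.
- exists b'; split.
    apply: (exLoopC _ H1' (t1 := T + (t_nextz A n + 1))); last by lia.
    by apply: (exec_If (b := true) H1); apply: (exec_If HZ'); apply: exec_Ret.
  rewrite H2'; split=> G u Hu1 Hu2; last by apply: G; lia.
  by case: (ltngtP v u) Hu1 => // [Hu|<-] _; [apply: G|apply/H2].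
- exists false; split.
    apply: exLoopE => //; apply: (@exec_weaken _ (T + (t_wrap A n + 1))); last by lia.
    by apply: (exec_If (b := false) H1); apply: (exec_Seq (b := true) HW'); apply: exec_Ret.
  by split => // G; apply/H2; apply: G.
- exists true; split.
    apply: exLoopE => //; apply: (@exec_weaken _ (T + (t_wrap A n + 1))); last by lia.
    by apply: (exec_If (b := true) H1); apply: (exec_Seq (b := true) HW'); apply: exec_Ret.
  by split => // _; exists v; [lia|apply/H2].
- exists b'; split.
    apply: (exLoopC _ H1' (t1 := T + (t_nextz A n + 1))); last by lia.
    by apply: (exec_If (b := false) H1); apply: (exec_If HZ'); apply: exec_Ret.
  rewrite H2'; split=> -[u Hu Pu]; first by exists u => //; lia.
  exists u => //; case: (v =P u) => [Eu|]; last by lia.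
  by rewrite -Eu in Pu; have := H2.2 Pu.
Qed.

(** The program side [f] has pointer indices for variables and the semantic side [g] has positions;
    [G] records which pointer holds which position. The bound [d + k <= A] reserves pointers below
    the odometer for the quantifiers to come. *)
Lemma pexec_form k G f g : eqv r k G f g ->
  forall d s, d + k <= A ->
  (forall x v, (x, v) \in G -> [/\ x < d, s x = v & v < N]) ->
  (forall i, d <= i -> s i = 0) ->
  exists b : bool, pexec (fprog A r d f) (t_form A r d f n) s (rb b) s /\ (b <-> sat z R g).
Proof.
have HN p : p < N -> p < n by rewrite /n; lia.
elim=> {k G f g}.
- move=> k G x v Hx d s Hd HG Hs; have [Hxd Es Hv] := HG _ _ Hx.
  exists (nth false z v); split=> //=.
  have HB := @exec_Bit z y m h n_gt0 x s; rewrite Es nth_cat Hv in HB.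
  by apply: HB; rewrite ?HN // /m; lia.
- move=> k G x v x' v' Hx Hx' d s Hd HG Hs.
  have [Hxd Es Hv] := HG _ _ Hx; have [Hxd' Es' Hv'] := HG _ _ Hx'.
  exists (v < v'); split=> //=.
  have HB := @exec_Lt z y m h n_gt0 x x' s; rewrite Es Es' in HB.
  by apply: HB; rewrite ?HN // /m; lia.
- move=> k G i x1 v1 x2 v2 x3 v3 x4 v4 Hi Hx1 Hx2 Hx3 Hx4 d s Hd HG Hs.
  have [Hd1 E1 Hv1] := HG _ _ Hx1; have [Hd2 E2 Hv2] := HG _ _ Hx2.
  have [Hd3 E3 Hv3] := HG _ _ Hx3; have [Hd4 E4 Hv4] := HG _ _ Hx4.
  exists (R i v1 v2 v3 v4); split=> //=.
  have HB := @pexec_Rel s i x1 x2 x3 x4; rewrite E1 E2 E3 E4 table_ok // in HB.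
  by apply: HB => //; try lia; move=> j Hj; apply: Hs; lia.
- move=> k G f g _ IH d s Hd HG Hs; have [b [H1 H2]] := IH d s Hd HG Hs.
  exists (~~ b); split.
    rewrite /= -addn1; apply: (exec_If H1).
    by case: (b); apply: exec_Ret.
  by rewrite /= -H2; case: (b); split.
- move=> k G f g f' g' _ IH _ IH' d s Hd HG Hs.
  have [b [H1 H2]] := IH d s Hd HG Hs; have [b' [H1' H2']] := IH' d s Hd HG Hs.
  exists (b && b'); split; last by rewrite /= -H2 -H2'; split=> [/andP|/andP].
  apply: (@exec_weaken _ (t_form A r d f n + (t_form A r d f' n + 1))); last by rewrite /=; lia.
  apply: (exec_If H1); case: (b) => /=.
    by apply: exec_weaken H1' _; lia.
  by apply: exec_weaken; [apply: exec_Ret|lia].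
- move=> k G f g f' g' _ IH _ IH' d s Hd HG Hs.
  have [b [H1 H2]] := IH d s Hd HG Hs; have [b' [H1' H2']] := IH' d s Hd HG Hs.
  exists (b || b'); split; last by rewrite /= -H2 -H2'; split=> [/orP|/orP].
  apply: (@exec_weaken _ (t_form A r d f n + (t_form A r d f' n + 1))); last by rewrite /=; lia.
  apply: (exec_If H1); case: (b) => /=; last by apply: exec_weaken H1' _; lia.
  by apply: exec_weaken; [apply: exec_Ret|lia].
- move=> k G f g f' g' _ IH _ IH' d s Hd HG Hs.
  have [b [H1 H2]] := IH d s Hd HG Hs; have [b' [H1' H2']] := IH' d s Hd HG Hs.
  exists (b ==> b'); split; last by rewrite /= -H2 -H2'; split=> [/implyP|/implyP].
  apply: (@exec_weaken _ (t_form A r d f n + (t_form A r d f' n + 1))); last by rewrite /=; lia.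
  apply: (exec_If H1); case: (b) => /=; first by apply: exec_weaken H1' _; lia.
  by apply: exec_weaken; [apply: exec_Ret|lia].
- move=> k G f g _ IH d s Hd HG Hs.
  apply: (@pexec_loop (fprog A r d.+1 (f d)) _ true d _ s (fun v => sat z R (g v))) => //.
  + by rewrite /m; lia.
  + exact: Hs.
  move=> v Hv; apply: IH; first by lia.
    move=> x u; rewrite inE => /orP [/eqP [-> ->]|/HG [H1 H2 H3]].
      by rewrite supd_eq.
    by split; rewrite ?supd_ne //; lia.
  by move=> i Hi; rewrite supd_ne ?Hs //; lia.
- move=> k G f g _ IH d s Hd HG Hs.
  apply: (@pexec_loop (fprog A r d.+1 (f d)) _ false d _ s (fun v => sat z R (g v))) => //.
  + by rewrite /m; lia.
  + exact: Hs.
  move=> v Hv; apply: IH; first by lia.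
    move=> x u; rewrite inE => /orP [/eqP [-> ->]|/HG [H1 H2 H3]].
      by rewrite supd_eq.
    by split; rewrite ?supd_ne //; lia.
  by move=> i Hi; rewrite supd_ne ?Hs //; lia.
Qed.
End Correctness.

Ltac poly := repeat first
  [ exact: poly_id | exact: poly_const | assumption
  | apply: poly_add | apply: poly_mul | apply: poly_S | apply: poly_exp ].

Lemma poly_t_op A : is_poly (t_op A).
Proof. by rewrite /t_op; poly. Qed.

Lemma poly_t_wrap A : is_poly (t_wrap A).
Proof. by have H := poly_t_op A; rewrite /t_wrap; poly. Qed.

Lemma poly_t_nextz A : is_poly (t_nextz A).
Proof. by have H := poly_t_op A; have H' := poly_t_wrap A; rewrite /t_nextz; poly. Qed.

Lemma poly_t_rel A r : is_poly (t_rel A r).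
Proof.
have H := poly_t_op A; have H' := poly_t_wrap A; have H2 := poly_t_nextz A.
by rewrite /t_rel /t_iter /t_adv; poly.
Qed.

Lemma poly_t_form A r d f : is_poly (t_form A r d f).
Proof.
have H := poly_t_op A; have H' := poly_t_wrap A; have H2 := poly_t_nextz A.
elim: f d => /=.
- by [].
- by [].
- by move=> *; apply: poly_t_rel.
- by move=> f IH d; have := IH d; move=> Hd; poly.
- by move=> f IH g IH' d; have Hd := IH d; have Hd' := IH' d; poly.
- by move=> f IH g IH' d; have Hd := IH d; have Hd' := IH' d; poly.
- by move=> f IH g IH' d; have Hd := IH d; have Hd' := IH' d; poly.
- by move=> g IH d; have Hd := IH d d.+1; poly.
- by move=> g IH d; have Hd := IH d d.+1; poly.
Qed.

(* Lists the values of the first r relations on {0, .., N - 1} in the order in *)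
(* which PRel enumerates them.                                                 *)
Definition table (r N : nat) (R : rels) : seq bool :=
  mkseq (fun e => let j := e %/ r in
    R (e %% r) (j %/ N %/ N %/ N) (j %/ N %/ N %% N) (j %/ N %% N) (j %% N)) (N ^ 4 * r).

Lemma table_relE z r R i p1 p2 p3 p4 : i < r ->
  p1 < size z -> p2 < size z -> p3 < size z -> p4 < size z ->
  table_rel z (table r (size z) R) r i p1 p2 p3 p4 = R i p1 p2 p3 p4.
Proof.
set N := size z => Hi H1 H2 H3 H4.
have Hlt := digits_lt H1 H2 H3 H4.
set j := ((p1 * N + p2) * N + p3) * N + p4 in Hlt.
have Hjr : j * r + i < N ^ 4 * r by nia.
rewrite /table_rel /table_pos -/N -/j size_mkseq modn_small ?ltn_add2l //.
rewrite nth_cat ifF; last by rewrite -/N; lia.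
rewrite -/N addKn nth_mkseq //.
have dvE a b q : b < q -> (a * q + b) %/ q = a.
  by move=> Hb; rewrite divnMDl ?divn_small ?addn0 //; lia.
have mdE a b q : b < q -> (a * q + b) %% q = b by move=> Hb; rewrite modnMDl modn_small.
by rewrite /j !(dvE, mdE).
Qed.

(** * Existential second-order sentences define NP languages *)

Section Fagin.
Variables (r k : nat) (f : fo nat).
Hypothesis f_param : eqv r k [::] f f.
Let A := k.
Let m := A + 5.

Definition t_layout (h n : nat) : nat := (n + 2) * (4 * (h + n * m.+2 + m + 20) + 10).

Lemma exec_fagin z y R : z <> [::] ->
  (forall i p1 p2 p3 p4, i < r ->
    p1 < size z -> p2 < size z -> p3 < size z -> p4 < size z ->
    table_rel z y r i p1 p2 p3 p4 = R i p1 p2 p3 p4) ->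
  exists b : bool, (exists F e, exec (fagin_prog A r f)
    (t_layout (size (pair_enc z y)) (size z + size y) + (m + 10 + t_form A r 0 f (size z + size y)))
    (input_tape 0 (pair_enc z y)) 0 (rb b) F e) /\ (b <-> sat z R f).
Proof.
move=> z0 HR.
have N0 : 0 < size z by case: (z) z0.
have n0 : 0 < size z + size y by lia.
set h := size (pair_enc z y).
have HF := @pexec_form z y A r h N0 R HR _ _ _ _ f_param 0 (fun=> 0).
have [//|//|//|b [H1 H2]] := HF.
exists b; split=> //.
exists (lay z y m h (cell z y (fun=> 0))), h.
apply: (exec_Seq (b := true) (exec_Relayout z y m)).
apply: (@exec_weaken _ (3 + (1 + (3 + t_form A r 0 f (size z + size y))))); last by lia.
apply: (exec_Seq (b := true) (exec_MovesR _ _ _)).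
have E : h + 2 = pos m h 0 1 by rewrite /pos; lia.
apply: (exec_If (exec_Is _ _ _)).
rewrite E lay_pos // (_ : Some _ == Some false); last by rewrite /cell leqNgt N0.
apply: (exec_Seq (b := true) _ H1); rewrite -E.
apply: exec_SkipL => //; last exact: lay_home.
move=> [|[|i]] // _; rewrite -/m.
  by rewrite (_ : h + 1 = pos m h 0 0) ?lay_pos // /pos; lia.
by rewrite E lay_pos.
Qed.

Lemma exec_fagin_nil y : exists t F e, exec (fagin_prog A r f) t
    (input_tape 0 (pair_enc [::] y)) 0 RF F e.
Proof.
set h := size (pair_enc [::] y); set F := lay [::] y m h (cell [::] y (fun=> 0)).
exists (t_layout h (size y) + (3 + (1 + 1))), F, (h + 2).
apply: (exec_Seq (b := true) (exec_Relayout [::] y m)).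
apply: (exec_Seq (b := true) (exec_MovesR _ _ _)).
apply: (exec_If (exec_Is _ _ _)).
rewrite (_ : _ == Some false = false); first exact: exec_Ret.
rewrite -/h -/m -/F /F /lay; case: ifP => // _; case: ifP => // _.
have -> : h + 2 - h.+1 = 1 by lia.
by rewrite modn_small.
Qed.

(** A satisfying interpretation is written out as [table]; conversely [table_rel] reads an
    interpretation off an accepted certificate. One polynomial must bound both the certificate and
    the time, so the sum of the two bounds is taken. *)
Theorem fagin_inNP : inNP (fun z => z <> [::] /\ exists R, sat z R f).
Proof.
pose Y N := N ^ 4 * r.
pose T N := t_layout (N.*2 + 2 + Y N) (N + Y N) + (m + 10 + t_form A r 0 f (N + Y N)).
have PY : is_poly Y by rewrite /Y; poly.
have Pn : is_poly (fun N => N + Y N) by poly.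
have Pd : is_poly (fun N => N.*2) by apply: (@poly_le _ (fun N => N * 2)); [move=> N; lia|poly].
have PT : is_poly T.
  have := poly_comp (poly_t_form A r 0 f) Pn => Pf.
  by rewrite /T /t_layout; poly.
have [c [d Hcd]] : is_poly (fun N => Y N + T N) by poly.
exists (prog_machine (fagin_prog A r f)), c, d => z; split.
  move=> [z0 [R HR]]; exists (table r (size z) R).
  have sT : size (table r (size z) R) = Y (size z) by rewrite size_mkseq.
  split; first by rewrite sT; apply: leq_trans (Hcd _); lia.
  have [|b [[F [e H1]] H2]] := @exec_fagin z (table r (size z) R) R z0.
    by move=> *; apply: table_relE.
  rewrite (H2.2 HR) in H1; apply: (prog_machine_accepts H1).
  rewrite size_pair_enc sT; apply: leq_trans (Hcd _); rewrite /T; lia.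
move=> [y [_ Hacc]].
case: (z =P [::]) => [Ez|z0].
  have [t [F [e H]]] := exec_fagin_nil y.
  by rewrite Ez in Hacc; have := prog_machine_rejects (poly_bound c d (size (Nil bool))) H; rewrite Hacc.
split=> //; exists (table_rel z y r).
have [//|[] [[F [e H1]] H2]] := @exec_fagin z y (table_rel z y r) z0.
  exact/H2.
(* If the formula were false the program would answer [RF], and then no time bound allows
   acceptance. *)
by have := prog_machine_rejects (poly_bound c d (size z)) H1; rewrite Hacc.
Qed.
End Fagin.

(** * Parsing the instance *)

(** The places where numbers occur: knowledge base, prerequisite, justification, conclusion,
    backdoor. *)
Inductive kind := KW | KP | KJ | KC | KB.
Inductive qst := W0 | D0 | B0 | QE | QX | CL of kind | LL of kind | NN of kind
  | NF of kind | N1 of kind | NB of kind | NZ of kind | SS of kind.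

Definition after_cnf (k : kind) : qst :=
  match k with KW => W0 | KP => CL KJ | KJ => CL KC | KC => D0 | KB => QX end.

(* A deterministic automaton for the range of enc_instance: W0, D0 and B0 read   *)
(* the separators of the three outer lists, CL and LL those of a clause list and *)
(* of a literal list, NN, NF, N1, NB and NZ the code of a number, and SS the     *)
(* sign of a literal or (for KB) the separator behind an element of the backdoor. *)
Definition dq (q : qst) (b : bool) : qst :=
  match q with
  | W0 => if b then CL KW else D0
  | D0 => if b then CL KP else B0
  | B0 => if b then NN KB else QE
  | CL k => if b then LL k else after_cnf k
  | LL KB => QX
  | LL k => if b then NN k else CL k
  | NN k => if b then NF k else NZ k
  | NF k => if b then N1 k else QX
  | N1 k => if b then NB k else NZ k
  | NB k => N1 k
  | NZ k => if b then QX else SS k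
  | SS KB => if b then NN KB else QE
  | SS k => LL k
  | QE | QX => QX
  end.

(* The same for strings pair_enc x (1 .. 1): Mk reads the marker in front of a   *)
(* bit of x, and Rd the bit itself.                                              *)
Inductive zst := Mk of qst | Rd of qst | F0 | FF | ZX.

Definition dz (s : zst) (b : bool) : zst :=
  match s with
  | Mk q => if b then Rd q else if q is QE then F0 else ZX
  | Rd q => Mk (dq q b)
  | F0 => if b then ZX else FF
  | FF => if b then FF else ZX
  | ZX => ZX
  end.

Definition kinds := [:: KW; KP; KJ; KC; KB].
Definition qsts := [:: W0; D0; B0; QE; QX] ++ map CL kinds ++ map LL kinds ++ map NN kinds
  ++ map NF kinds ++ map N1 kinds ++ map NB kinds ++ map NZ kinds ++ map SS kinds.
Definition zsts := map Mk qsts ++ map Rd qsts ++ [:: F0; FF; ZX].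

Definition kc (k : kind) : nat :=
  match k with KW => 0 | KP => 1 | KJ => 2 | KC => 3 | KB => 4 end.
Definition qc (q : qst) : nat :=
  match q with
  | W0 => 0 | D0 => 1 | B0 => 2 | QE => 3 | QX => 4
  | CL k => 5 + kc k | LL k => 10 + kc k | NN k => 15 + kc k | NF k => 20 + kc k
  | N1 k => 25 + kc k | NB k => 30 + kc k | NZ k => 35 + kc k | SS k => 40 + kc k
  end.
(** The 93 codes double as relation symbols, one per state; the other symbols of the formula begin
    at 93. *)
Definition zc (s : zst) : nat :=
  match s with Mk q => qc q | Rd q => 45 + qc q | F0 => 90 | FF => 91 | ZX => 92 end.

Lemma nth_zsts s : nth ZX zsts (zc s) = s.
Proof. by case: s => // q; case: q => // -[]. Qed.

Lemma zc_inj : injective zc.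
Proof. by move=> s s' E; rewrite -[s]nth_zsts E nth_zsts. Qed.

Lemma zc_lt s : zc s < 93.
Proof. by case: s => // q; case: q => // -[]. Qed.

Definition pr (x : seq bool) : seq bool := flatten (map (fun b => [:: true; b]) x).

Lemma pr_cat x y : pr (x ++ y) = pr x ++ pr y.
Proof. by rewrite /pr map_cat flatten_cat. Qed.

Lemma pr_inj : injective pr.
Proof. by elim=> [|a x IH] [|b y] //= [-> /IH ->]. Qed.

Lemma pair_encE x y : pair_enc x y = pr x ++ [:: false; false] ++ y.
Proof. by []. Qed.

Lemma pair_enc_inj x y x' y' : pair_enc x y = pair_enc x' y' -> x = x' /\ y = y'.
Proof.
elim: x x' => [|a x IH] [|b x'] //=; first by case.
by rewrite !pair_encE /= => -[-> /IH [-> ->]].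
Qed.

Definition nat_bits (n : nat) : seq bool :=
  match N.of_nat n with N0 => [::] | Npos p => pos_bits p end.

Lemma enc_natE n : enc_nat n = pr (nat_bits n) ++ [:: false; false].
Proof. by []. Qed.

(** The leading binary digit is one. Codes are therefore canonical, and the automaton insists on
    this digit in state [N1] reached from [NF], whose marker and digit are both [true]. *)
Lemma pos_bits_head p : exists s, pos_bits p = true :: s.
Proof.
elim: p => [p [s E]|p [s E]|] /=; last by exists [::].
  by exists (rcons s true); rewrite E.
by exists (rcons s false); rewrite E.
Qed.

Lemma pos_bits_inj : injective pos_bits.
Proof.
elim=> [p IH|p IH|] [q|q|] //=; try by move=> /rcons_inj [] // /IH ->.
- by have [s ->] := pos_bits_head p; case: s.
- by have [s ->] := pos_bits_head p; case: s.
- by have [s ->] := pos_bits_head q; case: s.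
- by have [s ->] := pos_bits_head q; case: s.
Qed.

Lemma nat_bits_inj : injective nat_bits.
Proof.
move=> m n; rewrite /nat_bits => E.
apply: (Nnat.Nat2N.inj); move: E.
case: (N.of_nat m) => [|p]; case: (N.of_nat n) => [|q] //.
- by have [s ->] := pos_bits_head q.
- by have [s ->] := pos_bits_head p.
- by move=> /pos_bits_inj ->.
Qed.

Lemma enc_nat_inj : injective enc_nat.
Proof.
move=> m n; rewrite !enc_natE => E; apply: nat_bits_inj; apply: pr_inj; move: E.
by move/(congr1 (fun s => take (size s - 2) s)); rewrite !size_cat !addnK !take_size_cat.
Qed.

Lemma nat_bits_surj s : exists n, nat_bits n = true :: s.
Proof.
suff [p Ep] : exists p, pos_bits p = true :: s.
  by exists (N.to_nat (Npos p)); rewrite /nat_bits Nnat.N2Nat.id.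
elim/last_ind: s => [|s b [p Ep]]; first by exists xH.
by case: b; [exists (xI p)|exists (xO p)]; rewrite /= Ep.
Qed.

Section ParseSound.

Definition LB x := exists B, x = enc_seq enc_nat B.
Definition LD x := exists D x', x = enc_seq enc_rule D ++ x' /\ LB x'.
Definition LC x := exists f x', x = enc_cnf f ++ x' /\ LD x'.
Definition LJ x := exists f x', x = enc_cnf f ++ x' /\ LC x'.
Definition LP x := exists f x', x = enc_cnf f ++ x' /\ LJ x'.
Definition LW x := exists W x', x = enc_seq enc_cnf W ++ x' /\ LD x'.
Definition LWc x := exists f x', x = enc_cnf f ++ x' /\ LW x'.
Definition Lcnf k x := match k with KW => LWc x | KP => LP x | KJ => LJ x | KC => LC x | KB => False end.
Definition Lclause k x := exists c x', x = enc_clause c ++ x' /\ Lcnf k x'.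
Definition Lsign k x := match k with KB => LB x | _ => exists b x', x = b :: x' /\ Lclause k x' end.
(** The strings that complete an instance once the automaton is in state [q]; the auxiliary
    predicates follow the order knowledge base, rules, backdoor. *)
Definition Lang (q : qst) (x : seq bool) : Prop :=
  match q with
  | W0 => LW x | D0 => LD x | B0 => LB x | QE => x = [::] | QX => False
  | CL k => Lcnf k x | LL k => Lclause k x
  | NN k => exists n x', x = enc_nat n ++ x' /\ Lsign k x'
  | NF k => exists s x', x = true :: pr s ++ [:: false, false & x'] /\ Lsign k x'
  | N1 k => exists s x', x = pr s ++ [:: false, false & x'] /\ Lsign k x'
  | NB k => exists b s x', x = b :: pr s ++ [:: false, false & x'] /\ Lsign k x'
  | NZ k => exists x', x = false :: x' /\ Lsign k x'
  | SS k => Lsign k x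
  end.

Lemma enc_cnf_cons c f : enc_cnf (c :: f) = true :: enc_clause c ++ enc_cnf f.
Proof. by rewrite /enc_cnf /enc_seq /= catA. Qed.

Lemma enc_clause_cons l c : enc_clause (l :: c) = true :: enc_nat l.1 ++ l.2 :: enc_clause c.
Proof. by rewrite /enc_clause /enc_seq /enc_lit /= -!catA. Qed.

Lemma Lcnf_cons k c x : Lcnf k x -> Lcnf k (true :: enc_clause c ++ x).
Proof.
by case: k => //= -[f [x' [-> H]]]; exists (c :: f), x'; rewrite enc_cnf_cons /= -catA.
Qed.

Lemma Lcnf_nil k x : Lang (after_cnf k) x -> Lcnf k (false :: x).
Proof. by case: k => //= H; exists [::], x. Qed.

(** Used from the end of the string backwards: whatever leads to [QE] is a legal remainder. In state
    [NN] a string of digits beginning with one is turned back into a number by [nat_bits_surj]. *)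
Lemma parse_step q b x : Lang (dq q b) x -> Lang q (b :: x).
Proof.
case: q => [||||| k|k|k|k|k|k|k|k] //=.
- case: b => /=; last by move=> H; exists [::], x.
  move=> [f [x1 [-> [W [x2 [-> H]]]]]]; exists (f :: W), x2; split=> //.
  by rewrite /enc_seq /= -!catA.
- case: b => /=; last by move=> H; exists [::], x.
  move=> [f [x1 [-> [g [x2 [-> [h [x3 [-> [D [x4 [-> H]]]]]]]]]]]].
  exists ((f, g, h) :: D), x4; split=> //.
  by rewrite /enc_seq /= /enc_rule /rpre /rjust /rconcl /= -!catA.
- case: b => /=; last by move=> ->; exists [::].
  move=> [n [x1 [-> [B ->]]]]; exists (n :: B).
  by rewrite /enc_seq /= -!catA.
- case: b => /=; last exact: Lcnf_nil.
  by move=> [c [x1 [-> H]]]; apply: Lcnf_cons.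
- case: k => //=; case: b => /=; try (by move=> H; exists [::], x);
  move=> [n [x1 [-> [b [x2 [-> [c [x3 [-> H]]]]]]]]]; exists ((n, b) :: c), x3;
  by rewrite enc_clause_cons /= -!catA.
- case: b => /=.
    move=> [s [x1 [-> H]]]; have [n En] := nat_bits_surj s.
    by exists n, x1; rewrite enc_natE En /= -catA.
  by move=> [x1 [-> H]]; exists 0, x1.
- by case: b => //= -[s [x1 [-> H]]]; exists s, x1.
- case: b => /=.
    by move=> [b [s [x1 [-> H]]]]; exists (b :: s), x1.
  by move=> [x1 [-> H]]; exists [::], x1.
- by move=> [s [x1 [-> H]]]; exists b, s, x1.
- by case: b => //= H; exists x.
- case: k => /=; try by move=> H; exists b, x.
  case: b => /=; last by move=> ->; exists [::].
  move=> [n [x1 [-> [B ->]]]]; exists (n :: B).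
  by rewrite /enc_seq /= -!catA.
Qed.

Lemma parse_sound x : foldl dq W0 x = QE -> exists T B, x = enc_instance T B.
Proof.
have H q : foldl dq q x = QE -> Lang q x.
  elim: x q => [|b x IH] q /=; first by move=> ->.
  by move=> /IH; apply: parse_step.
move=> /H [W [x1 [-> [D [x2 [-> [B ->]]]]]]].
by exists (W, D), B.
Qed.

Lemma zparse_sound z : foldl dz (Mk W0) z = FF ->
  exists T B m, z = pair_enc (enc_instance T B) (nseq m true).
Proof.
have HX s : foldl dz ZX s = ZX by elim: s.
have HF s : foldl dz FF s = FF -> s = nseq (size s) true.
  by elim: s => // -[] s IH /=; rewrite ?HX // => /IH <-.
have H q : foldl dz (Mk q) z = FF -> exists x m, z = pr x ++ [:: false, false & nseq m true] /\ foldl dq q x = QE.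
  move: {2}(size z) (leqnn (size z)) => c; elim: c z q => [|c IH] [|a [|b z]] q //=.
  - by case: a => //=; case: q.
  - case: a => /= Hs.
      move=> /IH [|x [m [-> E]]]; first by lia.
      by exists (b :: x), m; rewrite -E.
    case: q => /=; try by rewrite HX.
    case: b => /=; first by rewrite HX.
    by move=> /HF ->; exists [::], (size z).
move=> /H [x [m [-> /parse_sound [T [B ->]]]]].
by exists T, B, m.
Qed.
End ParseSound.

(** * Tokens emitted along the scan *)

Inductive token := TR | TC of kind | TL of nat & bool | TB of nat | TF.

(** Digits are doubled twice, by [enc_nat] and again by the pairing; the trailing [true] is the
    pairing marker of the bit that follows the number. *)
Definition code (n : nat) : seq bool := rcons (pr (enc_nat n)) true.

Lemma code_inj : injective code.
Proof. by move=> m n /rcons_inj [/pr_inj /enc_nat_inj]. Qed.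

(** A left inverse of [code] obtained by choice; 0 is a placeholder outside the range. *)
Definition dn (a : seq bool) : nat :=
  if pselect (exists n, code n = a) is left H then projT1 (cid H) else 0.

Lemma codeK n : dn (code n) = n.
Proof.
rewrite /dn; case: pselect => [H|[]]; last by exists n.
by apply: code_inj; case: (cid H).
Qed.

(* The second component collects the bits since the last start of a number. *)
Definition zstep (c : zst * seq bool) (b : bool) : zst * seq bool :=
  let s := dz c.1 b in (s, if s is Mk (NN _) then [::] else rcons c.2 b).

(** A number is known only after its code has been read, so the token of a literal sits on its sign
    bit and that of a backdoor element on the separator behind it. *)
Definition tok (c : zst * seq bool) (b : bool) : option token :=
  match c.1 with
  | Rd D0 => if b then Some TR else None
  | Rd (CL k) => if b then Some (TC k) else None
  | Rd (SS KB) => Some (TB (dn c.2))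
  | Rd (SS _) => Some (TL (dn c.2) b)
  | FF => if b then Some TF else None
  | _ => None
  end.

Fixpoint emit (c : zst * seq bool) (u : seq bool) : seq (option token) :=
  if u is b :: u' then tok c b :: emit (zstep c b) u' else [::].

Definition conf (z : seq bool) (p : nat) : zst * seq bool :=
  foldl zstep (Mk W0, [::]) (take p z).

Lemma foldl_zstep1 c u : (foldl zstep c u).1 = foldl dz c.1 u.
Proof. by elim: u c => //= b u IH c; rewrite IH. Qed.

Lemma size_emit c u : size (emit c u) = size u.
Proof. by elim: u c => //= b u IH c; rewrite IH. Qed.

Lemma emit_cat c u v : emit c (u ++ v) = emit c u ++ emit (foldl zstep c u) v.
Proof. by elim: u c => //= b u IH c; rewrite IH. Qed.

Lemma nth_emit z p : p < size z ->
  nth None (emit (Mk W0, [::]) z) p = tok (conf z p) (nth false z p).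
Proof.
rewrite /conf; elim: z p (Mk W0, [::]) => // b z IH [|p] c //= Hp.
exact: IH.
Qed.

Lemma conf0 z : conf z 0 = (Mk W0, [::]).
Proof. by rewrite /conf take0. Qed.

Lemma confS z p : p < size z -> conf z p.+1 = zstep (conf z p) (nth false z p).
Proof. by move=> Hp; rewrite /conf (take_nth false) // foldl_rcons. Qed.

Definition toksC (k : kind) (c : clause) : seq token := TC k :: map (fun l => TL l.1 l.2) c.
Definition toksF (k : kind) (f : cnf) : seq token := flatten (map (toksC k) f).
Definition toksR (r : rule) : seq token :=
  TR :: toksF KP (rpre r) ++ toksF KJ (rjust r) ++ toksF KC (rconcl r).
Definition toks (T : theory) (B : seq nat) : seq token :=
  flatten (map (toksF KW) T.1) ++ flatten (map toksR T.2) ++ map TB B.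

(** Allowing any accumulator on entry and forgetting it on exit makes these runs compose; inside a
    number, where the accumulator matters, [silent] records it exactly. *)
Definition goes (q : qst) (x : seq bool) (q' : qst) (ts : seq token) : Prop :=
  forall a, exists a', foldl zstep (Mk q, a) (pr x) = (Mk q', a') /\
    pmap id (emit (Mk q, a) (pr x)) = ts.

Lemma goes_cat q x q1 ts y q2 ts' :
  goes q x q1 ts -> goes q1 y q2 ts' -> goes q (x ++ y) q2 (ts ++ ts').
Proof.
move=> H1 H2 a; have [a1 [E1 F1]] := H1 a; have [a2 [E2 F2]] := H2 a1.
by exists a2; rewrite pr_cat foldl_cat emit_cat pmap_cat E1 E2 F1 F2.
Qed.

Lemma run_bit q a b x : foldl zstep (Mk q, a) (pr (b :: x)) = foldl zstep (zstep (Rd q, rcons a true) b) (pr x).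
Proof. by []. Qed.

Lemma emit_bit q a b x : pmap id (emit (Mk q, a) (pr (b :: x))) =
  pmap id [:: tok (Rd q, rcons a true) b] ++ pmap id (emit (zstep (Rd q, rcons a true) b) (pr x)).
Proof. by rewrite /=; case: (tok _ b). Qed.

Definition silent (q : qst) (a x : seq bool) (q' : qst) : Prop :=
  foldl zstep (Mk q, a) (pr x) = (Mk q', a ++ pr x) /\ pmap id (emit (Mk q, a) (pr x)) = [::].

Lemma silent_cons q a b x q' q1 : dq q b = q1 -> (forall k, q1 <> NN k) ->
  (forall a, tok (Rd q, a) b = None) ->
  silent q1 (a ++ [:: true; b]) x q' -> silent q a (b :: x) q'.
Proof.
move=> Eq Hq Ht [H1 H2]; rewrite /silent run_bit emit_bit.
have -> : zstep (Rd q, rcons a true) b = (Mk q1, a ++ [:: true; b]).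
  by rewrite /zstep [dz _ _]/= Eq -!cats1 -catA; case: (q1) Hq => // k /(_ k).
rewrite H1 H2 /= Ht; split=> //.
by rewrite -catA.
Qed.

Lemma silent_N1 k s a : silent (N1 k) a (pr s ++ [:: false; false]) (SS k).
Proof.
elim: s a => [|b s IH] a.
  change (silent (N1 k) a [:: false; false] (SS k)).
  apply: (@silent_cons _ _ _ _ _ (NZ k)) => //.
  apply: (@silent_cons _ _ _ _ _ (SS k)) => //.
  by split; rewrite ?cats0.
change (silent (N1 k) a [:: true, b & pr s ++ [:: false; false]] (SS k)).
apply: (@silent_cons _ _ _ _ _ (NB k)) => //.
exact: (@silent_cons _ _ _ _ _ (N1 k)).
Qed.

Lemma num_run k n : foldl zstep (Mk (NN k), [::]) (pr (enc_nat n)) = (Mk (SS k), pr (enc_nat n)) /\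
  pmap id (emit (Mk (NN k), [::]) (pr (enc_nat n))) = [::].
Proof.
change (silent (NN k) [::] (enc_nat n) (SS k)).
rewrite enc_natE /nat_bits; case: (N.of_nat n) => [|p].
  change (silent (NN k) [::] [:: false; false] (SS k)).
  exact: (@silent_cons _ _ _ _ _ (NZ k)).
have [s ->] := pos_bits_head p.
change (silent (NN k) [::] [:: true, true & pr s ++ [:: false; false]] (SS k)).
apply: (@silent_cons _ _ _ _ _ (NF k)) => //.
apply: (@silent_cons _ _ _ _ _ (N1 k)) => //.
exact: silent_N1.
Qed.

Lemma goes_lit k l : k <> KB ->
  goes (LL k) (true :: enc_lit l) (LL k) [:: TL l.1 l.2].
Proof.
move=> Hk a; have [E1 E2] := num_run k l.1.
have Ea : forall a', zstep (zstep (Mk (LL k), a') true) true = (Mk (NN k), [::]).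
  by move=> a'; case: k Hk {E1 E2}.
exists (rcons (rcons (pr (enc_nat l.1)) true) l.2).
have Hd : dn (rcons (pr (enc_nat l.1)) true) = l.1 by apply: codeK.
rewrite /enc_lit; move: (enc_nat l.1) E1 E2 Hd => u E1 E2 Hd.
rewrite -[true :: _]/([:: true] ++ _) !pr_cat !foldl_cat !emit_cat !pmap_cat.
rewrite /= Ea E1 E2 /=; split; first by case: k Hk {E1 E2 Ea}.
by case: k Hk {E1 E2 Ea} => //= _; rewrite Hd.
Qed.

Lemma enc_seq_cons (S : Type) (e : S -> seq bool) a s :
  enc_seq e (a :: s) = true :: e a ++ enc_seq e s.
Proof. by rewrite /enc_seq /= -catA. Qed.

Lemma goes_seq (S : Type) q q' (e : S -> seq bool) (t : S -> seq token) (s : seq S) :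
  (forall a, goes q (true :: e a) q (t a)) -> goes q [:: false] q' [::] ->
  goes q (enc_seq e s) q' (flatten (map t s)).
Proof.
move=> H H0; elim: s => [|a s IH] //.
by rewrite enc_seq_cons -cat_cons; apply: (goes_cat (H a)).
Qed.

Lemma goes1 q b q' ts : dq q b = q' -> (forall a, pmap id [:: tok (Rd q, a) b] = ts) ->
  goes q [:: b] q' ts.
Proof. by move=> E1 E2 a; rewrite /= /zstep /= E1; eexists; split; [|exact: E2]. Qed.

Lemma goes_clause k c : k <> KB -> goes (CL k) (true :: enc_clause c) (CL k) (toksC k c).
Proof.
move=> Hk; rewrite -[true :: _]/([:: true] ++ _) -[toksC k c]/([:: TC k] ++ _).
apply: (@goes_cat _ _ (LL k)); first exact: goes1.
have -> : map (fun l => TL l.1 l.2) c = flatten (map (fun l : lit => [:: TL l.1 l.2]) c).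
  by elim: c => //= l c ->.
apply: goes_seq; first by move=> l; apply: goes_lit.
by apply: goes1 => //; case: k Hk.
Qed.

Lemma goes_cnf k f : k <> KB -> goes (CL k) (enc_cnf f) (after_cnf k) (toksF k f).
Proof.
move=> Hk; apply: goes_seq; first by move=> c; apply: goes_clause.
exact: goes1.
Qed.

Lemma goes_rule r : goes D0 (true :: enc_rule r) D0 (toksR r).
Proof.
rewrite -[true :: _]/([:: true] ++ _) -[toksR r]/([:: TR] ++ _).
apply: (@goes_cat _ _ (CL KP)); first exact: goes1.
apply: (@goes_cat _ _ (CL KJ)); first exact: (goes_cnf (k := KP)).
apply: (@goes_cat _ _ (CL KC)); first exact: (goes_cnf (k := KJ)).
exact: (goes_cnf (k := KC)).
Qed.

Lemma backdoor_run n B : exists a',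
  foldl zstep (Mk (SS KB), pr (enc_nat n)) (pr (enc_seq enc_nat B)) = (Mk QE, a') /\
  pmap id (emit (Mk (SS KB), pr (enc_nat n)) (pr (enc_seq enc_nat B))) = map TB (n :: B).
Proof.
have Hd : dn (rcons (pr (enc_nat n)) true) = n by apply: codeK.
elim: B n Hd => [|n' B IH] n Hd.
  exists (rcons (rcons (pr (enc_nat n)) true) false).
  by move: (enc_nat n) Hd => u Hd; rewrite /= /tok /= Hd.
have [|a' [E1 E2]] := IH n'; first exact: codeK.
have [F1 F2] := num_run KB n'.
exists a'; rewrite enc_seq_cons.
move: (enc_nat n) Hd => u Hd.
rewrite run_bit emit_bit pr_cat foldl_cat emit_cat pmap_cat.
rewrite [zstep (Rd _, _) _](_ : _ = (Mk (NN KB), [::])) // F1 F2 E1 E2.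
by rewrite /tok /= Hd.
Qed.

Lemma goes_backdoor B : goes B0 (enc_seq enc_nat B) QE (map TB B).
Proof.
case: B => [|n B]; first exact: goes1.
move=> a; have [a' [E1 E2]] := backdoor_run n B; have [F1 F2] := num_run KB n.
exists a'; rewrite enc_seq_cons run_bit emit_bit pr_cat foldl_cat emit_cat pmap_cat.
by rewrite [zstep (Rd _, _) _](_ : _ = (Mk (NN KB), [::])) // F1 F2 E1 E2.
Qed.

Lemma goes_instance T B : goes W0 (enc_instance T B) QE (toks T B).
Proof.
apply: (@goes_cat _ _ D0).
  apply: goes_seq; last exact: goes1.
  move=> f; rewrite -[true :: _]/([:: true] ++ _) -[toksF _ _]/([::] ++ _).
  by apply: (@goes_cat _ _ (CL KW)); [exact: goes1|exact: (goes_cnf (k := KW))].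
apply: (@goes_cat _ _ B0); last exact: goes_backdoor.
by apply: goes_seq; [exact: goes_rule|exact: goes1].
Qed.

Lemma zparse_complete T B m (z := pair_enc (enc_instance T B) (nseq m true)) :
  foldl dz (Mk W0) z = FF /\
  pmap id (emit (Mk W0, [::]) z) = toks T B ++ nseq m TF.
Proof.
have [a [E1 E2]] := goes_instance T B [::].
rewrite /z pair_encE -(foldl_zstep1 (Mk W0, [::])) foldl_cat emit_cat pmap_cat E1 E2 /=.
have H a' : (foldl zstep (FF, a') (nseq m true)).1 = FF /\ pmap id (emit (FF, a') (nseq m true)) = nseq m TF.
  by elim: m {z} a' => //= m IH a'; have [-> ->] := IH (rcons a' true).
by rewrite /zstep /= -/zstep; have [-> ->] := H (rcons (rcons a false) false).
Qed.

(** * Decoding token sequences *)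

Notation tokens := (seq (option token)).

(** The [soft] entries can separate a clause start from a literal of the clause, the [inner] ones a
    rule start from a clause of the rule. All others end the clause or the rule, so membership
    becomes a condition on the positions in between. *)
Definition soft (t : option token) : bool :=
  match t with None | Some (TL _ _) => true | _ => false end.
Definition inner (t : option token) : bool :=
  match t with None | Some (TL _ _) | Some (TC _) => true | _ => false end.

Fixpoint tlits (u : tokens) : clause :=
  match u with
  | Some (TL n b) :: u' => (n, b) :: tlits u'
  | None :: u' => tlits u'
  | _ => [::]
  end.

Fixpoint tcnf (k : kind) (u : tokens) : cnf :=
  match u with
  | Some (TC k') :: u' => if kc k' == kc k then tlits u' :: tcnf k u' else tcnf k u'
  | Some (TL _ _) :: u' | None :: u' => tcnf k u'
  | _ => [::]
  end.

Fixpoint trules (u : tokens) : seq rule :=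
  match u with
  | Some TR :: u' => (tcnf KP u', tcnf KJ u', tcnf KC u') :: trules u'
  | _ :: u' => trules u'
  | [::] => [::]
  end.

Definition tbs (u : tokens) : seq nat :=
  pmap (fun t => if t is Some (TB n) then Some n else None) u.

Definition is_TF (t : option token) : bool := if t is Some TF then true else false.

Lemma tlits_pmap u : tlits u = tlits (map Some (pmap id u)).
Proof. by elim: u => // -[[|k|n b|n|]|] u //= ->. Qed.

Lemma tcnf_pmap k u : tcnf k u = tcnf k (map Some (pmap id u)).
Proof.
elim: u => // -[[|k'|n b|n|]|] u //= ->.
by rewrite -tlits_pmap.
Qed.

Lemma trules_pmap u : trules u = trules (map Some (pmap id u)).
Proof. by elim: u => // -[[|k'|n b|n|]|] u //= ->; rewrite -!tcnf_pmap. Qed.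

Lemma tbs_pmap u : tbs u = tbs (map Some (pmap id u)).
Proof. by rewrite /tbs; elim: u => // -[[|k'|n b|n|]|] u //= ->. Qed.

Lemma count_TF_pmap u : count is_TF u = count is_TF (map Some (pmap id u)).
Proof. by elim: u => // -[[|k'|n b|n|]|] u //= ->. Qed.

Definition hard (u : tokens) : bool := if u is t :: _ then ~~ inner t else true.
Definition clean (u : tokens) : bool := if u is t :: _ then ~~ soft t else true.

Lemma tlits_map c u : clean u -> tlits (map Some (map (fun l : lit => TL l.1 l.2) c) ++ u) = c.
Proof. by move=> Hu; elim: c => [|[n b] c IH] /=; [case: u Hu => // -[[]|]|rewrite IH]. Qed.

Lemma clean_toksF k f u : clean u -> clean (map Some (toksF k f) ++ u).
Proof. by case: f. Qed.

Lemma tcnf_map k c u : tcnf k (map Some (map (fun l : lit => TL l.1 l.2) c) ++ u) = tcnf k u.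
Proof. by elim: c => [|[n b] c IH]. Qed.

Lemma tcnf_toksF k k' f u : clean u ->
  tcnf k (map Some (toksF k' f) ++ u) = (if kc k' == kc k then f else [::]) ++ tcnf k u.
Proof.
move=> Hu; elim: f => [|c f IH]; first by case: ifP.
rewrite /toksF /= -/(toksF _ _) map_cat -catA /=.
rewrite tcnf_map IH tlits_map; last exact: clean_toksF.
by case: (_ == _).
Qed.

Lemma hard_tcnf k u : hard u -> tcnf k u = [::].
Proof. by case: u => // -[[]|]. Qed.

Lemma hard_clean u : hard u -> clean u.
Proof. by case: u => // -[[]|]. Qed.

Lemma trules_toksF k f u : trules (map Some (toksF k f) ++ u) = trules u.
Proof.
elim: f => // c f IH; rewrite /toksF /= -/(toksF _ _) map_cat -catA /=.
by elim: c => [|l c IHc] //=.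
Qed.

Lemma hard_rules D u : hard u -> hard (map Some (flatten (map toksR D)) ++ u).
Proof. by case: D. Qed.

Lemma trules_toksR D u : hard u -> trules u = [::] ->
  trules (map Some (flatten (map toksR D)) ++ u) = D.
Proof.
move=> Hu Eu; elim: D => [|[[p j] c] D IH] /=; first by rewrite Eu.
set v := map Some (flatten _) ++ u in IH *.
have Hv : hard v by apply: hard_rules.
have Cv := hard_clean Hv.
rewrite /rpre /rjust /rconcl /= !map_cat -!catA -/v.
rewrite !tcnf_toksF ?clean_toksF // (hard_tcnf _ Hv) /= ?cats0.
by rewrite !(hard_tcnf _ Hv) !cats0 !trules_toksF IH.
Qed.

Lemma tcnf_W W u : hard u ->
  tcnf KW (map Some (flatten (map (toksF KW) W)) ++ u) = flatten W.
Proof.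
move=> Hu; elim: W => [|f W IH] /=; first exact: hard_tcnf.
rewrite map_cat -catA tcnf_toksF ?IH //.
by elim: (W) => [|g V IHV] /=; [exact: hard_clean|rewrite map_cat -catA clean_toksF].
Qed.

Lemma trules_W W u : trules (map Some (flatten (map (toksF KW) W)) ++ u) = trules u.
Proof. by elim: W => //= f W IH; rewrite map_cat -catA trules_toksF. Qed.

Lemma hard_tail B m : hard (map Some (map TB B) ++ nseq m (Some TF)).
Proof. by case: B => //; case: m. Qed.

(** The knowledge base is recovered up to flattening: the boundaries between its formulas emit no
    token, and satisfaction, variables and the Horn condition depend only on its clauses. *)
Lemma decode T B m u : pmap id u = toks T B ++ nseq m TF ->
  [/\ tcnf KW u = flatten T.1, trules u = T.2, tbs u = B & count is_TF u = m].
Proof.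
move=> E; rewrite tcnf_pmap trules_pmap tbs_pmap count_TF_pmap E /toks !map_cat -!catA map_nseq.
have Ht := hard_tail B m.
have Hr : trules (map Some (map TB B) ++ nseq m (Some TF)) = [::].
  by elim: B {E Ht} => //=; elim: m.
have HL k c : tbs (map Some (toksC k c)) = [::] /\ count is_TF (map Some (toksC k c)) = 0.
  by split; elim: c => [|l c IH].
have HF k f : tbs (map Some (toksF k f)) = [::] /\ count is_TF (map Some (toksF k f)) = 0.
  elim: f => // c f [IH1 IH2]; have [H1 H2] := HL k c.
  by rewrite (_ : toksF k (c :: f) = toksC k c ++ toksF k f) // map_cat count_cat /tbs pmap_cat -!/(tbs _) H1 H2 IH1 IH2.
split.
- by rewrite tcnf_W // hard_rules.
- by rewrite trules_W trules_toksR.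
- rewrite /tbs !pmap_cat -!/(tbs _).
  have -> : tbs (map Some (flatten (map (toksF KW) T.1))) = [::].
    elim: (T.1) => //= f W IH; rewrite map_cat /tbs pmap_cat -!/(tbs _) IH.
    by have [-> _] := HF KW f.
  have -> : tbs (map Some (flatten (map toksR T.2))) = [::].
    elim: (T.2) => //= r D IH; rewrite map_cat /tbs /= pmap_cat -!/(tbs _) IH !map_cat /tbs !pmap_cat -!/(tbs _).
    by have [-> _] := HF KP (rpre r); have [-> _] := HF KJ (rjust r); have [-> _] := HF KC (rconcl r).
  rewrite /= (_ : tbs (nseq m _) = [::]) ?cats0; last by elim: (m).
  by elim: (B) => //= n B' ->.
- rewrite !count_cat.
  have -> : count is_TF (map Some (flatten (map (toksF KW) T.1))) = 0.
    elim: (T.1) => //= f W IH; rewrite map_cat count_cat IH.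
    by have [_ ->] := HF KW f.
  have -> : count is_TF (map Some (flatten (map toksR T.2))) = 0.
    elim: (T.2) => //= r D IH; rewrite map_cat count_cat IH !map_cat !count_cat.
    by have [_ ->] := HF KP (rpre r); have [_ ->] := HF KJ (rjust r); have [_ ->] := HF KC (rconcl r).
  rewrite count_nseq mul1n (_ : count _ _ = 0) //.
  by elim: (B).
Qed.

(** * Clauses, rules and backdoor as conditions on positions *)

Section Positions.
Variable u : tokens.
Let N := size u.
Definition at_ (p : nat) : option token := nth None u p.

Definition inC (c l : nat) : Prop := c < l /\ forall q, c < q -> q < l -> soft (at_ q).
Definition inR (r c : nat) : Prop := r < c /\ forall q, r < q -> q < c -> inner (at_ q).

Definition clause_at (c : nat) : clause := tlits (drop c.+1 u).
Definition cnf_at (k : kind) (r : nat) : cnf := tcnf k (drop r.+1 u).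
Definition rule_at (r : nat) : rule := (cnf_at KP r, cnf_at KJ r, cnf_at KC r).
End Positions.

Lemma tlitsP u n b : (n, b) \in tlits u <->
  exists2 l, nth None u l = Some (TL n b) & forall q, q < l -> soft (nth None u q).
Proof.
elim: u => [|t u IH]; first by split=> // -[l]; rewrite nth_nil.
have shift : soft t -> (exists2 l, nth None u l = Some (TL n b) & forall q, q < l -> soft (nth None u q)) ->
   exists2 l, nth None (t :: u) l = Some (TL n b) & forall q, q < l -> soft (nth None (t :: u) q).
  by move=> Ht [l H1 H2]; exists l.+1 => // -[|q] //= Hq; apply: H2.
have unshift l : nth None (t :: u) l.+1 = Some (TL n b) -> (forall q, q < l.+1 -> soft (nth None (t :: u) q)) ->
  exists2 l, nth None u l = Some (TL n b) & forall q, q < l -> soft (nth None u q).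
  by move=> H1 H2; exists l => // q Hq; apply: (H2 q.+1).
case: t shift unshift => [[|k|n' b'|n'|]|] shift unshift /=.
- by split=> // -[[|l]] //= _ /(_ 0 isT).
- by split=> // -[[|l]] //= _ /(_ 0 isT).
- rewrite inE; split.
    by move=> /orP [/eqP [-> ->]|/IH /shift]; [exists 0|apply].
  case=> -[|l]; first by move=> [-> ->]; rewrite eqxx.
  by move=> H1 H2; apply/orP; right; apply/IH; apply: unshift H1 H2.
- by split=> // -[[|l]] //= _ /(_ 0 isT).
- by split=> // -[[|l]] //= _ /(_ 0 isT).
- split; first by move/IH/shift; apply.
  by case=> -[|l] // H1 H2; apply/IH; apply: unshift H1 H2.
Qed.

Lemma tcnfP k u C : C \in tcnf k u <->
  exists c, [/\ nth None u c = Some (TC k), C = tlits (drop c.+1 u) & forall q, q < c -> inner (nth None u q)].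
Proof.
have kcI k1 k2 : kc k1 = kc k2 -> k1 = k2 by case: k1; case: k2.
elim: u => [|t u IH]; first by split=> // -[c []]; rewrite nth_nil.
have shift : inner t -> C \in tcnf k u ->
  exists c, [/\ nth None (t :: u) c = Some (TC k), C = tlits (drop c.+1 (t :: u)) & forall q, q < c -> inner (nth None (t :: u) q)].
  by move=> Ht /IH [c [H1 H2 H3]]; exists c.+1; split=> // -[|q] //= Hq; apply: H3.
have unshift c : nth None (t :: u) c.+1 = Some (TC k) -> C = tlits (drop c.+2 (t :: u)) ->
  (forall q, q < c.+1 -> inner (nth None (t :: u) q)) -> C \in tcnf k u.
  by move=> H1 H2 H3; apply/IH; exists c; split=> // q Hq; apply: (H3 q.+1).
case: t shift unshift => [[|k'|n' b'|n'|]|] shift unshift /=.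
- by split=> // -[[|l] []] //= _ _ /(_ 0 isT).
- case: eqP => [/kcI Ek|Hk].
    rewrite inE; split.
      move=> /orP [/eqP ->|/shift]; last by apply.
      by exists 0; rewrite Ek /= drop0.
    move=> [[|c] [H1 H2 H3]]; first by rewrite H2 /= drop0 eqxx.
    by rewrite (unshift c) ?orbT.
  split; first by move/shift; apply.
  by move=> [[|c] [H1 H2 H3]]; [case: H1 => E; rewrite E in Hk|exact: unshift H1 H2 H3].
- split; first by move/shift; apply.
  by move=> [[|c] [H1 H2 H3]] //; exact: unshift H1 H2 H3.
- by split=> // -[[|l] []] //= _ _ /(_ 0 isT).
- by split=> // -[[|l] []] //= _ _ /(_ 0 isT).
- split; first by move/shift; apply.
  by move=> [[|c] [H1 H2 H3]] //; exact: unshift H1 H2 H3.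
Qed.

Lemma clause_atP u c n b : (n, b) \in clause_at u c <->
  exists2 l, inC u c l & at_ u l = Some (TL n b).
Proof.
rewrite /clause_at tlitsP; split.
  move=> [l H1 H2]; exists (c.+1 + l); last by rewrite /at_ -nth_drop.
  split; first by lia.
  move=> q Hq1 Hq2; have := H2 (q - c.+1); rewrite nth_drop subnKC // /at_; apply; lia.
move=> [l [H1 H2] H3]; exists (l - c.+1); first by rewrite nth_drop subnKC.
by move=> q Hq; rewrite nth_drop; apply: H2; lia.
Qed.

Lemma cnf_atP u k r C : C \in cnf_at u k r <->
  exists c, [/\ inR u r c, at_ u c = Some (TC k) & C = clause_at u c].
Proof.
rewrite /cnf_at tcnfP; split.
  move=> [c [H1 H2 H3]]; exists (r.+1 + c); split.
  - split; first by lia.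
    by move=> q Hq1 Hq2; have := H3 (q - r.+1); rewrite nth_drop subnKC // /at_; apply; lia.
  - by rewrite /at_ -nth_drop.
  - by rewrite H2 drop_drop; congr (tlits (drop _ _)); lia.
move=> [c [[H1 H2] H3 H4]]; exists (c - r.+1); split.
- by rewrite nth_drop subnKC.
- by rewrite H4 /clause_at drop_drop; congr (tlits (drop _ _)); lia.
- by move=> q Hq; rewrite nth_drop; apply: H2; lia.
Qed.

Lemma trulesP u r : r \in trules u <-> exists2 p, at_ u p = Some TR & r = rule_at u p.
Proof.
rewrite /at_ /rule_at /cnf_at; elim: u => [|t u IH]; first by split=> // -[p]; rewrite nth_nil.
have H : r \in trules u -> exists2 p, nth None (t :: u) p = Some TR &
   r = (tcnf KP (drop p.+1 (t :: u)), tcnf KJ (drop p.+1 (t :: u)), tcnf KC (drop p.+1 (t :: u))).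
  by move=> /IH [p H1 H2]; exists p.+1.
have H' p : nth None (t :: u) p.+1 = Some TR ->
   r = (tcnf KP (drop p.+2 (t :: u)), tcnf KJ (drop p.+2 (t :: u)), tcnf KC (drop p.+2 (t :: u))) -> r \in trules u.
  by move=> H1 H2; apply/IH; exists p.
case: t H H' => [[|k'|n' b'|n'|]|] H H';
  try by split; [exact: H|move=> [[|p] // H1 H2]; apply: H' H1 H2].
rewrite /= inE; split.
  by move=> /orP [/eqP ->|/H //]; exists 0; rewrite /= ?drop0.
by move=> [[|p] H1 H2]; [rewrite H2 /= drop0 eqxx|rewrite (H' p) ?orbT].
Qed.

Lemma tbsP u n : n \in tbs u <-> exists p, at_ u p = Some (TB n).
Proof.
rewrite /at_ /tbs; elim: u => [|t u IH] /=; first by split=> // -[p]; rewrite nth_nil.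
have H : n \in tbs u -> exists p, nth None (t :: u) p = Some (TB n).
  by move=> /IH [p Hp]; exists p.+1.
have H' p : nth None (t :: u) p.+1 = Some (TB n) -> n \in tbs u.
  by move=> Hp; apply/IH; exists p.
case: t H H' => [[|k'|n' b'|n'|]|] H H' /=;
  try by split; [exact: H|move=> [[|p] // Hp]; apply: H' Hp].
rewrite inE; split; first by move=> /orP [/eqP ->|/H //]; exists 0.
by move=> [[[->]|p /H' E]]; [rewrite eqxx|rewrite -/(tbs u) E orbT].
Qed.

Lemma uniq_tbs u : uniq (tbs u) <->
  forall p q n, at_ u p = Some (TB n) -> at_ u q = Some (TB n) -> p = q.
Proof.
rewrite /at_; elim: u => [|t u IH] /=; first by split=> // _ p q n; rewrite nth_nil.
have step : (forall p q n, nth None (t :: u) p = Some (TB n) -> nth None (t :: u) q = Some (TB n) -> p = q) -> uniq (tbs u).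
  by move=> H; apply/IH => p q n Hp Hq; have [] := H p.+1 q.+1 n Hp Hq.
have HN : (forall n, t <> Some (TB n)) -> uniq (tbs u) <->
    forall p q n, nth None (t :: u) p = Some (TB n) -> nth None (t :: u) q = Some (TB n) -> p = q.
  move=> Ht; split=> // /IH H [|p] [|q] n //= Hp Hq; try by case: (Ht n).
  by congr S; apply: H Hp Hq.
case: t step HN => [[|k'|n' b'|n'|]|] step HN; rewrite /tbs /=; try exact: HN.
rewrite -/(tbs u); split.
  move=> /andP [Hn /IH H] [|p] [|q] n //=.
  - by move=> [<-] Hq; case/negP: Hn; apply/tbsP; exists q.
  - by move=> Hp [En]; case/negP: Hn; apply/tbsP; exists p; rewrite En.
  - by move=> Hp Hq; congr S; apply: H Hp Hq.
move=> H; rewrite (step H) andbT; apply/negP => /tbsP [p Hp].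
by have := H 0 p.+1 n' erefl Hp.
Qed.

(** Since [count] respects multiplicity, the right-hand side compares positions: two occurrences of
    one literal satisfying [P] already violate it. *)
Lemma count_tlits (P : lit -> bool) u : count P (tlits u) <= 1 <->
  forall l l' n b n' b', l < l' -> nth None u l = Some (TL n b) -> nth None u l' = Some (TL n' b') ->
    (forall q, q < l' -> soft (nth None u q)) -> P (n, b) -> P (n', b') -> False.
Proof.
elim: u => [|t u IH]; first by split=> // _ l l' n b n' b' _; rewrite nth_nil.
have step : soft t -> (forall l l' n b n' b', l < l' -> nth None (t :: u) l = Some (TL n b) -> nth None (t :: u) l' = Some (TL n' b') ->
    (forall q, q < l' -> soft (nth None (t :: u) q)) -> P (n, b) -> P (n', b') -> False) -> count P (tlits u) <= 1.
  move=> Ht H; apply/IH => l l' n b n' b' Hl H1 H2 H3.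
  by apply: (H l.+1 l'.+1 n b n' b') => // -[|q] //= Hq; apply: H3.
have hard_case : ~~ soft t -> forall l l' n b n' b', l < l' -> nth None (t :: u) l = Some (TL n b) -> nth None (t :: u) l' = Some (TL n' b') ->
    (forall q, q < l' -> soft (nth None (t :: u) q)) -> P (n, b) -> P (n', b') -> False.
  by move=> Ht l [|l'] n b n' b' // Hl _ _ /(_ 0 isT) /=; rewrite (negbTE Ht).
case: t step hard_case => [[|k|m e|m|]|] step hard_case /=; try by split=> // _; apply: hard_case.
- split=> [H|H].
    move=> [|l] [|l'] n b n' b' // Hl /=.
      move=> [<- <-] H2 H3 Pm Pn'; move: H; rewrite Pm.
      have : 0 < count P (tlits u).
        rewrite -has_count; apply/hasP; exists (n', b') => //; apply/tlitsP; exists l' => // q Hq.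
        exact: (H3 q.+1).
      by case: (count _ _).
    move=> H1 H2 H3; apply: (IH.1 _ l l' n b n' b') => //; first by lia.
    by move=> q Hq; apply: (H3 q.+1).
  case Pm: (P (m, e)); last exact: step.
  rewrite leqNgt; apply/negP => Hc.
  have : has P (tlits u) by rewrite has_count; lia.
  case/hasP=> -[n b] /tlitsP [l H1 H2] Pn.
  by apply: (H 0 l.+1 m e n b) => // -[|q] //= Hq; apply: H2.
- split=> [H|]; last exact: step.
  move=> [|l] [|l'] n b n' b' // Hl /= H1 H2 H3.
  apply: (IH.1 H l l' n b n' b') => // q Hq.
  exact: (H3 q.+1).
Qed.

Lemma count_clause_at (P : lit -> bool) u c : count P (clause_at u c) <= 1 <->
  forall l l' n b n' b', l < l' -> inC u c l -> inC u c l' ->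
    at_ u l = Some (TL n b) -> at_ u l' = Some (TL n' b') -> P (n, b) -> P (n', b') -> False.
Proof.
rewrite /clause_at count_tlits; split=> H l l' n b n' b' Hl.
  move=> [H1 _] [H2 H3] H4 H5.
  apply: (H (l - c.+1) (l' - c.+1) n b n' b'); rewrite ?nth_drop ?subnKC //; first by lia.
  by move=> q Hq; rewrite nth_drop; apply: H3; lia.
rewrite !nth_drop => H1 H2 H3.
have Hs q : c < q -> q < c.+1 + l' -> soft (at_ u q).
  by move=> Hq1 Hq2; have := H3 (q - c.+1); rewrite nth_drop subnKC // /at_; apply; lia.
apply: (H (c.+1 + l) (c.+1 + l') n b n' b') => //; first by lia.
  by split; [lia|move=> q Hq1 Hq2; apply: Hs; lia].
by split; [lia|].
Qed.

Lemma tcnf_atW u C : C \in tcnf KW u <->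
  exists2 c, at_ u c = Some (TC KW) /\ (forall q, q < c -> inner (at_ u q)) & C = clause_at u c.
Proof.
by rewrite tcnfP; split=> [[c [H1 H2 H3]]|[c [H1 H2] H3]]; exists c.
Qed.

(** * The formula *)

Declare Scope fo_scope.
Delimit Scope fo_scope with F.
Bind Scope fo_scope with fo.
Notation "'ALL' x , f" := (QAll (fun x => f%F)) (at level 200, x name, f at level 200) : fo_scope.
Notation "'EX' x , f" := (QEx (fun x => f%F)) (at level 200, x name, f at level 200) : fo_scope.
Notation "f && g" := (QAnd f%F g%F) : fo_scope.
Notation "f || g" := (QOr f%F g%F) : fo_scope.
Notation "f ==> g" := (QImp f%F g%F) : fo_scope.
Notation "f <==> g" := (QAnd (QImp f%F g%F) (QImp g%F f%F)) (at level 56, no associativity) : fo_scope.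
Notation "p '<!' q" := (QLt p q) (at level 35) : fo_scope.

Section Formula.
Variable V : Type.
Local Notation fo := (fo V).
Implicit Types p q a b c l r v x : V.
Local Open Scope fo_scope.

Definition fTrue x : fo := QNot (x <! x).
Definition fAnds (x : V) (fs : seq fo) : fo := foldr (@QAnd V) (fTrue x) fs.
Definition fOrs (x : V) (fs : seq fo) : fo := foldr (@QOr V) (x <! x) fs.

(** The guessed relations. Symbol 93 compares numbers; [fVal a b] is the value of backdoor element
    [b] under the assignment named [a]; [fFired] marks the generating defaults and [fOrd] orders
    their derivation; [fStage q a s v] says that query [q] under [a] has derived the variable at [v]
    by stage [s]; [fMod q l] makes the variable at [l] true in the model for query [q]. *)
Definition fState (s : zst) (p : V) : fo := QRel (zc s) p p p p.
Definition fSame p q : fo := QRel 93 p q q q.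
Definition fVal a b : fo := QRel 94 a b b b.
Definition fFired r : fo := QRel 95 r r r r.
Definition fOrd r r' : fo := QRel 96 r r' r' r'.
Definition fStage q a s v : fo := QRel 97 q a s v.
Definition fMod q l : fo := QRel 98 q l l l.

Definition fEq p q : fo := QNot (p <! q) && QNot (q <! p).
Definition fSucc p q : fo := p <! q && QNot (EX x, p <! x && x <! q).

Definition num_states : seq zst :=
  flatten (map (fun k => map Mk [:: NN k; NF k; N1 k; NB k; NZ k; SS k]
    ++ map Rd [:: NN k; NF k; N1 k; NB k; NZ k; SS k]) kinds).
Definition fNum p : fo := fOrs p (map (fState^~ p) num_states).
Definition fStart p : fo := fOrs p (map (fun k => fState (Mk (NN k)) p) kinds).

Definition axFirst : fo := ALL p, QNot (EX q, q <! p) ==> fState (Mk W0) p.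
Definition axStep : fo := ALL p, ALL q, fSucc p q ==>
  fAnds p (map (fun s => fState s p ==>
    ((QBit p ==> fState (dz s true) q) && (QNot (QBit p) ==> fState (dz s false) q))) zsts).
Definition axOnly : fo := ALL p,
  fAnds p (map (fun s => fAnds p (map (fun s' =>
    if zc s == zc s' then fTrue p else QNot (fState s p && fState s' p)) zsts)) zsts).
Definition axLast : fo := ALL p, QNot (EX q, p <! q) ==>
  ((fState FF p && QBit p) || (fState F0 p && QNot (QBit p))).
(** Number equality is unwound backwards: two prefixes of codes agree if both are empty, or if their
    last bits and the prefixes before these agree. Positions decrease, so the axiom determines the
    relation inside numbers. *)
Definition axSame : fo := ALL p, ALL q, fNum p ==> fNum q ==>
  (fSame p q <==> ((fStart p && fStart q) ||
     (QNot (fStart p) && QNot (fStart q) &&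
      (EX p', EX q', fSucc p' p && fSucc q' q && (QBit p' <==> QBit q') && fSame p' q')))).

Definition fR p : fo := fState (Rd D0) p && QBit p.
Definition fC (k : kind) p : fo := fState (Rd (CL k)) p && QBit p.
Definition fL p : fo := fOrs p (map (fun k => fState (Rd (SS k)) p) [:: KW; KP; KJ; KC]).
Definition fB p : fo := fState (Rd (SS KB)) p.
Definition fF p : fo := fState FF p && QBit p.
Definition fInner p : fo := QNot (fR p || fB p || fF p).
Definition fSoft p : fo := QNot (fOrs p (map (fC^~ p) kinds)) && fInner p.

Definition fInC c l : fo := fL l && c <! l && (ALL q, (c <! q && q <! l) ==> fSoft q).
Definition fInR r c : fo := fR r && r <! c && (ALL q, (r <! q && q <! c) ==> fInner q).
Definition fClW c : fo := fC KW c && (ALL q, q <! c ==> fInner q).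
Definition fClR (k : kind) r c : fo := fInR r c && fC k c.
Definition fCl c : fo := fClW c || (EX r, fClR KP r c || fClR KJ r c || fClR KC r c).

Definition fInB l : fo := EX b, fB b && fSame l b.
Definition fFalseB a l : fo := EX b, fB b && fSame l b && QNot (fVal a b <==> QBit l).
Definition fTrueB a l : fo := EX b, fB b && fSame l b && (fVal a b <==> QBit l).

Definition fAx c : fo := fClW c || (EX r, fClR KC r c && fFired r).
Definition fAxBefore r' c : fo := fClW c || (EX r, fClR KC r c && fFired r && fOrd r r').

(* Unit propagation for query q under the assignment a of the backdoor: [prem]   *)
(* are the clauses of the query and [extra] the literals assumed to be false.    *)
Definition fFire (prem extra : V -> fo) q a s v : fo :=
  (EX c, prem c && (ALL l, fInC c l ==>
     (fFalseB a l || (QNot (QBit l) && fStage q a s l) || (QBit l && fSame l v))))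
  || (EX l, extra l && QNot (QBit l) && fSame l v).
Definition fConflict (prem extra : V -> fo) q a s : fo :=
  (EX c, prem c && (ALL l, fInC c l ==> (fFalseB a l || (QNot (QBit l) && fStage q a s l))))
  || (EX l, extra l && (fTrueB a l || (QBit l && fStage q a s l))).
(** Besides a conflict, only soundness of the stages is demanded: a derived variable must be fired
    from a strictly earlier stage. Stages are named by positions, so the descent is well-founded. *)
Definition fRefute (prem extra : V -> fo) q : fo := ALL a, fF a ==>
  ((EX s, fConflict prem extra q a s) &&
   (ALL s, ALL v, fL v ==> fStage q a s v ==> (EX s', s' <! s && fFire prem extra q a s' v))).

Definition fHolds q c : fo := EX l, fInC c l && (fMod q l <==> QBit l).

Definition axUniq : fo := ALL b, ALL b', fB b ==> fB b' ==> fSame b b' ==> fEq b b'.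
Definition axTaut : fo := ALL c, ALL l, ALL l', fCl c ==> fInC c l ==> fInC c l' ==>
  fSame l l' ==> QBit l ==> QBit l'.
Definition axVars : fo := ALL b, fB b ==> (EX c, EX l, fCl c && fInC c l && fSame b l).
Definition axHorn : fo := ALL c, ALL l, ALL l', fCl c ==> fInC c l ==> fInC c l' ==>
  QBit l ==> QBit l' ==> QNot (fInB l) ==> QNot (fInB l') ==> QNot (l <! l').
Definition axSome : fo := EX a, fF a.
Definition axFlip : fo := ALL a, ALL b, fF a ==> fB b ==> (EX a', fF a' &&
  ALL b', fB b' ==> (fVal a' b' <==> ((fEq b b' && QNot (fVal a b')) || (QNot (fEq b b') && fVal a b')))).
Definition axDiff : fo := ALL a, ALL a', fF a ==> fF a' ==> QNot (fEq a a') ==>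
  EX b, fB b && QNot (fVal a b <==> fVal a' b).
Definition axIrr : fo := ALL r, QNot (fOrd r r).
Definition axTrans : fo := ALL x, ALL y, ALL w, fOrd x y ==> fOrd y w ==> fOrd x w.
(** Prerequisites are entailed clause by clause. The query is named by the clause [c], whose
    literals are assumed false against the axioms of smaller order. *)
Definition axFired : fo := ALL r, ALL c, fFired r ==> fClR KP r c ==>
  fRefute (fAxBefore r) (fInC c) c.
Definition axMod : fo := ALL q, ALL l, ALL l', fL l ==> fL l' ==> fSame l l' ==> fMod q l ==> fMod q l'.
Definition axCons : fo := EX q, ALL c, fAx c ==> fHolds q c.
Definition axJust : fo := ALL r, ALL c, fR r ==> fFired r ==> (fAx c || fClR KJ r c) ==> fHolds r c.
(** A model refutes the prerequisite, or propagation refutes the justification; in the latter case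
    [l <! l] stands for the empty set of assumed literals. These queries are named by rule starts
    and cannot collide with those of [axFired], named by clause starts. *)
Definition axBlocked : fo := ALL r, fR r ==> QNot (fFired r) ==>
  (((ALL c, fAx c ==> fHolds r c) &&
    EX c, fClR KP r c && (ALL l, fInC c l ==> QNot (fMod r l <==> QBit l)))
   || fRefute (fun c => fAx c || fClR KJ r c) (fun l => l <! l) r).

Definition scan_axioms : fo := axFirst && axStep && axOnly && axLast && axSame.
Definition theory_axioms : fo := axUniq && axTaut && axVars && axHorn && axSome && axFlip && axDiff
  && axIrr && axTrans && axFired && axMod && axCons && axJust && axBlocked.
Definition sbd_formula : fo := scan_axioms && theory_axioms.
End Formula.

Lemma eqv_ands r k G x y (S : Type) (h h' : S -> fo nat) (ss : seq S) : (x, y) \in G ->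
  (forall s, eqv r k G (h s) (h' s)) -> eqv r k G (fAnds x (map h ss)) (fAnds y (map h' ss)).
Proof. by move=> HG H; elim: ss => [|s ss IH] /=; constructor=> //; constructor. Qed.

Lemma eqv_ors r k G x y (S : Type) (h h' : S -> fo nat) (ss : seq S) : (x, y) \in G ->
  (forall s, eqv r k G (h s) (h' s)) -> eqv r k G (fOrs x (map h ss)) (fOrs y (map h' ss)).
Proof. by move=> HG H; elim: ss => [|s ss IH] /=; constructor. Qed.

Lemma zc_lt99 s : zc s < 99.
Proof. exact: leq_trans (zc_lt s) _. Qed.

(** There are 99 relation symbols, and 20 is a generous bound on quantifier nesting. [fAnds] and
    [fOrs] stay folded so that conjunctions over all automaton states are treated uniformly. *)
Lemma eqv_sbd : eqv 99 20 [::] (sbd_formula nat) (sbd_formula nat).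
Proof.
cbv beta delta [sbd_formula scan_axioms theory_axioms axFirst axStep axOnly axLast axSame
  axUniq axTaut axVars axHorn axSome axFlip axDiff axIrr axTrans axFired axMod axCons axJust
  axBlocked fRefute fConflict fFire fHolds fAx fAxBefore fFalseB fTrueB fInB fCl fClR fClW
  fInR fInC fSoft fInner fF fB fL fC fR fStart fNum fSucc fEq fMod fStage fOrd fFired fVal
  fSame fState fTrue].
repeat lazymatch goal with
  | |- eqv _ _ _ (fAnds _ _) _ => apply: eqv_ands => [|?]
  | |- eqv _ _ _ (fOrs _ _) _ => apply: eqv_ors => [|?]
  | |- eqv _ _ _ (QAnd _ _) _ => apply: eqAnd
  | |- eqv _ _ _ (QOr _ _) _ => apply: eqOr
  | |- eqv _ _ _ (QImp _ _) _ => apply: eqImp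
  | |- eqv _ _ _ (QNot _) _ => apply: eqNot
  | |- eqv _ _ _ (QAll _) _ => apply: eqAll => ? ?
  | |- eqv _ _ _ (QEx _) _ => apply: eqEx => ? ?
  | |- eqv _ _ _ (QBit _) _ => apply: eqBit
  | |- eqv _ _ _ (QLt _ _) _ => apply: eqLt
  | |- eqv _ _ _ (QRel _ _ _ _ _) _ => apply: eqRel
  | |- eqv _ _ _ (if _ then _ else _) _ => case: ifP => _
  | |- is_true (_ \in _) => by rewrite !inE ?eqxx ?orbT
  | |- is_true (_ < _) => first [exact: zc_lt99 | by []]
  end.
Qed.

Lemma sat_ands z R x (S : Type) (h : S -> fo nat) (ss : seq S) :
  sat z R (fAnds x (map h ss)) <-> forall s, List.In s ss -> sat z R (h s).
Proof.
elim: ss => [|s ss IH] /=; first by split=> // _; rewrite ltnn.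
rewrite IH; split; first by move=> [H1 H2] s' [<-|]; [|exact: H2].
by move=> H; split=> [|s' Hs']; apply: H; [left|right].
Qed.

Lemma sat_ors z R x (S : Type) (h : S -> fo nat) (ss : seq S) :
  sat z R (fOrs x (map h ss)) <-> exists2 s, List.In s ss & sat z R (h s).
Proof.
elim: ss => [|s ss IH] /=; first by rewrite ltnn; split=> // -[].
rewrite IH; split; first by move=> [H|[s' H1 H2]]; [exists s => //; left|exists s' => //; right].
by move=> [s' [<-|H1] H2]; [left|right; exists s'].
Qed.

Lemma In_zsts s : List.In s zsts.
Proof.
have H (q : qst) : List.In q qsts by case: q; try case; cbv; tauto.
have In_map (A B : Type) (f : A -> B) l x : List.In x l -> List.In (f x) (map f l).
  by elim: l => //= y l IH [->|/IH]; [left|right].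
have In_cat (A : Type) (l1 l2 : seq A) x : List.In x l1 \/ List.In x l2 -> List.In x (l1 ++ l2).
  by elim: l1 => [|y l1 IH] /= [] //; [case=> [->|Hx]; [left|right; apply: IH; left]|move=> Hx; right; apply: IH; right].
rewrite /zsts; case: s => [q|q|||].
- by apply: (In_cat); left; apply: In_map.
- by apply: (In_cat); right; apply: In_cat; left; apply: In_map.
- by apply: (In_cat); right; apply: In_cat; right; cbv; tauto.
- by apply: (In_cat); right; apply: In_cat; right; cbv; tauto.
- by apply: (In_cat); right; apply: In_cat; right; cbv; tauto.
Qed.

(** * Meaning of the scan axioms *)

Definition num_q (q : qst) : bool :=
  match q with NN _ | NF _ | N1 _ | NB _ | NZ _ | SS _ => true | _ => false end.
Definition is_num (s : zst) : bool := match s with Mk q | Rd q => num_q q | _ => false end.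
Lemma In_num s : is_num s -> List.In s num_states.
Proof. by case: s => [q|q|||] //; case: q => // k; case: k => _; cbv; intuition. Qed.

Definition is_start (s : zst) : bool := if s is Mk (NN _) then true else false.

Definition scanned (z : seq bool) (R : rels) : Prop :=
  [/\ forall p s, p < size z -> R (zc s) p p p p <-> (conf z p).1 = s,
    forall p q, p < size z -> q < size z -> is_num (conf z p).1 -> is_num (conf z q).1 ->
      R 93 p q q q <-> (conf z p).2 = (conf z q).2 & foldl dz (Mk W0) z = FF].

Section States.
Variables (z : seq bool) (R : rels).
Hypothesis HS : forall p s, p < size z -> R (zc s) p p p p <-> (conf z p).1 = s.

Lemma sat_state s p : p < size z -> sat z R (fState s p) <-> (conf z p).1 = s.
Proof. exact: HS. Qed.

Lemma sat_num p : p < size z -> sat z R (fNum p) <-> is_num (conf z p).1.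
Proof.
move=> Hp; rewrite /fNum sat_ors; split.
  move=> [s Hs] /sat_state -> //.
  have : all is_num num_states by [].
  by elim: num_states Hs => //= s' ss IH [<-|/IH H] /andP [].
by move=> H; exists (conf z p).1; [exact: In_num|exact/sat_state].
Qed.

Lemma sat_start p : p < size z -> sat z R (fStart p) <-> is_start (conf z p).1.
Proof.
move=> Hp; rewrite /fStart sat_ors; split.
  by move=> [k _] /sat_state ->.
case E: (conf z p).1 => [q|q|||] //; case: q E => // k E _.
by exists k; [case: (k); cbv; intuition|apply/sat_state].
Qed.
End States.

Lemma sat_succ z R p q : q < size z -> sat z R (fSucc p q) <-> q = p.+1.
Proof.
move=> Hq; rewrite /=; split.
  move=> [H1 H2]; case: (ltnP p.+1 q) => H3; last by lia.
  by case: H2; exists p.+1 => //; lia.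
by move=> ->; split=> // -[x _ []]; lia.
Qed.

Lemma sat_eq z R p q : sat z R (fEq p q) <-> p = q.
Proof. by rewrite /=; split=> [[H1 H2]|->]; [lia|rewrite ltnn]. Qed.

Lemma num_zstep c b : is_num (zstep c b).1 -> is_start (zstep c b).1 = false ->
  is_num c.1 /\ (zstep c b).2 = rcons c.2 b.
Proof.
case: c => s a; rewrite /zstep /=; case: s => [q|q|||] //=.
- by case: b => //; case: q.
- by case: q => [|||||k|k|k|k|k|k|k|k]; try case: k; case: b.
- by case: b.
- by case: b.
Qed.

Lemma start_acc z p : is_start (conf z p).1 -> p <= size z -> (conf z p).2 = [::].
Proof.
case: p => [|p]; first by rewrite conf0.
by move=> H Hp; move: H; rewrite confS // /zstep /=; case: (dz _ _) => // -[].
Qed.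

Lemma num_pred z p : p < size z -> is_num (conf z p).1 -> ~~ is_start (conf z p).1 ->
  exists p', [/\ p = p'.+1, is_num (conf z p').1 & (conf z p).2 = rcons (conf z p').2 (nth false z p')].
Proof.
case: p => [|p]; first by rewrite conf0.
move=> Hp; rewrite confS; last by lia.
by move=> H1 /negbTE H2; have [H3 H4] := num_zstep H1 H2; exists p.
Qed.

(** Induction on the first position. Along a number the accumulator grows by one bit per position
    from its empty start, so equality of accumulators obeys the same recursion as the axiom. *)
Lemma axSameE z (R : rels) (HS : forall p s, p < size z -> R (zc s) p p p p <-> (conf z p).1 = s) :
  sat z R (axSame nat) <-> (forall p q, p < size z -> q < size z ->
    is_num (conf z p).1 -> is_num (conf z q).1 ->
      R 93 p q q q <-> (conf z p).2 = (conf z q).2).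
Proof.
have key p q : p < size z -> q < size z -> is_num (conf z p).1 -> is_num (conf z q).1 ->
  (forall p' q', p = p'.+1 -> q = q'.+1 -> is_num (conf z p').1 -> is_num (conf z q').1 ->
     R 93 p' q' q' q' <-> (conf z p').2 = (conf z q').2) ->
  (sat z R (QOr (QAnd (fStart p) (fStart q))
     (QAnd (QAnd (QNot (fStart p)) (QNot (fStart q)))
      (QEx (fun p' => QEx (fun q' => QAnd (QAnd (QAnd (fSucc p' p) (fSucc q' q))
         (QAnd (QImp (QBit p') (QBit q')) (QImp (QBit q') (QBit p')))) (fSame p' q'))))))
    <-> (conf z p).2 = (conf z q).2).
  move=> Hp Hq Np Nq IH; cbn [sat].
  rewrite !(sat_start HS) //; split.
    move=> [[Sp Sq]|[[/negP Sp /negP Sq]]]; first by rewrite !start_acc // ltnW.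
    move=> [p' Hp' [q' Hq' [[[E1 E2] [B1 B2]] HR]]].
    have {}E1 : p = p'.+1 by apply/(@sat_succ z R).
    have {}E2 : q = q'.+1 by apply/(@sat_succ z R).
    have [p1 [F1 N1 ->]] := num_pred Hp Np Sp; have [q1 [F2 N2 ->]] := num_pred Hq Nq Sq.
    have Ep : p1 = p' by lia. have Eq : q1 = q' by lia.
    rewrite Ep Eq in N1 N2 *; have -> := (IH p' q' E1 E2 N1 N2).1 HR.
    by congr rcons; apply/idP/idP.
  case Sp: (is_start (conf z p).1); case Sq: (is_start (conf z q).1) => E.
  - by left.
  - have [q1 [F2 N2 E2]] := num_pred Hq Nq (negbT Sq).
    by move: E; rewrite E2 start_acc ?(ltnW Hp) //; case: (conf z q1).2.
  - have [p1 [F1 N1 E1]] := num_pred Hp Np (negbT Sp).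
    by move: E; rewrite E1 [in RHS]start_acc ?(ltnW Hq) //; case: (conf z p1).2.
  - right; split=> //.
    have [p1 [F1 N1 E1]] := num_pred Hp Np (negbT Sp); have [q1 [F2 N2 E2]] := num_pred Hq Nq (negbT Sq).
    exists p1; first by lia. exists q1; first by lia.
    move: E; rewrite E1 E2 => /rcons_inj [Ea Eb]; split; [split; [split|]|].
    + by apply/(@sat_succ z R).
    + by apply/(@sat_succ z R).
    + by rewrite Eb.
    + by apply/(IH p1 q1).
split.
  move=> H p; elim: p => [|p IHp] q Hp Hq Np Nq; first by move: Np; rewrite conf0.
  have H' := H p.+1 Hp q Hq; cbn [sat] in H'.
  have {}H' := H' ((sat_num HS Hp).2 Np) ((sat_num HS Hq).2 Nq).
  have K := key p.+1 q Hp Hq Np Nq _.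
  rewrite -K; first by split; [exact: H'.1|exact: H'.2].
  by move=> p' q' [<-] Eq N1 N2; apply: IHp => //; lia.
move=> H p Hp q Hq Np Nq.
have {}Np := (sat_num HS Hp).1 Np; have {}Nq := (sat_num HS Hq).1 Nq.
have IH p' q' : p = p'.+1 -> q = q'.+1 -> is_num (conf z p').1 -> is_num (conf z q').1 ->
     R 93 p' q' q' q' <-> (conf z p').2 = (conf z q').2.
  by move=> E1 E2; apply: H; lia.
have K := key p q Hp Hq Np Nq IH; have HH := H p q Hp Hq Np Nq.
by split=> X; [apply/K/HH|apply/HH/K].
Qed.

Lemma scan_axiomsE z R : z <> [::] -> sat z R (scan_axioms nat) <-> scanned z R.
Proof.
move=> z0.
have N0 : 0 < size z by case: (z) z0.
cbn [sat scan_axioms]; split.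
  move=> [[[[H1 H2] H3] H4] H5].
  cbn [sat axStep] in H2; cbn [sat axOnly] in H3.
  have HS p s : p < size z -> R (zc s) p p p p <-> (conf z p).1 = s.
    (* The relation of the true state holds at each position, by induction along the string;
       [axOnly] then excludes all other states. *)
    have Hrun q : q < size z -> R (zc (conf z q).1) q q q q.
      elim: q => [|q IH] Hq.
        by rewrite conf0; apply: (H1 0 Hq); case=> x _.
      have Hq' : q < size z by lia.
      have [B1 B2] := (sat_ands _ _ _ _ _).1 (H2 q Hq' q.+1 Hq ((sat_succ R q Hq).2 erefl)) _ (In_zsts _) (IH Hq').
      by rewrite confS // /zstep /=; case E: (nth false z q); [apply: B1|apply: B2; rewrite /= E].
    move=> Hp; split; last by move=> <-; apply: Hrun.
    move=> HR; have := (sat_ands _ _ _ _ _).1 ((sat_ands _ _ _ _ _).1 (H3 p Hp) s (In_zsts s)) (conf z p).1 (In_zsts _).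
    by case: eqP => [/zc_inj -> //|_] []; split=> //; apply: Hrun.
  split=> //; first exact/(axSameE HS).
  have Hl : (size z).-1 < size z by lia.
  cbn [sat axLast] in H4; have := H4 _ Hl; rewrite !(sat_state HS) // => {}H4.
  have Ef : foldl dz (Mk W0) z = (conf z (size z).-1.+1).1.
    by rewrite prednK // /conf take_size foldl_zstep1.
  rewrite Ef confS // /zstep /=; case: H4 => [[x Hx]|[-> ->]|[-> /negP/negbTE ->]] //.
  by lia.
move=> [HS HC HF]; split; last exact/(axSameE HS).
split; [split; [split|]|].
- move=> p Hp H; apply/HS => //; case: p Hp H => [|p] Hp H; first by rewrite conf0.
  by case: H; exists 0.
- cbn [sat axStep]; move=> p Hp q Hq /(sat_succ R p Hq) Eq.
  apply: (sat_ands _ _ _ _ _).2 => s _; rewrite Eq in Hq *.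
  move=> /(HS _ _ Hp) Es; split=> Hb; apply/HS => //; rewrite confS // /zstep /= Es.
    by rewrite Hb.
  by move/negP/negbTE: Hb => ->.
- cbn [sat axOnly]; move=> p Hp.
  apply: (sat_ands _ _ _ _ _).2 => s _; apply: (sat_ands _ _ _ _ _).2 => s' _.
  case: eqP => [_|H]; first by rewrite /= ltnn.
  by move=> [/(HS _ _ Hp) E1 /(HS _ _ Hp) E2]; apply: H; rewrite -E1 -E2.
- move=> p Hp H.
  have Ep : p.+1 = size z.
    by case: (ltnP p.+1 (size z)) => Hp'; [case: H; exists p.+1 => //=|lia].
  have : (conf z p.+1).1 = FF by rewrite Ep /conf take_size foldl_zstep1.
  rewrite confS // /zstep /=; case E: (conf z p).1 => [q|q|||] //=.
  + by case: (nth _ _ _) => //; case: (q).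
  + by case: ifP => // /negbT/negP Hb _; right; split; [exact: (HS p F0 Hp).2 E|].
  + by case: ifP => // Hb _; left; split; [exact: (HS p FF Hp).2 E|].
Qed.

Arguments pr : simpl never.

Lemma pr_rcons x b : rcons (rcons (pr x) true) b = pr (x ++ [:: b]).
Proof. by rewrite pr_cat -!cats1 -catA. Qed.

(* What the collected bits look like inside the code of a number. *)
Definition acc_inv (q : qst) (a : seq bool) : Prop :=
  match q with
  | NN _ => a = [::]
  | NF _ => a = pr [:: true]
  | N1 _ => exists s, a = pr (pr (true :: s))
  | NB _ => exists s, a = pr (pr (true :: s) ++ [:: true])
  | NZ _ => exists n, a = pr (pr (nat_bits n) ++ [:: false])
  | SS _ => exists n, a = pr (enc_nat n)
  | _ => True
  end.

Definition conf_inv (c : zst * seq bool) : Prop :=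
  match c.1 with
  | Mk q => acc_inv q c.2
  | Rd q => exists2 a, c.2 = rcons a true & acc_inv q a
  | _ => True
  end.

Lemma conf_inv_step c b : conf_inv c -> conf_inv (zstep c b).
Proof.
case: c => s a; rewrite /conf_inv /zstep; case: s => [q|q|||] //=; try by case: b.
  by case: b => [H|]; [exists a|case: q].
move=> [a0 -> ]; case: q => [|||||k|k|k|k|k|k|k|k] //=; try by case: b.
- by case: b => //; case: k.
- by case: k; case: b.
- move=> ->; case: b => //=.
  by exists 0.
- by move=> ->; case: b => //=; exists [::].
- move=> [s ->]; case: b => /=; rewrite pr_rcons; first by exists s.
  by have [n En] := nat_bits_surj s; exists n; rewrite En.
- move=> [s ->]; exists (rcons s b).
  by rewrite pr_rcons; congr pr; rewrite -rcons_cons -cats1 pr_cat /pr /= -catA.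
- by move=> [n ->]; case: b => //=; exists n; rewrite pr_rcons -catA.
- by case: k => // _; case: b.
Qed.

Lemma conf_invP z p : conf_inv (conf z p).
Proof.
rewrite /conf; elim/last_ind: (take p z) => // s b IH.
by rewrite foldl_rcons; apply: conf_inv_step.
Qed.

(** * Atomic predicates at token positions *)

Definition var_of (t : option token) : option nat :=
  match t with Some (TL n _) | Some (TB n) => Some n | _ => None end.

Section Leaves.
Variables (z : seq bool) (R : rels).
Hypothesis scan : scanned z R.
Let u := emit (Mk W0, [::]) z.
Let N := size z.

Let HS p s : p < size z -> sat z R (fState s p) <-> (conf z p).1 = s.
Proof. by case: scan => H _ _; apply: H. Qed.

Lemma at_emit p : p < N -> at_ u p = tok (conf z p) (nth false z p).
Proof. exact: nth_emit. Qed.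

Lemma at_lt p t : at_ u p = Some t -> p < N.
Proof.
by case: (ltnP p N) => // H; rewrite /at_ nth_default // size_emit.
Qed.

Lemma sat_R p : p < N -> sat z R (fR p) <-> at_ u p = Some TR.
Proof.
move=> Hp; cbn [sat fR]; rewrite HS // at_emit // /tok.
case: (conf z p) => s a /=; split.
  by move=> [-> ->].
case: s => [q|q|||] //; last by case: ifP.
by case: q => [|||||k|k|k|k|k|k|k|k] //; try (by case: ifP); by case: k.
Qed.

Lemma sat_C k p : p < N -> sat z R (fC k p) <-> at_ u p = Some (TC k).
Proof.
move=> Hp; cbn [sat fC]; rewrite HS // at_emit // /tok.
case: (conf z p) => s a /=; split.
  by move=> [-> ->].
case: s => [q|q|||] //; last by case: ifP.
case: q => [|||||k'|k'|k'|k'|k'|k'|k'|k'] //; try (by case: ifP); last by case: k'.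
by case: ifP => // _ [->].
Qed.

Lemma sat_B p : p < N -> sat z R (fB p) <-> exists n, at_ u p = Some (TB n).
Proof.
move=> Hp; cbn [fB]; rewrite HS // at_emit // /tok.
case: (conf z p) => s a /=; split.
  by move=> ->; exists (dn a).
move=> [n]; case: s => [q|q|||] //; last by case: ifP.
by case: q => [|||||k'|k'|k'|k'|k'|k'|k'|k'] //; try (by case: ifP); case: k'.
Qed.

Lemma sat_F p : p < N -> sat z R (fF p) <-> at_ u p = Some TF.
Proof.
move=> Hp; cbn [sat fF]; rewrite HS // at_emit // /tok.
case: (conf z p) => s a /=; split.
  by move=> [-> ->].
case: s => [q|q|||] //; last by case: ifP.
by case: q => [|||||k'|k'|k'|k'|k'|k'|k'|k'] //; try (by case: ifP); case: k'.
Qed.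

Lemma sat_L p : p < N -> sat z R (fL p) <-> at_ u p = Some (TL (dn (conf z p).2) (nth false z p)).
Proof.
move=> Hp; rewrite /fL sat_ors at_emit // /tok; split.
  move=> [k Hk]; rewrite HS // => ->.
  by case: Hk => [<-|[<-|[<-|[<-|]]]].
case E: (conf z p) => [s a] /=.
case: s E => [q|q|||] // E; last by case: ifP.
case: q E => [|||||k'|k'|k'|k'|k'|k'|k'|k'] // E; try (by case: ifP).
have HR := (@HS p (conf z p).1 Hp).2 erefl; rewrite E /= in HR.
by case: k' E HR => // E HR _; [exists KW|exists KP|exists KJ|exists KC] => //; tauto.
Qed.

Lemma at_sign p n b : at_ u p = Some (TL n b) -> nth false z p = b.
Proof.
move=> H; have Hp := at_lt H; move: H; rewrite at_emit // /tok.
case: (conf z p) => -[q|q|||] a //=; last by case: ifP.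
by case: q => [|||||k'|k'|k'|k'|k'|k'|k'|k'] //; try (by case: ifP); case: k' => // -[_ ->].
Qed.

Lemma sat_LE p : p < N -> sat z R (fL p) <-> exists n b, at_ u p = Some (TL n b).
Proof.
move=> Hp; rewrite sat_L //; split; first by move=> ->; do 2 eexists.
move=> [n [b E]]; rewrite E (at_sign E); congr (Some (TL _ _)).
move: E; rewrite at_emit // /tok; case: (conf z p) => -[q|q|||] a //=; last by case: ifP.
by case: q => [|||||k'|k'|k'|k'|k'|k'|k'|k'] //; try (by case: ifP); case: k' => // -[].
Qed.

Lemma sat_inner p : p < N -> sat z R (fInner p) <-> inner (at_ u p).
Proof.
move=> Hp; cbn [sat fInner]; rewrite sat_R // sat_B // sat_F //.
case E: (at_ u p) => [[|k|n b|n|]|] /=; split=> //; try (by move=> H; exfalso; apply: H; tauto).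
- by move=> _ [[|[]]|].
- by move=> _ [[|[]]|].
- by move=> H; exfalso; apply: H; left; right; exists n.
- by move=> _ [[|[]]|].
Qed.

Lemma sat_soft p : p < N -> sat z R (fSoft p) <-> soft (at_ u p).
Proof.
move=> Hp; cbn [sat fSoft]; rewrite sat_inner // sat_ors.
case E: (at_ u p) => [[|k|n b|n|]|] /=; split=> //; try (by case).
- move=> [H _]; exfalso; apply: H; exists k; last by apply/sat_C.
  by case: (k); rewrite /=; tauto.
- by move=> _; split=> // -[k _ /sat_C]; rewrite E => /(_ Hp).
- by move=> _; split=> // -[k _ /sat_C]; rewrite E => /(_ Hp).
Qed.

Lemma sat_InC c l : l < N ->
  sat z R (fInC c l) <-> inC u c l /\ exists n b, at_ u l = Some (TL n b).
Proof.
move=> Hl; cbn [sat fInC]; rewrite sat_LE //; split.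
  move=> [[H1 H2] H3]; split=> //; split=> // q Hq1 Hq2.
  have Hq : q < N by lia.
  by apply/sat_soft => //; apply: H3.
move=> [[H1 H2] H3]; split=> // q Hq [Hq1 Hq2].
by apply/sat_soft => //; apply: H2.
Qed.

Lemma sat_InR r c : c < N -> sat z R (fInR r c) <-> at_ u r = Some TR /\ inR u r c.
Proof.
move=> Hc; cbn [sat fInR]; split.
  move=> [[H1 H2] H3]; have Hr : r < N by lia.
  rewrite -sat_R //; split=> //; split=> // q Hq1 Hq2.
  have Hq : q < N by lia.
  by apply/sat_inner => //; apply: H3.
move=> [H0 [H1 H2]]; have Hr : r < N by lia.
rewrite sat_R //; split=> // q Hq [Hq1 Hq2].
by apply/sat_inner => //; apply: H2.
Qed.

Lemma sat_ClR k r c : c < N ->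
  sat z R (fClR k r c) <-> [/\ at_ u r = Some TR, inR u r c & at_ u c = Some (TC k)].
Proof.
move=> Hc; cbn [sat fClR]; rewrite sat_InR // sat_C //; split; first by move=> [[]].
by case.
Qed.

Lemma sat_ClW c : c < N ->
  sat z R (fClW c) <-> at_ u c = Some (TC KW) /\ forall q, q < c -> inner (at_ u q).
Proof.
move=> Hc; cbn [sat fClW]; rewrite sat_C //; split=> -[H1 H2]; split=> // q Hq.
  have Hq' : q < N by lia.
  by apply/sat_inner => //; apply: H2.
by move=> Hq'; apply/sat_inner => //; apply: H2.
Qed.

(** By [conf_inv] the accumulator at such a position is a full code, and injectivity of [code] then
    reduces equality of variables to equality of accumulators. *)
Lemma var_at p n : var_of (at_ u p) = Some n ->
  [/\ p < N, is_num (conf z p).1 & (conf z p).2 = code n].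
Proof.
case E: (at_ u p) => [t|] // Hn; have Hp := at_lt E; split=> //.
  move: E Hn; rewrite at_emit // /tok; case: (conf z p) => -[q|q|||] a //=; last by case: ifP => // _ [<-].
  by case: q => [|||||k'|k'|k'|k'|k'|k'|k'|k'] //; case: ifP => // _ [<-].
have := conf_invP z p; rewrite /conf_inv; move: E Hn; rewrite at_emit // /tok.
case: (conf z p) => -[q|q|||] a //=; last by case: ifP => // _ [<-].
case: q => [|||||k'|k'|k'|k'|k'|k'|k'|k'] //; try (by case: ifP => // _ [<-]).
by case: k' => /= -[<-] [<-] [a0 -> [m ->]]; rewrite -/(code m) codeK.
Qed.

Lemma sat_same p q n n' : var_of (at_ u p) = Some n -> var_of (at_ u q) = Some n' ->
  sat z R (fSame p q) <-> n = n'.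
Proof.
move=> /var_at [Hp Np Ep] /var_at [Hq Nq Eq].
case: scan => _ H _; cbn [sat fSame]; rewrite H // Ep Eq; split=> [/code_inj|->] //.
Qed.
End Leaves.

(** * Stable extensions and refutations *)

Definition evalc (v : nat -> bool) (C : clause) : bool := has (fun l => v l.1 == l.2) C.
Definition evalf (v : nat -> bool) (f : cnf) : bool := all (evalc v) f.

Lemma eval_clause v C : eval v (clause_form C) = evalc v C.
Proof.
elim: C => //= -[n b] C ->; congr orb; rewrite /lit_form /=.
by case: b => /=; case: (v n).
Qed.

Lemma eval_cnf v f : eval v (cnf_form f) = evalf v f.
Proof. by elim: f => //= C f ->; rewrite eval_clause. Qed.

Section Stable.
Variables (T : theory) (isR : nat -> Prop) (rl : nat -> rule).
Hypothesis rulesE : forall r, r \in T.2 <-> exists2 p, isR p & r = rl p.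

Definition Ax (G : nat -> Prop) (v : nat -> bool) : Prop :=
  (forall w, w \in T.1 -> evalf v w) /\ (forall p, isR p -> G p -> evalf v (rconcl (rl p))).

(* G is the set of generating defaults, and ht bounds the length of a derivation. *)
Definition generating (G : nat -> Prop) (ht : nat -> nat) : Prop :=
  [/\ exists v, Ax G v,
    forall p, isR p -> G p -> forall v, Ax (fun q => G q /\ ht q < ht p) v -> evalf v (rpre (rl p)),
    forall p, isR p -> G p -> exists2 v, Ax G v & evalf v (rjust (rl p))
  & forall p, isR p -> ~ G p -> (exists2 v, Ax G v & ~~ evalf v (rpre (rl p))) \/
      (forall v, Ax G v -> ~~ evalf v (rjust (rl p)))].

(** The extension is the set of consequences of the knowledge base and the conclusions of [G]. It
    lies inside [Gamma] because the defaults of [G] can be applied in order of height, and contains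
    [Gamma] because every default outside [G] is blocked. *)
Lemma stable_sound G ht : generating G ht -> has_consistent_stable_extension T.
Proof.
move=> [[v0 Hv0] Hpre Hjust Hout].
pose E phi := forall v, Ax G v -> eval v phi.
have Ejust p : isR p -> G p -> ~ E (FNeg (cnf_form (rjust (rl p)))).
  by move=> Hp Gp H; have [v Hv Hj] := Hjust p Hp Gp; have := H v Hv; rewrite /= eval_cnf Hj.
exists E; split; last by move=> /(_ v0 Hv0).
move=> phi; split.
  move=> Ephi S SW Sded Srule.
  have SG p : isR p -> G p -> S (cnf_form (rconcl (rl p))).
    have [n] := ubnP (ht p); elim: n p => // n IH p Hn Hp Gp.
    apply: Srule; [by apply/rulesE; exists p| |exact: Ejust].
    apply: Sded => v Hv; rewrite eval_cnf; apply: Hpre => //; split.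
      by move=> w Hw; rewrite -eval_cnf; apply/Hv/SW.
    move=> q Hq [Gq Hlt]; rewrite -eval_cnf; apply/Hv/IH => //; lia.
  apply: Sded => v Hv; apply: Ephi; split.
    by move=> w Hw; rewrite -eval_cnf; apply/Hv/SW.
  by move=> q Hq Gq; rewrite -eval_cnf; apply/Hv/SG.
apply.
- by move=> w Hw v [Hv _]; rewrite eval_cnf; apply: Hv.
- by move=> psi H v Hv; apply: H => chi Hchi; apply: Hchi.
- move=> r /rulesE [p Hp ->] Epre Ej.
  case: (pselect (G p)) => [Gp|nGp].
    by move=> v [_ Hv]; rewrite eval_cnf; apply: Hv.
  case: (Hout p Hp nGp) => [[v Hv]|H].
    by rewrite -eval_cnf Epre.
  by case: Ej => v Hv; rewrite /= eval_cnf; apply: H.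
Qed.

Variable N : nat.
Hypothesis isR_lt : forall p, isR p -> p < N.

(** [G] collects the defaults applicable with respect to [E], and the height of a default is the
    first round in which it is derivable from the preceding round. Minimality of [Gamma] forces all
    of [E] to follow from defaults derived in finitely many rounds. *)
Lemma stable_complete : has_consistent_stable_extension T -> exists G ht, generating G ht.
Proof.
move=> [E [Estab Econs]].
pose G p := E (cnf_form (rpre (rl p))) /\ ~ E (FNeg (cnf_form (rjust (rl p)))).
(* Round [n.+1] holds the defaults of [G] whose prerequisite follows from the knowledge base and the
   conclusions of round [n]; round 0 is empty. *)
pose H := fix H n p := if n is n'.+1 then G p /\ (forall v, Ax (H n') v -> evalf v (rpre (rl p))) else False.
have AxS (P Q : nat -> Prop) v : (forall p, isR p -> P p -> Q p) -> Ax Q v -> Ax P v.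
  by move=> PQ [H1 H2]; split=> // p Hp Pp; apply: H2 => //; apply: PQ.
have Hmono n p : H n p -> H n.+1 p.
  elim: n p => // n IH p [Gp Hp]; split=> // v Hv; apply: Hp.
  by apply: AxS Hv => q _; apply: IH.
have Hle n n' p : n <= n' -> H n p -> H n' p.
  by move=> /subnK <-; elim: (n' - n) => // j IH /IH; apply: Hmono.
have HG n p : H n p -> G p by case: n => // n [].
pose Hinf p := exists n, H n p.
pose hn p := if pselect (Hinf p) is left h then projT1 (cid h) else 0.
have hnP p : Hinf p -> H (hn p) p.
  by move=> h; rewrite /hn; case: pselect => // h'; case: (cid h').
(* Positions of defaults are bounded, so one common round contains all derivable defaults. *)
pose M := \max_(p < N) hn p.
have HM p : isR p -> Hinf p -> H M p.
  move=> Hp h; have L : hn p <= M := @leq_bigmax _ (fun p : 'I_N => hn p) (Ordinal (isR_lt Hp)).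
  exact: Hle L (hnP p h).
have EW w : w \in T.1 -> E (cnf_form w).
  by move=> Hw; apply/Estab => S SW _ _; apply: SW.
have Eded : ded_closed E.
  move=> phi Hphi; apply/Estab => S SW Sded Srule; apply: (Sded) => v Hv.
  apply: Hphi => psi /Estab Hpsi; apply: Hv; exact: (Hpsi S).
have EG p : isR p -> G p -> E (cnf_form (rconcl (rl p))).
  move=> Hp [/Estab G1 G2]; apply/Estab => S SW Sded Srule; apply: (Srule) => //.
    by apply/rulesE; exists p.
  exact: (G1 S).
pose S phi := forall v, Ax Hinf v -> eval v phi.
have SE phi : S phi -> E phi.
  move=> HS; apply: Eded => v Hv; apply: HS; split.
    by move=> w Hw; rewrite -eval_cnf; apply/Hv/EW.
  by move=> p Hp [n Hn]; rewrite -eval_cnf; apply/Hv/EG => //; apply: HG Hn.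
have Sinf p : isR p -> S (cnf_form (rpre (rl p))) -> ~ E (FNeg (cnf_form (rjust (rl p)))) -> Hinf p.
  move=> Hp HS Hj; exists M.+1; split; first by split=> //; apply: SE.
  move=> v Hv; rewrite -eval_cnf; apply: HS; apply: AxS Hv => q Hq; exact: HM.
(* [S] has the three closure properties in the definition of [Gamma], so minimality puts [E] inside
   [S]. *)
have ES phi : E phi -> S phi.
  move=> /Estab; apply.
  - by move=> w Hw v [Hv _]; rewrite eval_cnf; apply: Hv.
  - by move=> psi K v Hv; apply: K => chi Hchi; apply: Hchi.
  - move=> r /rulesE [p Hp ->] Spre Ej v [_ Hv]; rewrite eval_cnf.
    by apply: Hv => //; apply: Sinf.
have GH p : isR p -> G p -> Hinf p.
  by move=> Hp [G1 G2]; apply: Sinf => //; apply: ES.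
have EAx phi : ~ E phi -> exists2 v, Ax G v & ~~ eval v phi.
  move=> nE; apply: contrapT => nex; apply: nE; apply: SE => v Hv.
  apply: contrapT => /negP nv; apply: nex; exists v => //.
  by apply: AxS Hv => p; apply: GH.
(* The value 0 concerns underivable defaults only. As round 0 is empty, a derivable default has
   positive height, and the round before it supports its prerequisite. *)
pose ht p := if pselect (exists n, `[< H n p >]) is left h then ex_minn h else 0.
have htP p n : H n p -> H (ht p) p /\ ht p <= n.
  move=> Hn; rewrite /ht; case: pselect => [h|[]]; last by exists n; apply/asboolP.
  by case: ex_minnP => k /asboolP Hk Hmin; split=> //; apply: Hmin; apply/asboolP.
exists G, ht; split.
- by have [v Hv _] := EAx _ Econs; exists v.
- move=> p Hp Gp v Hv; have [n Hn] := GH p Hp Gp.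
  have [Hh _] := htP p n Hn.
  case Eh: (ht p) Hh Hv => [|k] // [_ Hk] Hv; apply: Hk; apply: AxS Hv => q Hq Hkq.
  have [_ Hqk] := htP q k Hkq; split; [exact: HG Hkq|lia].
- move=> p Hp [_ Hj]; have [v Hv] := EAx _ Hj.
  by rewrite /= eval_cnf negbK => H'; exists v.
- move=> p Hp nG; case: (pselect (E (cnf_form (rpre (rl p))))) => [Ep|nEp].
    right; case: (pselect (E (FNeg (cnf_form (rjust (rl p)))))) => [Ej|nEj].
      move=> v Hv; have : S (FNeg (cnf_form (rjust (rl p)))) by apply: ES.
      move=> /(_ v); rewrite /= eval_cnf; apply; apply: AxS Hv => q Hq [n Hn]; exact: HG Hn.
    by case: nG.
  left; have [v Hv] := EAx _ nEp.
  by rewrite eval_cnf; exists v.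
Qed.
End Stable.

(** * Naming the assignments of the backdoor by positions *)

Section Enumeration.
Variables As Bs : seq nat.
Hypotheses (uA : uniq As) (uB : uniq Bs).

Definition flip_closed (W : nat -> nat -> bool) : Prop :=
  forall a b, a \in As -> b \in Bs ->
    exists2 a', a' \in As & forall b', b' \in Bs -> W a' b' = (b' == b) (+) W a b'.
Definition separated (W : nat -> nat -> bool) : Prop :=
  forall a a', a \in As -> a' \in As -> a <> a' -> exists2 b, b \in Bs & W a b <> W a' b.

(** Starting from any name, the coordinates that disagree with [f] are flipped one after another. *)
Lemma flip_closed_all W a0 : flip_closed W -> a0 \in As ->
  forall f, exists2 a, a \in As & forall b, b \in Bs -> W a b = f b.
Proof.
move=> HF Ha0 f.
suff H (l : seq nat) : {subset l <= Bs} -> exists2 a, a \in As & forall b, b \in l -> W a b = f b.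
  exact: H.
elim: l => [|b l IH] Hl; first by exists a0.
have [|a Ha H] := IH; first by move=> x Hx; apply: Hl; rewrite inE Hx orbT.
have Hb : b \in Bs by apply: Hl; rewrite mem_head.
case: (W a b =P f b) => E.
  by exists a => // b'; rewrite inE => /orP [/eqP ->|/H].
have [a' Ha' H'] := HF a b Ha Hb; exists a' => // b' Hb'.
rewrite H'; last exact: Hl.
case: (b' =P b) => [->|Hne] /=; first by case: (W a b) (f b) E => [] [].
by move: Hb'; rewrite inE => /orP [/eqP|/H].
Qed.

Let L : seq (seq bool) := map val (enum {: (size Bs).-tuple bool}).

Let size_L : size L = 2 ^ size Bs.
Proof. by rewrite size_map -cardE card_tuple card_bool. Qed.

Let uniq_L : uniq L.
Proof. by rewrite map_inj_uniq ?enum_uniq //; apply: val_inj. Qed.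

Let mem_L t : (t \in L) = (size t == size Bs).
Proof.
apply/mapP/idP => [[x _ ->]|Ht]; first by rewrite size_tuple.
by exists (Tuple Ht); rewrite ?mem_enum.
Qed.

(** The rows of [W] are distinct by separation and exhaust all bit vectors by flip closure, so [As]
    is in bijection with the vectors of length [size Bs]. *)
Lemma flip_closed_size W a0 : flip_closed W -> separated W -> a0 \in As ->
  size As = 2 ^ size Bs.
Proof.
move=> HF HS Ha0; rewrite -size_L -(size_map (fun a => map (W a) Bs) As).
apply: perm_size; apply: uniq_perm => //.
  rewrite map_inj_in_uniq // => a a' Ha Ha' E; apply: contrapT => Hne.
  have [b Hb Hw] := HS a a' Ha Ha' Hne; apply: Hw.
  by move/eq_in_map: E; apply.
move=> t; rewrite mem_L; apply/mapP/eqP => [[a _ ->]|Ht]; first by rewrite /= size_map.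
have [a Ha H] := flip_closed_all HF Ha0 (fun b => nth false t (index b Bs)).
exists a => //; apply: (@eq_from_nth _ false) => [|i Hi]; first by rewrite Ht size_map.
rewrite Ht in Hi; rewrite (nth_map 0) // H ?mem_nth // index_uniq //.
Qed.

(** The [i]-th element of [As] names the [i]-th bit vector in [L]. *)
Lemma enumeration_exists : size As = 2 ^ size Bs ->
  exists W, [/\ exists a, a \in As, flip_closed W & separated W].
Proof.
move=> sA.
pose W a b := nth false (nth [::] L (index a As)) (index b Bs).
have rowL a : a \in As -> nth [::] L (index a As) \in L.
  by move=> Ha; apply: mem_nth; rewrite size_L -sA index_mem.
exists W; split.
- have : 0 < size As by rewrite sA expn_gt0.
  by case: (As) => // a s _; exists a; rewrite mem_head.
- move=> a b Ha Hb.
  pose t := mkseq (fun i => (nth 0 Bs i == b) (+) nth false (nth [::] L (index a As)) i) (size Bs).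
  have tL : t \in L by rewrite mem_L size_mkseq.
  exists (nth 0 As (index t L)).
    by apply: mem_nth; rewrite sA -size_L index_mem.
  move=> b' Hb'; rewrite /W index_uniq ?sA -?size_L ?index_mem //.
  by rewrite nth_index // nth_mkseq ?index_mem // nth_index.
- move=> a a' Ha Ha' Hne; apply: contrapT => Hno; apply: Hne.
  have Ia : index a As < size L by rewrite size_L -sA index_mem.
  have Ia' : index a' As < size L by rewrite size_L -sA index_mem.
  have E : nth [::] L (index a As) = nth [::] L (index a' As).
    have := rowL a Ha; rewrite mem_L => /eqP S1; have := rowL a' Ha'; rewrite mem_L => /eqP S2.
    apply: (@eq_from_nth _ false); first by rewrite S1 S2.
    move=> i; rewrite S1 => Hi; apply: contrapT => Hw; apply: Hno.
    by exists (nth 0 Bs i); [exact: mem_nth|rewrite /W index_uniq].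
  have := congr1 (index^~ L) E; rewrite !index_uniq // => EI.
  by rewrite -(nth_index 0 Ha) EI nth_index.
Qed.
End Enumeration.

(** * Refutation by unit propagation *)

Section Refutation.
Variables (u : tokens) (W : nat -> nat -> bool) (prem extra : nat -> Prop) (a : nat).

Definition falseB (n : nat) (b : bool) : Prop := exists2 p, at_ u p = Some (TB n) & W a p <> b.
Definition trueB (n : nat) (b : bool) : Prop := exists2 p, at_ u p = Some (TB n) & W a p = b.

(** [D] collects literal positions whose variable has been derived true, so it refutes negative
    literals. The literals refuted neither by [D] nor by the assignment must be positive occurrences
    of [m], the unit conclusion. A negative literal assumed false yields its variable as well. *)
Definition fire (D : nat -> Prop) (m : nat) : Prop :=
  (exists2 c, prem c & forall l n b, inC u c l -> at_ u l = Some (TL n b) ->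
     falseB n b \/ (b = false /\ D l) \/ (b = true /\ n = m)) \/
  (exists2 l, extra l & at_ u l = Some (TL m false)).

Definition conflict (D : nat -> Prop) : Prop :=
  (exists2 c, prem c & forall l n b, inC u c l -> at_ u l = Some (TL n b) ->
     falseB n b \/ (b = false /\ D l)) \/
  (exists l n b, [/\ extra l, at_ u l = Some (TL n b) & trueB n b \/ (b = true /\ D l)]).

(** Every variable in a stage is true in [v], by induction on stages, so a conflict contradicts the
    clauses or the assumptions. The stages are arbitrary predicates because they come from a guessed
    relation. *)
Lemma refute_sound (D : nat -> nat -> Prop) v :
  (forall s l n b, at_ u l = Some (TL n b) -> D s l -> exists2 s', s' < s & fire (D s') n) ->
  (exists s, conflict (D s)) ->
  (forall p n, at_ u p = Some (TB n) -> W a p = v n) ->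
  (forall c, prem c -> evalc v (clause_at u c)) ->
  (forall l n b, extra l -> at_ u l = Some (TL n b) -> v n <> b) -> False.
Proof.
move=> HD [s0 Hs0] Hv Hprem Hextra.
have notF n b : v n = b -> ~ falseB n b.
  by move=> E [p Hp]; rewrite (Hv p n Hp) E.
have litP c : prem c -> exists l n b, [/\ inC u c l, at_ u l = Some (TL n b) & v n = b].
  by move=> /Hprem /hasP [[n b]] /clause_atP [l H1 H2] /eqP E; exists l, n, b.
have Dtrue s l n b : at_ u l = Some (TL n b) -> D s l -> v n = true.
  have [k] := ubnP s; elim: k s l n b => // k IH s l n b Hk El Hd.
  have [s' Hs' [[c Hc H]|[l' Hl' El']]] := HD s l n b El Hd.
    have [l1 [n1 [b1 [I1 E1 V1]]]] := litP c Hc.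
    case: (H l1 n1 b1 I1 E1) => [/(notF _ _ V1) //|[[Eb D1]|[Eb <-]]]; last by rewrite V1.
    have Tn : v n1 = true by apply: (IH s' l1 n1 b1) => //; lia.
    by move: Tn; rewrite V1 Eb.
  by have := Hextra l' n false Hl' El'; case: (v n).
case: Hs0 => [[c Hc H]|[l [n [b [Hl El [[p Hp]|[Eb Dl]]]]]]].
- have [l1 [n1 [b1 [I1 E1 V1]]]] := litP c Hc.
  case: (H l1 n1 b1 I1 E1) => [/(notF _ _ V1) //|[Eb D1]].
  by have := Dtrue s0 l1 n1 b1 E1 D1; rewrite V1 Eb.
- by rewrite (Hv p n Hp); apply: (Hextra l).
- by apply: (Hextra l n b Hl El); rewrite Eb; apply: Dtrue El Dl.
Qed.

Fixpoint stage (s l : nat) : Prop :=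
  if s is s'.+1 then exists n b, at_ u l = Some (TL n b) /\ fire (stage s') n else False.

Lemma stageP s l n b : at_ u l = Some (TL n b) -> stage s l -> exists2 s', s' < s & fire (stage s') n.
Proof. by case: s => //= s E [n' [b' []]]; rewrite E => -[<- _] H; exists s. Qed.

Lemma stage_mono s l : stage s l -> stage s.+1 l.
Proof.
elim: s l => //= s IH l [n [b [El H]]]; exists n, b; split=> //.
case: H => [[c Hc H]|]; last by right.
left; exists c => // l' n' b' I' E'.
by case: (H l' n' b' I' E') => [?|[[? /IH ?]|?]]; [left|right; left|right; right].
Qed.

Hypothesis uniqB : forall p q n, at_ u p = Some (TB n) -> at_ u q = Some (TB n) -> p = q.
Hypothesis horn : forall c, prem c -> forall l l' n b n' b', l < l' -> inC u c l -> inC u c l' ->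
    at_ u l = Some (TL n b) -> at_ u l' = Some (TL n' b') -> b -> b' ->
    (forall p, at_ u p <> Some (TB n)) -> (forall p, at_ u p <> Some (TB n')) -> False.

(** The increasing stages stabilise within [size u] steps. Without a conflict, the valuation that
    follows [W a] on the backdoor and makes exactly the derived variables true elsewhere would
    satisfy all clauses and falsify all assumed literals. *)
Lemma refute_complete : 0 < size u -> (forall n b, at_ u 0 <> Some (TL n b)) ->
  (forall v, (forall p n, at_ u p = Some (TB n) -> W a p = v n) ->
     (forall c, prem c -> evalc v (clause_at u c)) ->
     (forall l n b, extra l -> at_ u l = Some (TL n b) -> v n <> b) -> False) ->
  exists2 s, s < size u & conflict (stage s).
Proof.
move=> u0 at0 unsat.
pose D s := [seq l <- iota 0 (size u) | `[< stage s l >]].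
have stage_lt s l : stage s l -> 0 < l < size u.
  case: s => //= s [n [b [El _]]]; apply/andP; split.
    by case: l El => // E; case: (at0 _ _ E).
  by rewrite ltnNge; apply/negP => Hl; move: El; rewrite /at_ nth_default.
(* Otherwise every stage gains a position and stage [size u] contains at least [size u] of them; but
   position 0, which carries no literal, is never included. *)
have [s Hs stab] : exists2 s, s < size u & forall l, stage s.+1 l -> stage s l.
  apply: contrapT => Hno.
  have grow s : s <= size u -> s <= size (D s).
    elim: s => // s IH Hs; have {}IH := IH (ltnW Hs).
    apply: leq_ltn_trans IH _.
    have Hsub : {subset D s <= D s.+1}.
      move=> l; rewrite !mem_filter => /andP [/asboolP H ->]; rewrite andbT.
      by apply/asboolP; apply: stage_mono.
    have [l H1 H2] : exists2 l, stage s.+1 l & ~ stage s l.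
      apply: contrapT => H; apply: Hno; exists s => // l Hl.
      by apply: contrapT => nl; apply: H; exists l.
    have Hl : l \in D s.+1.
      rewrite mem_filter mem_iota add0n leq0n.
      by case/andP: (stage_lt _ _ H1) => _ ->; rewrite !andbT; apply/asboolP.
    rewrite ltnNge; apply/negP => Hle.
    have [_ Eq] := uniq_min_size (filter_uniq _ (iota_uniq _ _)) Hsub Hle.
    by move: Hl; rewrite -Eq mem_filter => /andP [/asboolP].
  have := grow (size u) (leqnn _).
  have : size (D (size u)) < size u.
    rewrite size_filter -[X in _ < X](size_iota 0) -(count_predC (fun l => `[< stage (size u) l >])) -addn1 leq_add2l.
    rewrite -has_count; apply/hasP; exists 0; first by rewrite mem_iota u0.
    by apply/negP => /asboolP /stage_lt.
  lia.
exists s => //; apply: contrapT => nconf.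
pose v n := if pselect (exists p, at_ u p = Some (TB n)) is left h then W a (projT1 (cid h))
  else `[< exists l b, at_ u l = Some (TL n b) /\ stage s l >].
have vB p n : at_ u p = Some (TB n) -> W a p = v n.
  move=> Hp; rewrite /v; case: pselect => [h|[]]; last by exists p.
  by congr (W a _); case: (cid h) => q Hq /=; apply: uniqB Hp Hq.
have stage_same s' l l' n b b' : at_ u l = Some (TL n b) -> at_ u l' = Some (TL n b') -> stage s' l -> stage s' l'.
  case: s' => //= s' E E' [n1 [b1 [E1 H1]]]; exists n, b'; split=> //.
  by move: E1; rewrite E => -[->].
have vN l n b : at_ u l = Some (TL n b) -> (forall p, at_ u p <> Some (TB n)) -> v n <-> stage s l.
  move=> El nB; rewrite /v; case: pselect => [[p Hp]|_]; first by case: (nB p).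
  split; last by move=> H; apply/asboolP; exists l, b.
  by move=> /asboolP [l' [b' [El' H']]]; apply: stage_same El' El H'.
have decB n : (exists p, at_ u p = Some (TB n)) \/ (forall p, at_ u p <> Some (TB n)).
  case: (pselect (exists p, at_ u p = Some (TB n))); first by left.
  by move=> H; right=> p Hp; apply: H; exists p.
apply: (unsat v vB).
- move=> c Hc; apply: contrapT => /negP/hasPn nsat.
  have lits l n b : inC u c l -> at_ u l = Some (TL n b) -> v n <> b.
    by move=> Il El; apply/eqP; apply: (nsat (n, b)); apply/clause_atP; exists l.
  have cases l n b : inC u c l -> at_ u l = Some (TL n b) ->
      falseB n b \/ (b = false /\ stage s l) \/ (b = true /\ forall p, at_ u p <> Some (TB n)).
    move=> Il El; have Hv := lits l n b Il El.
    case: (decB n) => [[p Hp]|nB]; first by left; exists p => //; rewrite (vB p n Hp).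
    right; case: b El Hv => El Hv; first by right.
    by left; split=> //; apply/(vN l n false) => //; case: (v n) Hv.
  (* By the Horn condition a positive literal outside the backdoor is the only one of its clause, so
     if all other literals are refuted the clause fires, and stability makes the variable true. *)
  case: (pselect (exists l n, [/\ inC u c l, at_ u l = Some (TL n true) & forall p, at_ u p <> Some (TB n)])).
    move=> [l [n [Il El nB]]]; apply: (lits l n true Il El).
    apply/(vN l n true El nB); apply: stab; exists n, true; split=> //.
    left; exists c => // l' n' b' Il' El'.
    case: (cases l' n' b' Il' El') => [?|[?|[Eb nB']]]; [by left|by right; left|right; right].
    split=> //; case: (ltngtP l l') => Hll.
    + by case: (horn Hc Hll Il Il' El El' isT _ nB nB'); rewrite Eb.
    + by case: (horn Hc Hll Il' Il El' El _ isT nB' nB); rewrite Eb.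
    + by move: El; rewrite Hll El' => -[].
  move=> nex; apply: nconf; left; exists c => // l n b Il El.
  case: (cases l n b Il El) => [?|[?|[Eb nB]]]; [by left|by right|].
  by case: nex; exists l, n; rewrite -Eb.
- move=> l n b Hl El Ev; case: (decB n) => [[p Hp]|nB].
    apply: nconf; right; exists l, n, b; split=> //; left; exists p => //.
    by rewrite (vB p n Hp).
  case: b El Ev => El Ev.
    apply: nconf; right; exists l, n, true; split=> //; right; split=> //.
    by apply/(vN l n true).
  have : v n by apply/(vN l n false El nB); apply: stab; exists n, false; split=> //; right; exists l.
  by rewrite Ev.
Qed.
End Refutation.

(** * Clauses of a theory and the backdoor condition *)

Definition inT (T : theory) (C : clause) : Prop :=
  (exists2 w, w \in T.1 & C \in w) \/
  (exists2 r, r \in T.2 & C \in rpre r ++ rjust r ++ rconcl r).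

Lemma allT (T : theory) (P : pred clause) :
  (all (all P) T.1 && all (fun r => [&& all P (rpre r), all P (rjust r) & all P (rconcl r)]) T.2)
  <-> forall C, inT T C -> P C.
Proof.
split.
  move=> /andP [/allP H1 /allP H2] C [[w Hw HC]|[r Hr HC]].
    by move/allP: (H1 w Hw); apply.
  have /and3P [P1 P2 P3] := H2 r Hr.
  by move: HC; rewrite !mem_cat => /or3P [] HC; [move/allP: P1|move/allP: P2|move/allP: P3]; apply.
move=> H; apply/andP; split; apply/allP.
  by move=> w Hw; apply/allP => C HC; apply: H; left; exists w.
move=> r Hr; apply/and3P; split; apply/allP => C HC; apply: H; right; exists r => //;
  by rewrite !mem_cat HC ?orbT.
Qed.

Lemma no_tautE T : no_taut T <-> forall C, inT T C -> ~~ taut_clause C.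
Proof. exact: allT. Qed.

Lemma vars_theoryE T x : x \in vars_theory T <-> exists2 C, inT T C & exists b, (x, b) \in C.
Proof.
have vars_cnfE f : x \in vars_cnf f <-> exists2 C, C \in f & exists b, (x, b) \in C.
  split.
    move=> /flatten_mapP [C HC /mapP [[n b] Hn ->]]; exists C => //; by exists b.
  by move=> [C HC [b Hb]]; apply/flatten_mapP; exists C => //; apply/mapP; exists (x, b).
rewrite /vars_theory mem_cat; split.
  move=> /orP [/flatten_mapP [w Hw /vars_cnfE [C HC Hb]]|/flatten_mapP [r Hr]].
    by exists C => //; left; exists w.
  rewrite !mem_cat => /or3P [] /vars_cnfE [C HC Hb]; exists C => //; right; exists r => //;
    by rewrite !mem_cat HC ?orbT.
move=> [C [[w Hw HC]|[r Hr HC]] Hb].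
  by apply/orP; left; apply/flatten_mapP; exists w => //; apply/vars_cnfE; exists C.
rewrite !mem_cat in HC; apply/orP; right; apply/flatten_mapP; exists r => //.
rewrite !mem_cat; apply/or3P.
by case/or3P: HC => HC; [apply: Or31|apply: Or32|apply: Or33]; apply/vars_cnfE; exists C.
Qed.

Lemma horn_redE B f :
  (forall Y, horn_cnf (red_cnf B Y f)) <->
  all (fun C => count (fun l => l.2 && (l.1 \notin B)) C <= 1) f.
Proof.
have E C : horn_clause (filter (fun l : lit => l.1 \notin B) C) = (count (fun l => l.2 && (l.1 \notin B)) C <= 1).
  by rewrite /horn_clause count_filter.
split.
  (* With every backdoor variable set to [x_eps] no clause is dropped and exactly the literals
     outside [B] remain. *)
  move=> /(_ (fun=> None)) /allP H; apply/allP => C HC; rewrite -E; apply: H.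
  rewrite /red_cnf mem_pmap; apply/mapP; exists C => //.
  by rewrite /red_clause ifF //; apply/hasP => -[l _]; rewrite andbF.
move=> /allP H Y; apply/allP => C'; rewrite /red_cnf mem_pmap => /mapP [C HC].
by rewrite /red_clause; case: ifP => // _ [->]; rewrite E; apply: H.
Qed.

(* The assignment that deletes every backdoor variable is the strongest test. *)
Lemma backdoorE B T : strong_horn_backdoor B T <->
  forall C, inT T C -> count (fun l => l.2 && (l.1 \notin B)) C <= 1.
Proof.
rewrite -(allT T (fun C => count (fun l => l.2 && (l.1 \notin B)) C <= 1)).
have zipE (P : pred rule) : all (fun ir : nat * rule => P ir.2) (zip (iota 0 (size T.2)) T.2) = all P T.2.
  by rewrite -[in RHS](@unzip2_zip _ _ (iota 0 (size T.2)) T.2) ?size_iota // /unzip2 all_map.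
(* The clause added for the fresh variable is a single positive literal, hence Horn, so only the
   reduct of the original conclusion is tested. *)
have redE Y : all_horn (red_theory B Y T) =
    all (fun w => horn_cnf (red_cnf B Y w)) T.1 &&
    all (fun r => [&& horn_cnf (red_cnf B Y (rpre r)), horn_cnf (red_cnf B Y (rjust r))
                    & horn_cnf (red_cnf B Y (rconcl r))]) T.2.
  rewrite /all_horn /red_theory /= !all_map; congr andb.
  rewrite -zipE; apply: eq_all => -[i r] /=.
  by rewrite /rpre /rjust /rconcl /horn_cnf /= all_cat /= andbT.
split.
  move=> H; apply/andP; split; apply/allP.
    move=> w Hw; apply/horn_redE => Y; have := H Y; rewrite redE => /andP [/allP H1 _].
    exact: H1.
  move=> r Hr; have H' Y : [&& horn_cnf (red_cnf B Y (rpre r)), horn_cnf (red_cnf B Y (rjust r))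
                    & horn_cnf (red_cnf B Y (rconcl r))].
    by have := H Y; rewrite redE => /andP [_ /allP H2]; apply: H2.
  by apply/and3P; split; apply/horn_redE => Y; case/and3P: (H' Y).
move=> /andP [/allP H1 /allP H2] Y; rewrite redE; apply/andP; split; apply/allP.
  by move=> w Hw; have/horn_redE := H1 w Hw; apply.
move=> r Hr; have /and3P [P1 P2 P3] := H2 r Hr.
by apply/and3P; split; [move/horn_redE: P1|move/horn_redE: P2|move/horn_redE: P3]; apply.
Qed.

(** * Correctness of the formula *)

Section PositionSets.
Variable u : tokens.
Definition ClW c : Prop := at_ u c = Some (TC KW) /\ forall q, q < c -> inner (at_ u q).
Definition ClR k r c : Prop := [/\ at_ u r = Some TR, inR u r c & at_ u c = Some (TC k)].
Definition AxP (G : nat -> Prop) c : Prop := ClW c \/ exists r, ClR KC r c /\ G r.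
Definition isCl c : Prop := ClW c \/ exists r, ClR KP r c \/ ClR KJ r c \/ ClR KC r c.
Definition isLit l : Prop := exists n b, at_ u l = Some (TL n b).

Lemma ClR_uniq k k' r r' c : ClR k r c -> ClR k' r' c -> r = r'.
Proof.
move=> [H1 [H2 H3] _] [H1' [H2' H3'] _].
case: (ltngtP r r') => // Hr; first by have := H3 r' Hr H2'; rewrite H1'.
by have := H3' r Hr H2; rewrite H1.
Qed.

Lemma evalf_at k r v : evalf v (cnf_at u k r) <->
  forall c, inR u r c -> at_ u c = Some (TC k) -> evalc v (clause_at u c).
Proof.
split; first by move=> /allP H c Hr Hc; apply: H; apply/cnf_atP; exists c.
by move=> H; apply/allP => C /cnf_atP [c [H1 H2 ->]]; apply: H.
Qed.

Lemma size_positions (P : option token -> bool) :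
  size [seq p <- iota 0 (size u) | P (at_ u p)] = count P u.
Proof.
rewrite size_filter -[in RHS](mkseq_nth None u) /mkseq count_map.
by apply: eq_count => p.
Qed.
End PositionSets.

Definition is_TB (t : option token) : bool := if t is Some (TB _) then true else false.
Definition is_TR (t : option token) : bool := if t is Some TR then true else false.

Lemma boolE (x y : bool) : ((x -> y) /\ (y -> x)) <-> x = y.
Proof. by split=> [[H1 H2]|->] //; apply/idP/idP. Qed.

Section Core.
Variables (z : seq bool) (T : theory) (B : seq nat) (m : nat).
Hypothesis Hz : z = pair_enc (enc_instance T B) (nseq m true).
Let u := emit (Mk W0, [::]) z.
Let N := size z.

Let dec : [/\ tcnf KW u = flatten T.1, trules u = T.2, tbs u = B & count is_TF u = m].
Proof. by apply: decode; rewrite /u Hz; case: (zparse_complete T B m). Qed.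

Let size_u : size u = N. Proof. exact: size_emit. Qed.

Let N_gt0 : 0 < N. Proof. by rewrite /N Hz size_pair_enc; lia. Qed.

Let at0 : at_ u 0 = None. Proof. by rewrite /u at_emit // conf0. Qed.

Lemma rules_pos r : r \in T.2 <-> exists2 p, at_ u p = Some TR & r = rule_at u p.
Proof. by case: dec => _ <- _ _; apply: trulesP. Qed.

Lemma inT_pos C : inT T C <-> exists2 c, isCl u c & C = clause_at u c.
Proof.
case: dec => HW _ _ _; split.
  case=> [[w Hw HC]|[r /rules_pos [p Hp ->]]].
    have : C \in tcnf KW u by rewrite HW; apply/flattenP; exists w.
    by move=> /tcnf_atW [c H ->]; exists c => //; left.
  rewrite !mem_cat => /or3P [] /cnf_atP [c [H1 H2 ->]]; exists c => //; right; exists p.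
  - by left.
  - by right; left.
  - by right; right.
move=> [c [[H1 H2]|[p H]] ->].
  have : clause_at u c \in tcnf KW u by apply/tcnf_atW; exists c.
  by rewrite HW => /flattenP [w Hw HC]; left; exists w.
have Hp : at_ u p = Some TR by case: H => [[]|[[]|[]]].
right; exists (rule_at u p); first by apply/rules_pos; exists p.
rewrite !mem_cat; apply/or3P.
case: H => [[_ H1 H2]|[[_ H1 H2]|[_ H1 H2]]]; [apply: Or31|apply: Or32|apply: Or33];
  by apply/cnf_atP; exists c.
Qed.

Notation isR := (fun p => at_ u p = Some TR).

Lemma Ax_pos G v : Ax T isR (rule_at u) G v <-> forall c, AxP u G c -> evalc v (clause_at u c).
Proof.
case: dec => HW _ _ _; split.
  move=> [H1 H2] c [[Hc1 Hc2]|[r [[Hr Hc1 Hc2] Gr]]].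
    have : clause_at u c \in tcnf KW u by apply/tcnf_atW; exists c.
    by rewrite HW => /flattenP [w Hw HC]; move/allP: (H1 w Hw); apply.
  by have /evalf_at := H2 r Hr Gr; apply.
move=> H; split.
  move=> w Hw; apply/allP => C HC.
  have : C \in tcnf KW u by rewrite HW; apply/flattenP; exists w.
  by move=> /tcnf_atW [c Hc ->]; apply: H; left.
move=> p Hp Gp; apply/evalf_at => c H1 H2; apply: H; right; exists p; split=> //.
Qed.

Lemma AxP_lt G c : AxP u G c -> c < N.
Proof. by case=> [[/at_lt]|[r [[_ _ /at_lt]]]]. Qed.

Let As := [seq p <- iota 0 (size u) | is_TF (at_ u p)].
Let Bs := [seq p <- iota 0 (size u) | is_TB (at_ u p)].

Let mem_As p : p \in As <-> at_ u p = Some TF.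
Proof.
rewrite mem_filter mem_iota add0n leq0n size_u; split.
  by move=> /andP [H _]; case: (at_ u p) H => // -[].
by move=> E; rewrite E (at_lt E).
Qed.

Let mem_Bs p : p \in Bs <-> exists n, at_ u p = Some (TB n).
Proof.
rewrite mem_filter mem_iota add0n leq0n size_u; split.
  by move=> /andP [H _]; case: (at_ u p) H => // -[] // n _; exists n.
by move=> [n E]; rewrite E (at_lt E).
Qed.

Let uA : uniq As. Proof. exact: filter_uniq (iota_uniq _ _). Qed.
Let uB : uniq Bs. Proof. exact: filter_uniq (iota_uniq _ _). Qed.

Let size_As : size As = m.
Proof. by rewrite size_positions; case: dec. Qed.

Let size_Bs : size Bs = size B.
Proof.
rewrite size_positions; case: dec => _ _ <- _; rewrite /tbs size_pmap.
by apply: eq_count => -[[]|].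
Qed.

Section Semantics.
Variable R : rels.
Hypothesis scan : scanned z R.
Let W a b := R 94 a b b b.

Lemma sat_Ax c : c < N -> sat z R (fAx c) <-> AxP u (fun r => R 95 r r r r) c.
Proof.
move=> Hc; cbn [sat fAx fFired]; rewrite (sat_ClW scan) //; split.
  by case=> [H|[r Hr [H1 H2]]]; [left|right; exists r; split=> //; apply/(sat_ClR scan)].
case=> [H|[r [H1 H2]]]; [by left|right]; have [Hr _ _] := H1.
by exists r; [exact: at_lt Hr|split=> //; apply/(sat_ClR scan)].
Qed.

Lemma sat_AxBefore r' c : c < N ->
  sat z R (fAxBefore r' c) <-> AxP u (fun r => R 95 r r r r /\ R 96 r r' r' r') c.
Proof.
move=> Hc; cbn [sat fAxBefore fFired fOrd]; rewrite (sat_ClW scan) //; split.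
  by case=> [H|[r Hr [[H1 H2] H3]]]; [left|right; exists r; split=> //; apply/(sat_ClR scan)].
case=> [H|[r [H1 [H2 H3]]]]; [by left|right]; have [Hr _ _] := H1.
by exists r; [exact: at_lt Hr|split=> //; split=> //; apply/(sat_ClR scan)].
Qed.

Lemma sat_Cl c : c < N -> sat z R (fCl c) <-> isCl u c.
Proof.
move=> Hc; cbn [sat fCl]; rewrite (sat_ClW scan) //; split.
  case=> [H|[r Hr H]]; [by left|right; exists r].
  by move: H; rewrite !(sat_ClR scan) //; tauto.
case=> [H|[r H]]; [by left|right; exists r; last by rewrite !(sat_ClR scan) //; tauto].
by case: H => [[/at_lt]|[[/at_lt]|[/at_lt]]].
Qed.

Lemma sat_sameL l n b l' n' b' : at_ u l = Some (TL n b) -> at_ u l' = Some (TL n' b') ->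
  sat z R (fSame l l') <-> n = n'.
Proof. by move=> El El'; apply: (sat_same scan); rewrite -/u ?El ?El'. Qed.

Lemma sat_sameB l n b p : at_ u l = Some (TL n b) -> p < N ->
  (sat z R (fB p) /\ sat z R (fSame l p)) <-> at_ u p = Some (TB n).
Proof.
move=> El Hp; rewrite (sat_B scan) //; split.
  move=> [[n' En'] Hs]; rewrite En'; congr (Some (TB _)).
  have S : sat z R (fSame l p) <-> n = n' by apply: (sat_same scan); rewrite -/u ?El ?En'.
  by rewrite (S.1 Hs).
move=> E; split; first by exists n.
have S : sat z R (fSame l p) <-> n = n by apply: (sat_same scan); rewrite -/u ?El ?E.
exact/S.
Qed.

Lemma sat_InB l n b : at_ u l = Some (TL n b) ->
  sat z R (fInB l) <-> exists p, at_ u p = Some (TB n).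
Proof.
move=> El; cbn [sat fInB]; split.
  by move=> [p Hp /(sat_sameB El Hp)]; exists p.
by move=> [p Ep]; have Hp := at_lt Ep; exists p => //; apply/(sat_sameB El Hp).
Qed.

Lemma sat_falseB a l n b : at_ u l = Some (TL n b) ->
  sat z R (fFalseB a l) <-> falseB u W a n b.
Proof.
move=> El; cbn [sat fFalseB fVal]; rewrite (at_sign El); split.
  by move=> [p Hp [/(sat_sameB El Hp) H1 H2]]; exists p => // E; apply: H2; apply/boolE.
move=> [p Ep H]; have Hp := at_lt Ep; exists p => //; split; first by apply/(sat_sameB El Hp).
by move/boolE.
Qed.

Lemma sat_trueB a l n b : at_ u l = Some (TL n b) ->
  sat z R (fTrueB a l) <-> trueB u W a n b.
Proof.
move=> El; cbn [sat fTrueB fVal]; rewrite (at_sign El); split.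
  by move=> [p Hp [/(sat_sameB El Hp) H1 H2]]; exists p => //; apply/boolE.
move=> [p Ep H]; have Hp := at_lt Ep; exists p => //; split; first by apply/(sat_sameB El Hp).
exact/boolE.
Qed.

Section Query.
Variables (prem extra : nat -> fo nat) (premP extraP : nat -> Prop) (q a : nat).
Hypothesis Hprem : forall c, c < N -> sat z R (prem c) <-> premP c.
Hypothesis HpremN : forall c, premP c -> c < N.
Hypothesis Hextra : forall l, l < N -> sat z R (extra l) <-> extraP l.
Hypothesis HextraL : forall l, extraP l -> isLit u l.

Lemma sat_fire s (D : nat -> Prop) v n b : (forall l, D l <-> R 97 q a s l) ->
  at_ u v = Some (TL n b) ->
  sat z R (fFire prem extra q a s v) <-> fire u W premP extraP a D n.
Proof.
move=> HD Ev; have Hv := at_lt Ev; cbn [sat fFire fStage]; split.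
  case=> [[c Hc [Pc H]]|[l Hl [[Pl Bl] Sl]]].
    left; exists c; first exact/Hprem.
    move=> l n' b' Il El; have Hl := at_lt El.
    have := H l Hl; rewrite (at_sign El) (sat_falseB a El) (sat_sameL El Ev).
    case; first by apply/(sat_InC scan) => //; split=> //; exists n', b'.
      case=> [H1|[/negP/negbTE H1 /HD H2]]; [by left|by right; left].
    by case=> H1 H2; right; right.
  have /HextraL [n' [b' El]] := (Hextra Hl).1 Pl.
  right; exists l; first exact/Hextra.
  move: Bl Sl; rewrite (at_sign El) (sat_sameL El Ev) => /negP/negbTE Eb En.
  by rewrite El Eb En.
case=> [[c Pc H]|[l Pl El]].
  have Hc := HpremN Pc; left; exists c => //; split; first exact/Hprem.
  move=> l Hl /(sat_InC scan) -/(_ Hl) [Il [n' [b' El]]].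
  rewrite (at_sign El) (sat_falseB a El) (sat_sameL El Ev).
  case: (H l n' b' Il El) => [H1|[[-> /HD H1]|[-> H1]]]; [by left; left|by left; right|by right].
have Hl := at_lt El; right; exists l => //.
rewrite (at_sign El) (sat_sameL El Ev).
by split=> //; split=> //; apply/Hextra.
Qed.

Lemma sat_conflict s (D : nat -> Prop) : (forall l, D l <-> R 97 q a s l) ->
  sat z R (fConflict prem extra q a s) <-> conflict u W premP extraP a D.
Proof.
move=> HD; cbn [sat fConflict fStage]; split.
  case=> [[c Hc [Pc H]]|[l Hl [Pl H]]].
    left; exists c; first exact/Hprem.
    move=> l n' b' Il El; have Hl := at_lt El.
    have := H l Hl; rewrite (at_sign El) (sat_falseB a El).
    case; first by apply/(sat_InC scan) => //; split=> //; exists n', b'.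
      by left.
    by move=> [/negP/negbTE H1 /HD H2]; right.
  have /HextraL [n' [b' El]] := (Hextra Hl).1 Pl.
  right; exists l, n', b'; split=> //; first exact/Hextra.
  move: H; rewrite (at_sign El) (sat_trueB a El).
  by case=> [?|[H1 /HD H2]]; [left|right].
case=> [[c Pc H]|[l [n' [b' [Pl El H]]]]].
  have Hc := HpremN Pc; left; exists c => //; split; first exact/Hprem.
  move=> l Hl /(sat_InC scan) -/(_ Hl) [Il [n' [b' El]]].
  rewrite (at_sign El) (sat_falseB a El).
  by case: (H l n' b' Il El) => [H1|[-> /HD H1]]; [left|right].
have Hl := at_lt El; right; exists l => //; split; first exact/Hextra.
rewrite (at_sign El) (sat_trueB a El).
by case: H => [?|[-> /HD H]]; [left|right].
Qed.
End Query.

Definition unsat (premP extraP : nat -> Prop) : Prop := forall v,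
  (forall c, premP c -> evalc v (clause_at u c)) ->
  (forall l n b, extraP l -> at_ u l = Some (TL n b) -> v n <> b) -> False.

Section Queries.
Variables (prem extra : nat -> fo nat) (premP extraP : nat -> Prop) (q : nat).
Hypothesis Hprem : forall c, c < N -> sat z R (prem c) <-> premP c.
Hypothesis HpremN : forall c, premP c -> c < N.
Hypothesis Hextra : forall l, l < N -> sat z R (extra l) <-> extraP l.
Hypothesis HextraL : forall l, extraP l -> isLit u l.

(** The restriction of [v] to the backdoor has a name [a], and the refutation stored for [a]
    excludes [v]. Stages are cut down to positions below [N], the range of the quantifiers. *)
Lemma refute_unsat :
  (forall f : nat -> bool, exists2 a, at_ u a = Some TF &
     forall p n, at_ u p = Some (TB n) -> W a p = f n) ->
  sat z R (fRefute prem extra q) -> unsat premP extraP.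
Proof.
move=> Hall; cbn [sat fRefute fStage] => H v Hv1 Hv2.
have [a Ea Ha] := Hall v; have aN := at_lt Ea.
have [[s sN Hs] Hst] := H a aN ((sat_F scan aN).2 Ea).
apply: (@refute_sound u W premP extraP a (fun s l => s < N /\ R 97 q a s l) v) => //.
  move=> s' l n b El [s'N Hl]; have lN := at_lt El.
  have [|t tN [tlt Ht]] := Hst s' s'N l lN _ Hl; first by apply/(sat_LE scan) => //; exists n, b.
  exists t => //; apply/(sat_fire Hprem HpremN Hextra HextraL (q := q) (s := t) _ El) => // l'.
  by split=> [[]|].
by exists s; apply/(sat_conflict Hprem HpremN Hextra HextraL (q := q) (s := s)) => // l; split=> [[]|].
Qed.

Hypothesis uniqB : forall p q n, at_ u p = Some (TB n) -> at_ u q = Some (TB n) -> p = q.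
Hypothesis horn : forall c, premP c -> forall l l' n b n' b', l < l' -> inC u c l -> inC u c l' ->
    at_ u l = Some (TL n b) -> at_ u l' = Some (TL n' b') -> b -> b' ->
    (forall p, at_ u p <> Some (TB n)) -> (forall p, at_ u p <> Some (TB n')) -> False.

(** The canonical stages serve as the relation; [refute_complete] finds a conflict at a stage below
    [size u], which a position can name. *)
Lemma unsat_refute : unsat premP extraP ->
  (forall a s l, R 97 q a s l <-> stage u W premP extraP a s l) ->
  sat z R (fRefute prem extra q).
Proof.
move=> Hun HR; cbn [sat fRefute fStage] => a aN _.
have HR' s l : stage u W premP extraP a s l <-> R 97 q a s l by rewrite HR.
split.
  have [|||s Hs Hc] := @refute_complete u W premP extraP a uniqB horn.
  - by rewrite size_u.
  - by move=> n b; rewrite at0.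
  - by move=> v _; apply: Hun.
  rewrite size_u in Hs; exists s => //.
  by apply/(sat_conflict Hprem HpremN Hextra HextraL (HR' s)).
move=> s sN l lN /(sat_LE scan) -/(_ lN) [n [b El]] /HR Hl.
have [s' Hs' Hf] := stageP El Hl; exists s'; first by rewrite /N in sN *; lia.
by split=> //; apply/(sat_fire Hprem HpremN Hextra HextraL (HR' s') El).
Qed.
End Queries.

Lemma sat_holds q c v : (forall l n b, at_ u l = Some (TL n b) -> R 98 q l l l = v n) ->
  sat z R (fHolds q c) <-> evalc v (clause_at u c).
Proof.
move=> Hv; cbn [sat fHolds fMod]; split.
  move=> [l Hl [/(sat_InC scan) -/(_ Hl) [Il [n [b El]]]]].
  rewrite (at_sign El) (Hv l n b El) => /boolE E.
  by apply/hasP; exists (n, b); [apply/clause_atP; exists l|rewrite /= E].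
move=> /hasP [[n b] /clause_atP [l Il El] /= /eqP E]; have Hl := at_lt El.
exists l => //; split; first by apply/(sat_InC scan) => //; split=> //; exists n, b.
by rewrite (at_sign El) (Hv l n b El); apply/boolE.
Qed.
End Semantics.

Lemma flip_iff (x w : bool) (b b' : nat) :
  ((x -> (b = b' /\ ~ w) \/ (b <> b' /\ w)) /\ ((b = b' /\ ~ w) \/ (b <> b' /\ w) -> x))
  <-> x = (b' == b) (+) w.
Proof.
have F : ~ false by []. have I := isT.
rewrite eq_sym; case: (b =P b') => Hb; case: w; case: x => /=; split=> //; try by intuition.
Qed.

Lemma isCl_lt c : isCl u c -> c < N.
Proof. by case=> [[/at_lt]|[r [[_ _ /at_lt]|[[_ _ /at_lt]|[_ _ /at_lt]]]]]. Qed.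

Definition sbd_conditions : Prop :=
  [/\ m = 2 ^ size B, uniq B, no_taut T & all (fun v => v \in vars_theory T) B] /\
  strong_horn_backdoor B T /\ has_consistent_stable_extension T.

Lemma core_sound R : scanned z R -> sat z R (theory_axioms nat) -> sbd_conditions.
Proof.
move=> scan; cbn [sat theory_axioms].
move=> [[[[[[[[[[[[[HU HT] HVa] HH] HSo] HFl] HDi] HIr] HTr] HFi] HMo] HCo] HJu] HBl].
pose W a b := R 94 a b b b.
have [a0 Ha0] : exists a0, a0 \in As.
  by cbn [sat axSome] in HSo; have [a aN Ha] := HSo; exists a; apply/mem_As/(sat_F scan).
have FC : flip_closed As Bs W.
  move=> a b /mem_As Ea /mem_Bs [n Eb]; cbn [sat axFlip fVal] in HFl.
  have aN := at_lt Ea; have bN := at_lt Eb.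
  have [|a' a'N [Fa' H]] := HFl a aN b bN ((sat_F scan aN).2 Ea); first by apply/(sat_B scan) => //; exists n.
  exists a'; first exact/mem_As/(sat_F scan).
  move=> b' /mem_Bs [n' Eb']; have b'N := at_lt Eb'.
  have := H b' b'N; rewrite !sat_eq (sat_B scan) // => H'.
  by apply/flip_iff; apply: H'; exists n'.
have SP : separated As Bs W.
  move=> a a' /mem_As Ea /mem_As Ea' Hne; cbn [sat axDiff fVal] in HDi.
  have aN := at_lt Ea; have a'N := at_lt Ea'.
  have := HDi a aN a' a'N ((sat_F scan aN).2 Ea) ((sat_F scan a'N).2 Ea').
  rewrite sat_eq => /(_ Hne) [b bN [Bb Hb]].
  exists b; first exact/mem_Bs/(sat_B scan).
  by move=> E; apply: Hb; apply/boolE.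
have Hall (f : nat -> bool) : exists2 a, at_ u a = Some TF & forall p n, at_ u p = Some (TB n) -> W a p = f n.
  have [a /mem_As Ea H] := flip_closed_all FC Ha0 (fun p => if at_ u p is Some (TB n) then f n else false).
  exists a => // p n Ep; rewrite H ?Ep //.
  by apply/mem_Bs; exists n.
have [_ _ HB _] := dec.
split; first split.
- by rewrite -size_As -size_Bs; apply: (flip_closed_size uA uB FC SP Ha0).
- rewrite -HB; apply/uniq_tbs => p q n Ep Eq; cbn [sat axUniq] in HU.
  have pN := at_lt Ep; have qN := at_lt Eq.
  apply/(@sat_eq z R); apply: HU => //; try by apply/(sat_B scan) => //; exists n.
  have S : sat z R (fSame p q) <-> n = n by apply: (sat_same scan); rewrite -/u ?Ep ?Eq.
  exact/S.
- apply/no_tautE => C /inT_pos [c Hc ->]; have cN := isCl_lt Hc.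
  apply/hasP => -[[n b] /clause_atP [l Il El] /clause_atP [l' Il' El']].
  have lN := at_lt El; have l'N := at_lt El'; cbn [sat axTaut] in HT.
  have Hc' := (sat_Cl scan cN).2 Hc.
  have Sl : sat z R (fInC c l) by apply/(sat_InC scan) => //; split=> //; do 2 eexists; exact: El.
  have Sl' : sat z R (fInC c l') by apply/(sat_InC scan) => //; split=> //; do 2 eexists; exact: El'.
  have T1 := HT c cN l lN l' l'N Hc' Sl Sl' ((sat_sameL scan El El').2 erefl).
  have T2 := HT c cN l' l'N l lN Hc' Sl' Sl ((sat_sameL scan El' El).2 erefl).
  move: T1 T2; rewrite (at_sign El) (at_sign El') /=; case: (b) => T1 T2.
    by have := T1 isT.
  by have := T2 isT.
- apply/allP => n Hn; have /tbsP [p Ep] : n \in tbs u by rewrite HB.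
  have pN := at_lt Ep.
  cbn [sat axVars] in HVa.
  have [|c cN [l lN [[Hc Hl] Hs]]] := HVa p pN; first by apply/(sat_B scan) => //; exists n.
  have [Il [n' [b' El]]] := (sat_InC scan c lN).1 Hl.
  have S : sat z R (fSame p l) <-> n = n' by apply: (sat_same scan); rewrite -/u ?Ep ?El.
  apply/vars_theoryE; exists (clause_at u c); first by apply/inT_pos; exists c => //; apply/(sat_Cl scan).
  by exists b'; apply/clause_atP; exists l => //; rewrite El (S.1 Hs).
split.
  apply/backdoorE => C /inT_pos [c Hc ->]; have cN := isCl_lt Hc.
  apply/count_clause_at => l l' n b n' b' Hll Il Il' El El' /andP [b1 nB] /andP [b2 nB'].
  have lN := at_lt El; have l'N := at_lt El'; cbn [sat axHorn] in HH.
  have Sl : sat z R (fInC c l) by apply/(sat_InC scan) => //; split=> //; do 2 eexists; exact: El.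
  have Sl' : sat z R (fInC c l') by apply/(sat_InC scan) => //; split=> //; do 2 eexists; exact: El'.
  apply: (HH c cN l lN l' l'N ((sat_Cl scan cN).2 Hc) Sl Sl' _ _ _ _ Hll).
  - by rewrite (at_sign El).
  - by rewrite (at_sign El').
  - rewrite (sat_InB scan El) => /tbsP; rewrite HB => H; by rewrite /= H in nB.
  - rewrite (sat_InB scan El') => /tbsP; rewrite HB => H; by rewrite /= H in nB'.
pose G r : Prop := R 95 r r r r.
(* The height counts predecessors in the guessed order; transitivity and irreflexivity make it
   strictly increasing. *)
pose ht r := size [seq x <- iota 0 N | R 96 x r r r].
have ht_lt r p : r < N -> p < N -> R 96 r p p p -> ht r < ht p.
  move=> rN pN Hrp; cbn [sat axIrr axTrans fOrd] in HIr, HTr.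
  have sub : {subset [seq x <- iota 0 N | R 96 x r r r] <= [seq x <- iota 0 N | R 96 x p p p]}.
    move=> x; rewrite !mem_filter => /andP [H Hx]; rewrite Hx andbT.
    by apply: HTr H Hrp => //; move: Hx; rewrite mem_iota.
  rewrite /ht ltnNge; apply/negP => Hle.
  have [_ Eq] := uniq_min_size (filter_uniq _ (iota_uniq _ _)) sub Hle.
  have : r \in [seq x <- iota 0 N | R 96 x p p p] by rewrite mem_filter Hrp mem_iota.
  by rewrite -Eq mem_filter => /andP [/(HIr r rN)].
(* By [axMod] relation 98 depends on the variable and not on its occurrence, so it comes from a
   valuation. *)
have model q : q < N -> exists v, forall l n b, at_ u l = Some (TL n b) -> R 98 q l l l = v n.
  move=> qN; exists (fun n => `[< exists l b, at_ u l = Some (TL n b) /\ R 98 q l l l >]) => l n b El.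
  apply/idP/asboolP => [H|[l' [b' [El' H']]]]; first by exists l, b.
  have lN := at_lt El; have l'N := at_lt El'; cbn [sat axMod fMod] in HMo.
  apply: (HMo q qN l' l'N l lN _ _ _ H').
  - by apply/(sat_LE scan) => //; do 2 eexists; exact: El'.
  - by apply/(sat_LE scan) => //; do 2 eexists; exact: El.
  - exact/(sat_sameL scan El' El).
have AxH q v : (forall c, c < N -> sat z R (fAx c) -> sat z R (fHolds q c)) ->
    (forall l n b, at_ u l = Some (TL n b) -> R 98 q l l l = v n) -> Ax T (fun p => at_ u p = Some TR) (rule_at u) G v.
  move=> H Hv; apply/Ax_pos => c Hc; have cN := AxP_lt Hc.
  by apply/(sat_holds scan c Hv); apply: H => //; apply/(sat_Ax scan).
apply: (@stable_sound T (fun p => at_ u p = Some TR) (rule_at u) rules_pos G ht); split.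
- cbn [sat axCons] in HCo; have [q qN Hq] := HCo; have [v Hv] := model q qN.
  by exists v; apply: AxH Hv.
- move=> p Ep Gp v /Ax_pos Hv; apply/evalf_at => c Ic Ec; apply: contrapT => /negP/hasPn Hno.
  have pN := at_lt Ep; have cN := at_lt Ec; cbn [sat axFired fFired] in HFi.
  have Hr := HFi p pN c cN Gp ((sat_ClR scan KP p cN).2 (And3 Ep Ic Ec)).
  (* If the prerequisite clause [c] were false in [v], then [v] would satisfy the premises of a
     refuted query and falsify all its assumed literals. *)
  apply: (@refute_unsat R scan (fAxBefore p) (fInC c) (AxP u (fun r => R 95 r r r r /\ R 96 r p p p))
     (fun l => inC u c l /\ isLit u l) c _ _ _ _ Hall Hr v).
  + by move=> c' c'N; apply: sat_AxBefore.
  + by move=> c'; apply: AxP_lt.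
  + by move=> l lN; apply: (sat_InC scan).
  + by move=> l [].
  + move=> c' [HW|[r [Hc' [Gr Or]]]]; apply: Hv; first by left.
    right; exists r; split=> //; split=> //; apply: ht_lt => //.
    by case: Hc' => /at_lt.
  + move=> l n b [Il _] El E; have := Hno (n, b); rewrite /= E eqxx => H.
    by have := H ((clause_atP u c n b).2 (ex_intro2 _ _ l Il El)).
- move=> p Ep Gp; have pN := at_lt Ep; have [v Hv] := model p pN; cbn [sat axJust fFired] in HJu.
  exists v; first by apply: AxH Hv => c cN Hc; apply: HJu => //; [apply/(sat_R scan)|left].
  apply/evalf_at => c Ic Ec; have cN := at_lt Ec.
  apply/(sat_holds scan c Hv); apply: HJu => //; first exact/(sat_R scan).
  by right; apply/(sat_ClR scan).
- move=> p Ep nG; have pN := at_lt Ep; cbn [sat axBlocked fFired fMod] in HBl.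
  case: (HBl p pN ((sat_R scan pN).2 Ep) nG) => [[H1 [c cN [Hc Hl]]]|Hr].
    left; have [v Hv] := model p pN; exists v; first exact: AxH Hv.
    have [_ Ic Ec] := (sat_ClR scan KP p cN).1 Hc.
    apply/negP => /evalf_at /(_ c Ic Ec) /hasP [[n b] /clause_atP [l Il El] /eqP E].
    have lN := at_lt El; apply: (Hl l lN); first by apply/(sat_InC scan) => //; split=> //; exists n, b.
    by rewrite (at_sign El) (Hv l n b El); apply/boolE.
  right=> v /Ax_pos Hv; apply/negP => /evalf_at Hj.
  apply: (@refute_unsat R scan (fun c => QOr (fAx c) (fClR KJ p c)) (fun l => QLt l l)
     (fun c => AxP u G c \/ ClR u KJ p c) (fun=> False) p _ _ _ _ Hall Hr v) => //.
  + by move=> c cN; cbn [sat]; rewrite (sat_Ax scan) // (sat_ClR scan).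
  + by move=> c [/AxP_lt|[_ _ /at_lt]].
  + by move=> l lN; cbn [sat]; rewrite ltnn.
  + by move=> c [/Hv|[_ Ic Ec]] //; apply: Hj.
Qed.

Lemma core_complete : sbd_conditions ->
  exists R, scanned z R /\ sat z R (theory_axioms nat).
Proof.
move=> [[Hm HuB Hnt Hvars] [Hbd Hcse]].
have [_ _ HB _] := dec.
have [|G [ht [[v0 Hv0] Hpre Hjust Hout]]] := @stable_complete T (fun p => at_ u p = Some TR) (rule_at u) rules_pos N _ Hcse.
  by move=> p /at_lt.
have [W [[a0 /mem_As Ea0] FC SP]] : exists W, [/\ exists a, a \in As, flip_closed As Bs W & separated As Bs W].
  by apply: enumeration_exists => //; rewrite size_As size_Bs.
(* One model per rule is enough: it satisfies the justification if the rule generates, and falsifies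
   the prerequisite otherwise. A rule admitting no such model is blocked by a refutation and gets
   [v0]. *)
pose goodv r v := Ax T (fun p => at_ u p = Some TR) (rule_at u) G v /\
  (if pselect (G r) then evalf v (rjust (rule_at u r)) else ~~ evalf v (rpre (rule_at u r))).
pose mv r := if pselect (exists v, goodv r v) is left h then projT1 (cid h) else v0.
have mvAx r : Ax T (fun p => at_ u p = Some TR) (rule_at u) G (mv r).
  by rewrite /mv; case: pselect => // h; case: (cid h) => v [].
have mvP r v : goodv r v -> goodv r (mv r).
  by move=> Hv; rewrite /mv; case: pselect => [h|[]]; [case: (cid h)|exists v].
(* A prerequisite query is named by its clause position [q]; the rule [r] is unique by [ClR_uniq],
   which fixes the height bound. *)
pose premE q c := exists2 r, ClR u KP r q & AxP u (fun r' => G r' /\ ht r' < ht r) c.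
pose extraE q l := inC u q l /\ isLit u l.
pose premU q c := AxP u G c \/ ClR u KJ q c.
(* Rule starts name justification queries; every other position is read as a prerequisite query. *)
pose RK q a s l : bool := if is_TR (at_ u q)
  then `[< stage u W (premU q) (fun=> False) a s l >]
  else `[< stage u W (premE q) (extraE q) a s l >].
pose MOD q l := if at_ u l is Some (TL n _) then mv q n else false.
pose R : rels := fun i p q r s =>
  if i < 93 then i == zc (conf z p).1 else
  match i - 93 with
  | 0 => (conf z p).2 == (conf z q).2
  | 1 => W p q
  | 2 => `[< G p >]
  | 3 => ht p < ht q
  | 4 => RK p q r s
  | _ => MOD p q
  end.
have scan : scanned z R.
  split.
  - by move=> p s _; rewrite /R zc_lt; split=> [/eqP/zc_inj ->|->].
  - by move=> p q _ _ _ _; rewrite /R /=; split=> [/eqP|->].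
  - by rewrite Hz; case: (zparse_complete T B m).
exists R; split=> //.
have uniqB p q n : at_ u p = Some (TB n) -> at_ u q = Some (TB n) -> p = q.
  by apply: (uniq_tbs u).1; rewrite HB.
have hornC c : isCl u c -> forall l l' n b n' b', l < l' -> inC u c l -> inC u c l' ->
    at_ u l = Some (TL n b) -> at_ u l' = Some (TL n' b') -> b -> b' ->
    (forall p, at_ u p <> Some (TB n)) -> (forall p, at_ u p <> Some (TB n')) -> False.
  move=> Hc l l' n b n' b' Hll Il Il' El El' b1 b2 nB nB'.
  have := (backdoorE B T).1 Hbd (clause_at u c) ((inT_pos _).2 (ex_intro2 _ _ c Hc erefl)).
  move=> /count_clause_at /(_ l l' n b n' b' Hll Il Il' El El'); apply; rewrite /= ?b1 ?b2 /=; apply/negP.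
    by rewrite -HB => /tbsP [p]; apply: nB.
  by rewrite -HB => /tbsP [p]; apply: nB'.
have AxCl G' c : AxP u G' c -> isCl u c.
  by case=> [H|[r [H _]]]; [left|right; exists r; right; right].
have modE q l n b : at_ u l = Some (TL n b) -> R 98 q l l l = mv q n.
  by move=> El; rewrite /R /= /MOD El.
have GE r : R 95 r r r r <-> G r by rewrite /R /=; split=> /asboolP.
have AxGE c : AxP u (fun r => R 95 r r r r) c <-> AxP u G c.
  by split=> -[H|[r [H1 H2]]]; [left|right; exists r; split=> //; apply/GE|left|right; exists r; split=> //; apply/GE].
have axHolds q c : c < N -> sat z R (fAx c) -> sat z R (fHolds q c).
  move=> cN /(sat_Ax scan cN) /AxGE Hc.
  by apply/(sat_holds scan c (modE q)); move/Ax_pos: (mvAx q); apply.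
have A_uniq : sat z R (axUniq nat).
  cbn [sat axUniq] => b bN b' b'N /(sat_B scan bN) [n Eb] /(sat_B scan b'N) [n' Eb'] Hs.
  have S : sat z R (fSame b b') <-> n = n' by apply: (sat_same scan); rewrite -/u ?Eb ?Eb'.
  by apply/sat_eq; apply: (uniqB _ _ n Eb); rewrite (S.1 Hs).
have A_taut : sat z R (axTaut nat).
  cbn [sat axTaut] => c cN l lN l' l'N /(sat_Cl scan cN) Hc.
  move=> /(sat_InC scan c lN) [Il [n [b El]]] /(sat_InC scan c l'N) [Il' [n' [b' El']]].
  move=> /(sat_sameL scan El El') En; rewrite (at_sign El) (at_sign El') => Hb.
  apply: contrapT => /negP/negbTE nb'.
  have := (no_tautE T).1 Hnt (clause_at u c) ((inT_pos _).2 (ex_intro2 _ _ c Hc erefl)).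
  case/negP; apply/hasP; exists (n, b); first by apply/clause_atP; exists l.
  by apply/clause_atP; exists l' => //; rewrite El' En nb' Hb.
have A_vars : sat z R (axVars nat).
  cbn [sat axVars] => p pN /(sat_B scan pN) [n Ep].
  have nB : n \in B by rewrite -HB; apply/tbsP; exists p.
  have /vars_theoryE [C /inT_pos [c Hc ->] [b /clause_atP [l Il El]]] := allP Hvars n nB.
  have cN := isCl_lt Hc; have lN := at_lt El.
  exists c => //; exists l => //; split; first split.
  - exact/(sat_Cl scan).
  - by apply/(sat_InC scan) => //; split=> //; exists n, b.
  - have S : sat z R (fSame p l) <-> n = n by apply: (sat_same scan); rewrite -/u ?Ep ?El.
    exact/S.
have A_horn : sat z R (axHorn nat).
  cbn [sat axHorn] => c cN l lN l' l'N /(sat_Cl scan cN) Hc.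
  move=> /(sat_InC scan c lN) [Il [n [b El]]] /(sat_InC scan c l'N) [Il' [n' [b' El']]].
  rewrite (at_sign El) (at_sign El') (sat_InB scan El) (sat_InB scan El') => b1 b2 nB nB' Hll.
  apply: (hornC c Hc l l' n b n' b') => // p Ep; first by apply: nB; exists p.
  by apply: nB'; exists p.
have A_some : sat z R (axSome nat).
  by cbn [sat axSome]; have aN := at_lt Ea0; exists a0 => //; apply/(sat_F scan).
have A_flip : sat z R (axFlip nat).
  cbn [sat axFlip fVal] => a aN b bN /(sat_F scan aN) Ea /(sat_B scan bN) Eb.
  have [a' /mem_As Ea' H] := FC a b ((mem_As a).2 Ea) ((mem_Bs b).2 Eb).
  have a'N := at_lt Ea'; exists a' => //; split; first exact/(sat_F scan).
  move=> b' b'N /(sat_B scan b'N) Eb'; rewrite !sat_eq; apply/flip_iff.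
  by apply: H; apply/mem_Bs.
have A_diff : sat z R (axDiff nat).
  cbn [sat axDiff fVal] => a aN a' a'N /(sat_F scan aN) Ea /(sat_F scan a'N) Ea'; rewrite sat_eq => Hne.
  have [b /mem_Bs Eb Hb] := SP a a' ((mem_As a).2 Ea) ((mem_As a').2 Ea') Hne.
  have bN : b < size z by case: Eb => n /at_lt.
  by exists b => //; split; [apply/(sat_B scan)|move/boolE].
have A_irr : sat z R (axIrr nat).
  by cbn [sat axIrr fOrd] => r rN; rewrite /R /= ltnn.
have A_trans : sat z R (axTrans nat).
  by cbn [sat axTrans fOrd] => x xN y yN w wN; rewrite /R /=; apply: ltn_trans.
have A_fired : sat z R (axFired nat).
  cbn [sat axFired fFired] => r rN c cN /GE Gr /(sat_ClR scan KP r cN) Hc; have [Er Ic Ec] := Hc.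
  apply: (@unsat_refute R scan (fAxBefore r) (fInC c) (premE c) (extraE c) c).
  - move=> c' c'N; rewrite (sat_AxBefore scan r c'N); split.
      move=> H; exists r => //; case: H => [H|[r' [H1 [/GE H2 H3]]]]; [by left|right].
      by exists r'.
    move=> [r1 H1 H]; move: H; rewrite (ClR_uniq H1 Hc).
    case=> [H|[r' [H2 [H3 H4]]]]; [by left|right; exists r'; split=> //; split=> //].
    exact/GE.
  - by move=> c' [r1 _ /AxP_lt].
  - by move=> l lN; apply: (sat_InC scan).
  - by move=> l [].
  - exact: uniqB.
  - by move=> c' [r1 _ /AxCl /hornC H].
  - move=> v Hv1 Hv2.
    have : evalf v (rpre (rule_at u r)).
      apply: Hpre => //; apply/Ax_pos => c' Hc'; apply: Hv1; by exists r.
    move=> /evalf_at /(_ c Ic Ec) /hasP [[n b] /clause_atP [l Il El] /eqP E].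
    by apply: (Hv2 l n b) => //; split=> //; exists n, b.
  - by move=> a s l; rewrite /R /= /RK Ec /=; split=> /asboolP.
have A_mod : sat z R (axMod nat).
  cbn [sat axMod fMod] => q qN l lN l' l'N /(sat_LE scan lN) [n [b El]] /(sat_LE scan l'N) [n' [b' El']].
  by move=> /(sat_sameL scan El El') En; rewrite (modE q l n b El) (modE q l' n' b' El') En.
have A_cons : sat z R (axCons nat).
  (* Each [mv q] satisfies the axioms, so any position could be the witness. *)
  by cbn [sat axCons]; exists 0 => // c cN; apply: axHolds.
have A_just : sat z R (axJust nat).
  cbn [sat axJust fFired] => r rN c cN /(sat_R scan rN) Er /GE Gr [|/(sat_ClR scan KJ r cN) [_ Ic Ec]].
    exact: axHolds.
  have [v Hv Hj] := Hjust r Er Gr.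
  have [_] : goodv r (mv r) by apply: (mvP r v); split=> //; case: pselect.
  case: pselect => // _ /evalf_at /(_ c Ic Ec) H.
  exact/(sat_holds scan c (modE r)).
have A_blocked : sat z R (axBlocked nat).
  cbn [sat axBlocked fFired fMod] => r rN /(sat_R scan rN) Er nG.
  have nG' : ~ G r by move/GE.
  case: (Hout r Er nG') => [[v Hv Hp]|Hu].
    left; split; first by move=> c cN; apply: axHolds.
    have [_] : goodv r (mv r) by apply: (mvP r v); split=> //; case: pselect.
    case: pselect => // _ /allPn [C /cnf_atP [c [Ic Ec ->]] /hasPn nC].
    have cN := at_lt Ec; exists c => //; split; first exact/(sat_ClR scan).
    move=> l lN /(sat_InC scan c lN) [Il [n [b El]]].
    rewrite (at_sign El) (modE r l n b El) => /boolE E.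
    by have := nC (n, b) ((clause_atP u c n b).2 (ex_intro2 _ _ l Il El)); rewrite /= E eqxx.
  right; apply: (@unsat_refute R scan (fun c => QOr (fAx c) (fClR KJ r c)) (fun l => QLt l l) (premU r) (fun=> False) r) => //.
  - by move=> c cN; cbn [sat]; rewrite (sat_Ax scan) // (sat_ClR scan) // AxGE.
  - by move=> c [/AxP_lt|[_ _ /at_lt]].
  - by move=> l lN; cbn [sat]; rewrite ltnn.
  - by move=> c Hc; apply: hornC; case: Hc => [/AxCl //|H]; right; exists r; right; left.
  - move=> v Hv1 _; apply: (negP (Hu v _)).
      by apply/Ax_pos => c Hc; apply: Hv1; left.
    by apply/evalf_at => c Ic Ec; apply: Hv1; right.
  - by move=> a s l; rewrite /R /= /RK Er /=; split=> /asboolP.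
cbn [sat theory_axioms].
by do 13!(split; last by []).
Qed.
End Core.

Theorem mainTheorem8 : paraNP SBD_EXT_Horn.
Proof.
exists (fun k => nseq (2 ^ k) true); split; first exact: pow2_computable.
exists (fun z => z <> [::] /\ exists R, sat z R (sbd_formula nat)); split.
  exact: fagin_inNP eqv_sbd.
move=> x k; set z := pair_enc x (nseq (2 ^ k) true).
have z0 : z <> [::] by move/(congr1 size); rewrite size_pair_enc /=; lia.
split.
  move=> [T [B [Ex [Ek [uB [nt [Hv [Hb Hc]]]]]]]]; split=> //.
  have Ez : z = pair_enc (enc_instance T B) (nseq (2 ^ k) true) by rewrite /z Ex.
  have [|R [scan th]] := core_complete Ez; first by split=> //; rewrite Ek.
  by exists R; cbn [sat sbd_formula]; split=> //; apply/scan_axiomsE.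
move=> [_ [R]]; cbn [sat sbd_formula] => -[/(scan_axiomsE R z0) scan th].
have [_ _ /zparse_sound [T [B [m Ez]]]] := scan.
have [[Em uB nt Hv] [Hb Hc]] := core_sound Ez scan th.
have [Ex Es] := pair_enc_inj Ez.
exists T, B; split=> //; split=> //.
(* The tail of [z] has length [2 ^ k] and also [m], which the axioms force to be [2 ^ size B];
   injectivity of the power recovers [k]. *)
have : 2 ^ k = 2 ^ size B by rewrite -Em -(size_nseq m true) -Es size_nseq.
by move/eqP; rewrite eqn_exp2l // => /eqP.
Qed.
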